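(* Let $\nu>0$. There exists a constant $C=C(\nu)>0$ such that the following holds. Let $n\ge1$, let $X$ be a centered random variable and $\mathbb{Y}=(Y_1,\dots,Y_n)$ a centered random vector in $\mathbb{R}^n$ such that $X\in\mathbb{D}^{1,2}$ and $Y_j\in\mathbb{D}^{1,2}$ for every $j\in\{1,\dots,n\}$. Then $$d_2\left(\mathbb{P}_{(X,\mathbb{Y})},F(\nu)\otimes\mathbb{P}_{\mathbb{Y}}\right)\le C\,\mathbf{E}\left[\left|2(X+\nu)-\left\langle D(-L)^{-1}X,DX\right\rangle_H\right|\right]+C\sum_{j=1}^n\mathbf{E}\left[\left|\left\langle D(-L)^{-1}X,DY_j\right\rangle_H\right|\right].$$ If moreover $X\in\mathbb{D}^{1,4}$ and $Y_j\in\mathbb{D}^{1,4}$ for every $j\in\{1,\dots,n\}$, then $$d_2\left(\mathbb{P}_{(X,\mathbb{Y})},F(\nu)\otimes\mathbb{P}_{\mathbb{Y}}\right)\le C\,\mathbf{E}\left[\left(2(X+\nu)-\left\langle D(-L)^{-1}X,DX\right\rangle_H\right)^2\right]^{\frac12}+C\sum_{j=1}^n\mathbf{E}\left[\left\langle D(-L)^{-1}X,DY_j\right\rangle_H^2\right]^{\frac12}.$$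
   Context: $\mathbb{P}_{\mathbb{U}}$ denotes the probability distribution of a random vector $\mathbb{U}$. For $\nu>0$, $F(\nu)$ denotes the centered Gamma distribution, i.e. the law on $\mathbb{R}$ with density $$p_\nu(x)=\frac{(x+\nu)^{\frac{\nu}{2}-1}e^{-\frac{x+\nu}{2}}}{2^{\frac{\nu}{2}}\Gamma\left(\frac{\nu}{2}\right)}\mathbf{1}_{(-\nu,+\infty)}(x).$$ Second Wasserstein distance: for $m\ge1$, let $\mathcal{H}$ be the set of $C^1$ functions $h:\mathbb{R}^{m}\to\mathbb{R}$ all of whose partial derivatives are Lipschitz and such that $\|h\|_{\mathrm{Lip}}+\|h'\|_{\mathrm{Lip}}\le1$, where $$\|h\|_{\mathrm{Lip}}=\sup_{\mathbf{x}\ne\mathbf{y}}\frac{|h(\mathbf{x})-h(\mathbf{y})|}{\|\mathbf{x}-\mathbf{y}\|},\qquad \|h'\|_{\mathrm{Lip}}=\max_{1\le j\le m}\sup_{\mathbf{x}\neq\mathbf{y}}\frac{|\partial_jh(\mathbf{x})-\partial_jh(\mathbf{y})|}{\|\mathbf{x}-\mathbf{y}\|}$$ ($\|\cdot\|$ Euclidean norm). For integrable random vectors $\mathbb{U},\mathbb{V}$ in $\mathbb{R}^m$, $d_2(\mathbb{P}_{\mathbb{U}},\mathbb{P}_{\mathbb{V}})=\sup_{h\in\mathcal{H}}|\mathbf{E}[h(\mathbb{U})]-\mathbf{E}[h(\mathbb{V})]|$. Here $m=n+1$. Malliavin calculus: $H$ is a real separable Hilbert space and $(W(h),h\in H)$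 is an isonormal Gaussian process on a probability space, i.e. a centered Gaussian family with $\mathbf{E}[W(\varphi)W(\psi)]=\langle\varphi,\psi\rangle_H$. $I_k$ is the multiple stochastic integral of order $k$ with respect to $W$, defined on the symmetric tensor product $H^{\odot k}$; every square integrable random variable measurable with respect to $W$ has a unique orthogonal expansion $F=\sum_{k\ge0}I_k(f_k)$, $f_k\in H^{\odot k}$, $I_0(f_0)=\mathbf{E}[F]$. The Ornstein-Uhlenbeck operator is $LF=-\sum_{k\ge0}kI_k(f_k)$, and for centered $F$, $(-L)^{-1}F=\sum_{k\ge1}\frac1kI_k(f_k)$. $D$ is the Malliavin derivative: for $F=g(W(h_1),\dots,W(h_r))$ with $g$ smooth with compact support, $DF=\sum_i\frac{\partial g}{\partial x_i}(W(h_1),\dots,W(h_r))h_i$. For $p>1$, $\mathbb{D}^{1,p}$ is the Sobolev-Watanabe space obtained as the closure of the polynomial random variables with respect to the norm $\|F\|_{1,p}=\|(I-L)^{1/2}F\|_{L^p(\Omega)}$, and $D$ extends continuously from $\mathbb{D}^{1,p}$ to $L^p(\Omega;H)$. *)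

(* Defs.v *)
From HB Require Import structures.
From mathcomp Require Import all_boot all_order all_algebra.
From mathcomp Require Import all_classical all_reals all_analysis.
From mathcomp Require Import measurable_realfun.

Set Implicit Arguments.
Unset Strict Implicit.
Unset Printing Implicit Defensive.

Import Order.TTheory GRing.Theory Num.Theory.
Import numFieldNormedType.Exports.

Local Open Scope classical_set_scope.
Local Open Scope ring_scope.

Section hilbert.
Context (R : realType).

(* A real Hilbert space is a complete normed module whose norm comes from an
   inner product. *)
Record inner_product (H : completeNormedModType R) := InnerProduct {
  inner :> H -> H -> R ;
  innerC : forall x y, inner x y = inner y x ;
  inner_linear : forall (a : R) x y z,
    inner (a *: x + y) z = a * inner x z + inner y z ;
  inner_norm : forall x, inner x x = `|x| ^+ 2 }.

Definition separable (T : topologicalType) :=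
  exists2 A : set T, countable A & dense A.

End hilbert.

Section differential_calculus.
Context (R : realType) (m : nat).
Implicit Types (h : 'rV[R]_m -> R) (x : 'rV[R]_m).

Definition partial (i : 'I_m) h x : R := 'D_(delta_mx 0 i) h x.

Definition C1 h :=
  (forall i x, derivable h x (delta_mx 0 i)) /\
  (forall i, continuous (partial i h)).

Definition smooth h := forall s : seq 'I_m, C1 (foldr partial h s).

Definition compactly_supported h := compact (closure [set x | h x != 0]).

Definition euclidean_norm x : R := Num.sqrt (\sum_(i < m) x 0 i ^+ 2).

Definition lip h : \bar R := ereal_sup
  [set (`|h z.1 - h z.2| / euclidean_norm (z.1 - z.2))%:E |
    z in [set z : 'rV[R]_m * 'rV[R]_m | z.1 <> z.2]].

Definition lip' h : \bar R := \big[maxe/0%E]_(j < m) lip (partial j h).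

(* The bound also forces h and its partial derivatives to be Lipschitz. *)
Definition d2_test h := C1 h /\ (lip h + lip' h <= 1)%E.

(* Laws on R^m are measures on m.-tuple R, the library's R^m with the product
   sigma-algebra; differential calculus takes place on row vectors. *)
Definition d2 (mu nu : {measure set (m.-tuple R) -> \bar R}) : \bar R :=
  ereal_sup [set (let E (P : {measure set (m.-tuple R) -> \bar R}) :=
                    \int[P]_t (h (\row_i tnth t i))%:E in
                  `| E mu - E nu |)%E | h in [set h | d2_test h]].

End differential_calculus.

Section centered_gamma.
Context (R : realType).
Local Notation mu := (@lebesgue_measure R).

Definition Gamma (a : R) : R :=
  Rintegral mu `]0, +oo[ (fun t => t `^ (a - 1) * expR (- t)).

Definition centered_gamma_pdf (nu x : R) : R :=
  (x + nu) `^ (nu / 2 - 1) * expR (- ((x + nu) / 2))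
    / (2 `^ (nu / 2) * Gamma (nu / 2)) * \1_`]- nu, +oo[ x.

Lemma Gamma_ge0 a : 0 <= Gamma a.
Proof. by apply: Rintegral_ge0 => t _; rewrite mulr_ge0 ?powR_ge0 ?expR_ge0. Qed.

Lemma centered_gamma_pdf_ge0 nu x : 0 <= centered_gamma_pdf nu x.
Proof.
by rewrite !mulr_ge0 ?invr_ge0 ?mulr_ge0 ?powR_ge0 ?expR_ge0 ?Gamma_ge0.
Qed.

Lemma measurable_centered_gamma_pdf nu :
  measurable_fun setT (centered_gamma_pdf nu).
Proof.
apply: measurable_funM; last exact: measurable_indic.
apply: measurable_funM => //; apply: measurable_funM.
  apply: (measurableT_comp (measurable_powR _)); exact: measurable_funD.
apply: measurableT_comp => //; apply: measurableT_comp => //.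
by apply: measurable_funM => //; exact: measurable_funD.
Qed.

Definition centered_gamma (nu : R) : set R -> \bar R :=
  fun A => (\int[mu]_(x in A) (centered_gamma_pdf nu x)%:E)%E.

Section measure.
Variable nu : R.

Let centered_gamma0 : centered_gamma nu set0 = 0%E.
Proof. by rewrite /centered_gamma integral_set0. Qed.

Let centered_gamma_ge0 A : (0 <= centered_gamma nu A)%E.
Proof. by apply: integral_ge0 => x _; rewrite lee_fin centered_gamma_pdf_ge0. Qed.

Let centered_gamma_sigma_additive : semi_sigma_additive (centered_gamma nu).
Proof.
move=> /= F mF tF mUF; rewrite /centered_gamma; apply: cvg_toP.
  apply: ereal_nondecreasing_is_cvgn => p q pq.
  apply: lee_sum_nneg_natr => // k _ _; apply: integral_ge0 => /= x _.
  by rewrite lee_fin centered_gamma_pdf_ge0.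
rewrite ge0_integral_bigcup//=.
- apply/measurable_funTS/measurableT_comp => //.
  exact: measurable_centered_gamma_pdf.
- by move=> x _; rewrite lee_fin centered_gamma_pdf_ge0.
Qed.

HB.instance Definition _ := isMeasure.Build _ _ _
  (centered_gamma nu) centered_gamma0 centered_gamma_ge0
  centered_gamma_sigma_additive.

End measure.

End centered_gamma.

Section random_vectors.
Context d (T : measurableType d) (R : realType) (P : probability T R) (n : nat).

Definition random_vector (Y : 'I_n -> {RV P >-> R}) (w : T) : n.-tuple R :=
  [tuple Y i w | i < n].

Lemma measurable_random_vector Y : measurable_fun setT (random_vector Y).
Proof.
apply/measurable_fun_tnthP => i.
rewrite (_ : _ \o _ = Y i); first exact: measurable_funPT.
by apply/funext => w /=; rewrite tnth_mktuple.
Qed.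

HB.instance Definition _ Y := isMeasurableFun.Build _ _ _ _
  (random_vector Y) (measurable_random_vector Y).

Definition concat (z : R * n.-tuple R) : n.+1.-tuple R := cons_tuple z.1 z.2.

Lemma measurable_concat : measurable_fun setT concat.
Proof. exact: measurable_cons. Qed.

HB.instance Definition _ := isMeasurableFun.Build _ _ _ _
  concat measurable_concat.

Definition tensor_law (mu : {measure set R -> \bar R})
    (nu : probability (n.-tuple R) R) : set (n.+1.-tuple R) -> \bar R :=
  pushforward (mu \x nu)%E concat.

Section tensor_law_measure.
Variables (mu : {measure set R -> \bar R}) (nu : probability (n.-tuple R) R).

Let tensor_law0 : tensor_law mu nu set0 = 0%E.
Proof. exact: measure0. Qed.

Let tensor_law_ge0 A : (0 <= tensor_law mu nu A)%E.
Proof. exact: measure_ge0. Qed.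

Let tensor_law_sigma_additive : semi_sigma_additive (tensor_law mu nu).
Proof.
have := measurable_concat => mc.
exact: (@measure_semi_sigma_additive _ _ _ (pushforward (mu \x nu)%E concat)).
Qed.

HB.instance Definition _ := isMeasure.Build _ _ _ (tensor_law mu nu)
  tensor_law0 tensor_law_ge0 tensor_law_sigma_additive.

End tensor_law_measure.

Definition joint (X : {RV P >-> R}) (Y : 'I_n -> {RV P >-> R}) (w : T) :
    n.+1.-tuple R :=
  concat (X w, random_vector Y w).

Lemma measurable_joint X Y : measurable_fun setT (joint X Y).
Proof.
apply: (measurableT_comp measurable_concat).
by apply: measurable_fun_pair; [exact: measurable_funPT|
  exact: measurable_random_vector].
Qed.

HB.instance Definition _ X Y := isMeasurableFun.Build _ _ _ _
  (joint X Y) (measurable_joint X Y).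

End random_vectors.

Section malliavin.
Context (R : realType) (H : completeNormedModType R) (ip : inner_product H).
Context d (T : measurableType d) (P : probability T R).
Implicit Types W : H -> {RV P >-> R}.

(* The library's normal_prob 0 s is a placeholder law when s = 0. *)
Definition centered_gauss (s : R) (A : set R) : \bar R :=
  if s == 0 then dirac (0 : R) A else normal_prob 0 s A.

Definition isonormal W :=
  (forall (n : nat) (h : 'I_n -> H) (a : 'I_n -> R), exists s : R,
     forall A : set R, measurable A ->
       P ((fun w => \sum_(i < n) a i * W (h i) w) @^-1` A)
       = centered_gauss s A) /\
  (forall phi psi : H, 'E_P[W phi \* W psi] = (ip phi psi)%:E)%E.

Definition Lp_cvg (p : R) (F : nat -> T -> R) (G : T -> R) :=
  Lnorm P p%:E (fun w => (F n w - G w)%:E) @[n --> \oo] --> 0%E.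

Definition LpH_cvg (p : R) (F : nat -> T -> H) (G : T -> H) :=
  Lnorm P p%:E (fun w => `|F n w - G w|%:E) @[n --> \oo] --> 0%E.

(* The list u represents the symmetric tensor \sum_(a <- u) a.1 *: a.2^{(x)k}; by polarization these span the algebraic symmetric tensor power,
   whose inner product is determined by <h^{(x)k}, g^{(x)k}> = <h, g>^k. *)
Definition tensor_dot (k : nat) (u v : seq (R * H)) : R :=
  \sum_(a <- u) \sum_(b <- v) a.1 * b.1 * ip a.2 b.2 ^+ k.

Definition tensor_sub (u v : seq (R * H)) : seq (R * H) :=
  u ++ [seq (- b.1, b.2) | b <- v].

(* An element of the Hilbert space completion, represented by a Cauchy sequence
   of algebraic tensors. *)
Record sym_tensor (k : nat) := SymTensor {
  approx :> nat -> seq (R * H) ;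
  approx_cauchy : forall e : R, 0 < e -> exists N : nat, forall i j : nat,
    (N <= i)%N -> (N <= j)%N ->
    let v := tensor_sub (approx i) (approx j) in tensor_dot k v v < e }.

(* hermite k s is the monic k-th Hermite polynomial of variance s. *)
Fixpoint hermite (k : nat) (s x : R) : R :=
  match k with
  | 0 => 1
  | 1 => x
  | (j.+1 as i).+1 => x * hermite i s x - i%:R * s * hermite j s x
  end.

(* I_k is the linear map with I_k(h^{(x)k}) = hermite k |h|^2 (W h), so that
   E[I_k(f)^2] = k! |f|^2, extended to the completion by continuity. Being
   defined up to null sets, it is a relation, as are the operators below. *)
Definition multiple_integral W (k : nat) (f : sym_tensor k) (J : {RV P >-> R}) :=
  Lp_cvg 2
    (fun n w => \sum_(a <- f n) a.1 * hermite k (ip a.2 a.2) (W a.2 w)) J.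

(* G = \sum_k phi(k) I_k(f_k) where F = \sum_k I_k(f_k), i.e. G = phi(-L) F. *)
Definition fun_OU W (phi : R -> R) (F G : {RV P >-> R}) :=
  exists (f : forall k, sym_tensor k) (J : nat -> {RV P >-> R}),
    [/\ forall k, multiple_integral W (f k) (J k),
        Lp_cvg 2 (fun N w => \sum_(k < N) J k w) F &
        Lp_cvg 2 (fun N w => \sum_(k < N) phi k%:R * J k w) G].

(* The term k = 0 drops out because 0^-1 = 0. *)
Definition pinv_OU W : {RV P >-> R} -> {RV P >-> R} -> Prop :=
  fun_OU W (fun t => t^-1).

Definition bessel W : {RV P >-> R} -> {RV P >-> R} -> Prop :=
  fun_OU W (fun t => Num.sqrt (1 + t)).

Definition polynomial_rv W (F : {RV P >-> R}) :=
  exists l : seq (R * seq H), forall w,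
    F w = \sum_(a <- l) a.1 * \prod_(h <- a.2) W h w.

(* Since |.|_{1,p} dominates the L^p norm and L^p is complete, the closure for
   |.|_{1,p} is realized inside L^p: F n tends to X in D^{1,p} when it tends to
   X in L^p and (I - L)^{1/2} (F n) converges in L^p. *)
Definition sobolev_cvg W (p : R) (F : nat -> {RV P >-> R}) (X : {RV P >-> R}) :=
  Lp_cvg p F X /\
  exists (Z : nat -> {RV P >-> R}) (Z' : {RV P >-> R}),
    (forall n, bessel W (F n) (Z n)) /\ Lp_cvg p Z Z'.

Definition sobolev W (p : R) (X : {RV P >-> R}) :=
  exists F : nat -> {RV P >-> R},
    (forall n, polynomial_rv W (F n)) /\ sobolev_cvg W p F X.

Definition smooth_derivative W (F : {RV P >-> R}) (DF : T -> H) :=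
  exists (r : nat) (h : 'I_r -> H) (g : 'rV[R]_r -> R),
    [/\ smooth g, compactly_supported g,
        forall w, F w = g (\row_i W (h i) w) &
        forall w, DF w = \sum_(i < r) partial i g (\row_j W (h j) w) *: h i].

(* DX is a version of the Malliavin derivative of X, in the continuous
   extension of D from D^{1,p} to L^p(T; H). As H is separable, Borel
   measurability is the right notion for H-valued maps. *)
Definition malliavin W (p : R) (X : {RV P >-> R}) (DX : T -> H) :=
  (forall A : set H, open A -> measurable (DX @^-1` A)) /\
  exists (F : nat -> {RV P >-> R}) (DF : nat -> T -> H),
    [/\ forall n, smooth_derivative W (F n) (DF n),
        sobolev_cvg W p F X & LpH_cvg p DF DX].

End malliavin.

(* Main.v *)
(* Stein's method for the centered Gamma law. For a test function h let c(y) be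
   the mean of h(., y) under F(nu) and let f(., y) be the bounded solution of
     2 (x + nu) d_x f(x, y) - x f(x, y) = h(x, y) - c(y).
   Taking expectations at (X, Y), the claim reduces to the Malliavin formula
     E[X f(X, Y)] = E[d_x f(X, Y) <DX, D(-L)^{-1}X>
                      + sum_j d_j f(X, Y) <DY_j, D(-L)^{-1}X>]
   together with bounds on the first derivatives of f depending only on nu.

   The formula: functionals of W are read as functions on R^H, D_k is the
   derivative along the path t |-> om + t <k, .>, and Gaussian integration by
   parts gives the divergence as adjoint of D. On the chaos of order k, which is
   spanned by Hermite polynomials, E[<DJ, D Phi>] = k E[J Phi]; the factor k is
   cancelled by (-L)^{-1}.

   The bounds: rescaling the variation of constants formula turns f into an
   integral over [0, 1] that makes sense for all x, also for x <= -nu. The mean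
   zero condition gives boundedness for x >= 1, and the equation itself then
   bounds d_x f. As f depends linearly on h, the same bound applied to the
   difference quotients of h in y_j shows that f is Lipschitz in y_j.

   f is only Lipschitz, so the formula is applied to its averages over small
   boxes; d_x f is continuous off x = -nu, where its coefficient vanishes.

   The second estimate follows from the first by the Cauchy-Schwarz inequality. *)

Require Import Defs.
From HB Require Import structures.
From mathcomp Require Import all_boot all_order all_algebra.
From mathcomp Require Import all_classical all_reals all_analysis.
From mathcomp Require Import measurable_realfun ring lra.
Set Implicit Arguments.
Unset Strict Implicit.
Unset Printing Implicit Defensive.
Import Order.TTheory GRing.Theory Num.Theory.
Import numFieldNormedType.Exports.
Local Open Scope classical_set_scope.
Local Open Scope ring_scope.

(** * Real-valued integrals *)

(** Isonormality gives only the one-dimensional laws of linear combinations of the [W h].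
    Independence of [W h] from the components orthogonal to [h] is therefore extracted from the
    factorization of joint characteristic functions, with cosines and sines in place of complex
    exponentials; the uniqueness theorem behind it is proved by Gaussian smoothing.

    Paths are arbitrary functions on [H], not linear ones: [h |-> W h] is linear only up to null
    sets that depend on the vectors involved. A random variable may then have several
    representations as a functional, with different derivatives; the identities are in expectation
    and hold for each of them.

    D(-L)^{-1}X is known only as an L^2 limit, so no chain rule is applied to it. It is paired with
    the smooth field sum_a phi'_a(F) DF_a, whose divergence contains the derivatives of the phi'_a.
    This is why phi needs two orders of regularity, and each coordinate two averages. *)

Lemma le_dist_cvg (R : realType) (u v : nat -> R) (l : R) :
  (forall n, `|u n - l| <= v n) -> v n @[n --> \oo] --> 0 ->
  u n @[n --> \oo] --> l.
Proof.
move=> uv v0; apply/cvgrPdist_le => e e0.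
have /cvgrPdist_le/(_ _ e0) := v0; apply: filterS => n /=.
rewrite sub0r normrN distrC => H; apply: le_trans (uv n) _.
exact: le_trans (ler_norm _) H.
Qed.

Section integration.
Context d (T : measurableType d) (R : realType).
Variable mu : {measure set T -> \bar R}.
Implicit Types f g : T -> R.

Definition itg f := mu.-integrable setT (EFin \o f).
Local Notation E f := (Rintegral mu setT f).

Lemma itg_meas f : itg f -> measurable_fun setT f.
Proof. by move=> /measurable_int/measurable_EFinP. Qed.

Lemma le_itg f g : measurable_fun setT f -> itg g ->
  (forall x, `|f x| <= g x) -> itg f.
Proof.
move=> mf ig fg; apply: (le_integrable measurableT _ _ ig).
  exact/measurable_EFinP.
by move=> x _ /=; rewrite lee_fin (le_trans (fg x))// ler_norm.
Qed.

Lemma itgD f g : itg f -> itg g -> itg (fun x => f x + g x).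
Proof. by move=> fi gi; exact: (integrableD measurableT fi gi). Qed.

Lemma itgB f g : itg f -> itg g -> itg (fun x => f x - g x).
Proof. by move=> fi gi; exact: (integrableB measurableT fi gi). Qed.

Lemma itgZl k f : itg f -> itg (fun x => k * f x).
Proof. by move=> fi; exact: (integrableZl measurableT k fi). Qed.

Lemma itgZr k f : itg f -> itg (fun x => f x * k).
Proof. by move=> fi; exact: (integrableZr measurableT k fi). Qed.

Lemma itg0 : itg (fun=> 0).
Proof. exact: integrable0. Qed.

Lemma itg_sum (I : Type) (s : seq I) (F : I -> T -> R) :
  (forall i, itg (F i)) -> itg (fun x => \sum_(i <- s) F i x).
Proof.
move=> iF; elim: s => [|i s ih].
  by under eq_fun do rewrite big_nil; exact: itg0.
by under eq_fun do rewrite big_cons; exact: itgD.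
Qed.

Lemma itg_norm f : itg f -> itg (fun x => `|f x|).
Proof. by move=> /integrable_norm. Qed.

Lemma itg_ext f g : f =1 g -> itg f -> itg g.
Proof. by move=> /funext ->. Qed.

Lemma EZl k f : itg f -> E (fun x => k * f x) = k * E f.
Proof. by move=> fi; rewrite RintegralZl. Qed.

Lemma EZr k f : itg f -> E (fun x => f x * k) = E f * k.
Proof. by move=> fi; rewrite RintegralZr. Qed.

Lemma ED f g : itg f -> itg g -> E (fun x => f x + g x) = E f + E g.
Proof. by move=> fi gi; rewrite RintegralD. Qed.

Lemma EB f g : itg f -> itg g -> E (fun x => f x - g x) = E f - E g.
Proof. by move=> fi gi; rewrite RintegralB. Qed.

Lemma E0 : E (fun=> 0) = 0.
Proof. by rewrite /Rintegral integral0. Qed.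

Lemma E_sum (I : Type) (s : seq I) (F : I -> T -> R) :
  (forall i, itg (F i)) ->
  E (fun x => \sum_(i <- s) F i x) = \sum_(i <- s) E (F i).
Proof.
move=> iF; elim: s => [|i s ih].
  by rewrite big_nil; under eq_Rintegral do rewrite big_nil; exact: E0.
rewrite big_cons -ih -ED//; last exact: itg_sum.
by congr Rintegral; apply/funext => x; rewrite big_cons.
Qed.

Lemma E_ge0 f : (forall x, 0 <= f x) -> 0 <= E f.
Proof. by move=> f0; apply: Rintegral_ge0. Qed.

Lemma le_E f g : itg f -> itg g -> (forall x, f x <= g x) -> E f <= E g.
Proof. by move=> fi gi fg; apply: le_Rintegral. Qed.

Lemma le_normE f : itg f -> `|E f| <= E (fun x => `|f x|).
Proof. by move=> fi; apply: le_normr_Rintegral. Qed.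

Lemma le_normE_le f g : itg f -> itg g -> (forall x, `|f x| <= g x) ->
  `|E f| <= E g.
Proof.
move=> fi gi fg; apply: le_trans (le_normE fi) _.
by apply: le_E => //; exact: itg_norm.
Qed.

Lemma E_EFin f : itg f -> (\int[mu]_x (f x)%:E)%E = (E f)%:E.
Proof. by move=> fi; rewrite /Rintegral fineK//; exact: integrable_fin_num. Qed.

Lemma itg_ge0 f : measurable_fun setT f -> (forall x, 0 <= f x) ->
  (\int[mu]_x (f x)%:E < +oo)%E -> itg f.
Proof.
move=> mf f0 foo; apply/integrableP; split; first exact/measurable_EFinP.
by under eq_integral do rewrite /= ger0_norm//.
Qed.

Lemma E_dominated (f_ : nat -> T -> R) f g :
  (forall n, measurable_fun setT (f_ n)) -> itg g ->
  (forall x, f_ n x @[n --> \oo] --> f x) ->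
  (forall n x, `|f_ n x| <= g x) ->
  itg f /\ E (f_ n) @[n --> \oo] --> E f.
Proof.
move=> mf ig cf fg.
have mf' : measurable_fun setT (EFin \o f).
  apply/measurable_EFinP; apply: (measurable_fun_cvg mf) => x _; exact: cf.
have [|||||i1 _ i2] := @dominated_convergence _ _ _ mu _ measurableT
    (fun n => EFin \o f_ n) (EFin \o f) (EFin \o g).
- by move=> n; apply/measurable_EFinP.
- exact: mf'.
- by apply: aeW => x _; apply: cvg_EFin; [exact: nearW|exact: cf].
- exact: ig.
- by apply: aeW => x n _ /=; rewrite lee_fin.
split => //.
by apply: fine_cvg; rewrite -E_EFin.
Qed.

End integration.

Section finite.
Context d (T : measurableType d) (R : realType).
Variable mu : {finite_measure set T -> \bar R}.
Implicit Types f g : T -> R.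
Local Notation E f := (Rintegral mu setT f).

Lemma itg_cst k : itg mu (fun=> k).
Proof. exact: finite_measure_integrable_cst. Qed.

Lemma itg_bounded f M : measurable_fun setT f -> (forall x, `|f x| <= M) ->
  itg mu f.
Proof. by move=> mf fM; apply: (le_itg mf (itg_cst M)). Qed.

Lemma itgMb f g M : measurable_fun setT f -> (forall x, `|f x| <= M) ->
  itg mu g -> itg mu (fun x => f x * g x).
Proof.
move=> mf fM ig; apply: (le_itg _ (itgZl M (itg_norm ig))).
  by apply: measurable_funM => //; exact: itg_meas ig.
by move=> x; rewrite normrM ler_wpM2r.
Qed.

Definition L2 f := measurable_fun setT f /\ itg mu (fun x => f x ^+ 2).

Lemma L2M f g : L2 f -> L2 g -> itg mu (fun x => f x * g x).
Proof.
move=> [mf f2] [mg g2]; apply: (le_itg _ (itgD f2 g2)).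
  exact: measurable_funM.
move=> x; rewrite normrM -(normr_id (f x)) -(real_normK (num_real (f x))).
rewrite -(real_normK (num_real (g x))) normr_id.
move: (normr_ge0 (f x)) (normr_ge0 (g x)); move: `|f x| `|g x| => a b a0 b0.
nra.
Qed.

Lemma L2_bounded f M : measurable_fun setT f -> (forall x, `|f x| <= M) -> L2 f.
Proof.
move=> mf fM; split=> //; apply: (@itg_bounded _ (M ^+ 2)).
  exact: measurable_funX.
by move=> x; rewrite normrX lerXn2r// nnegrE// (le_trans _ (fM x)).
Qed.

Lemma L2_cst k : L2 (fun=> k).
Proof. by apply: (@L2_bounded _ `|k|). Qed.

Lemma L2_itg f : L2 f -> itg mu f.
Proof.
by move=> f2; have := L2M f2 (L2_cst 1); apply: itg_ext => x; rewrite mulr1.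
Qed.

Lemma L2D f g : L2 f -> L2 g -> L2 (fun x => f x + g x).
Proof.
move=> f2 g2; have fg := L2M f2 g2; case: f2 g2 => mf f2 [mg g2]; split.
  exact: measurable_funD.
apply: itg_ext (itgD (itgD f2 g2) (itgZl 2 fg)) => x /=.
by ring.
Qed.

Lemma L2Z k f : L2 f -> L2 (fun x => k * f x).
Proof.
move=> [mf f2]; split; first exact: measurable_funM.
by apply: itg_ext (itgZl (k ^+ 2) f2) => x /=; rewrite exprMn.
Qed.

Lemma L2B f g : L2 f -> L2 g -> L2 (fun x => f x - g x).
Proof.
move=> f2 g2; have -> : (fun x => f x - g x) = (fun x => f x + -1 * g x).
  by apply/funext => x; rewrite mulN1r.
exact: L2D f2 (L2Z _ g2).
Qed.

Lemma L2_sum (I : Type) (s : seq I) (F : I -> T -> R) :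
  (forall i, L2 (F i)) -> L2 (fun x => \sum_(i <- s) F i x).
Proof.
move=> iF; elim: s => [|i s ih].
  by under eq_fun do rewrite big_nil; exact: L2_cst.
by under eq_fun do rewrite big_cons; exact: L2D.
Qed.

Lemma L2Mb f g M : measurable_fun setT f -> (forall x, `|f x| <= M) ->
  L2 g -> L2 (fun x => f x * g x).
Proof.
move=> mf fM [mg g2]; split; first exact: measurable_funM.
have : itg mu (fun x => f x ^+ 2 * g x ^+ 2).
  apply: (@itgMb _ _ (M ^+ 2)) => //; first exact: measurable_funX.
  by move=> x; rewrite normrX lerXn2r// nnegrE// (le_trans _ (fM x)).
by apply: itg_ext => x; rewrite exprMn.
Qed.

Lemma L2_norm f : L2 f -> L2 (fun x => `|f x|).
Proof.
move=> [mf f2]; split; first exact: measurableT_comp.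
by apply: itg_ext f2 => x; rewrite real_normK ?num_real.
Qed.

Lemma cauchy_schwarz f g : L2 f -> L2 g ->
  E (fun x => `|f x * g x|) ^+ 2 <=
  E (fun x => f x ^+ 2) * E (fun x => g x ^+ 2).
Proof.
move=> f2 g2; have fg := L2M (L2_norm f2) (L2_norm g2).
have -> : E (fun x => `|f x * g x|) = E (fun x => `|f x| * `|g x|).
  by apply: eq_Rintegral => x _; rewrite normrM.
case: f2 g2 => mf f2 [mg g2].
set A := E (fun x => f x ^+ 2); set B := E (fun x => g x ^+ 2).
set C := E (fun x => _ * _).
have A0 : 0 <= A by apply: E_ge0 => x; rewrite sqr_ge0.
have B0 : 0 <= B by apply: E_ge0 => x; rewrite sqr_ge0.
have q (t : R) : 2 * t * C <= A + t ^+ 2 * B.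
  rewrite -EZl// -EZl// -ED//; last exact: itgZl.
  apply: le_E; [exact: itgZl|by apply: itgD => //; exact: itgZl|].
  move=> x /=; rewrite -(real_normK (num_real (f x))).
  rewrite -(real_normK (num_real (g x))).
  have := sqr_ge0 (`|f x| - t * `|g x|); nra.
have [B00|Bn0] := eqVneq B 0; last first.
  have Bp : 0 < B by rewrite lt_def Bn0.
  (* This [t] minimizes [A - 2 * t * C + t ^+ 2 * B]. *)
  have := q (C / B).
  rewrite (_ : 2 * (C / B) * C = 2 * (C ^+ 2 / B)); last by field.
  rewrite (_ : (C / B) ^+ 2 * B = C ^+ 2 / B); last by field.
  by move=> H; rewrite -ler_pdivrMr//; lra.
have C0 : C <= 0.
  rewrite leNgt; apply/negP => Cp.
  (* With [B = 0] the bound [2 * t * C <= A] holds for every [t]; this one would give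
     [2 * (A + 1) <= A]. *)
  have := q ((A + 1) / C); rewrite B00 mulr0 addr0.
  rewrite (_ : 2 * ((A + 1) / C) * C = 2 * (A + 1)); first lra.
  by field; rewrite gt_eqF.
have : 0 <= C by apply: E_ge0 => x; rewrite mulr_ge0.
move=> C0'; have -> : C = 0 by apply/eqP; rewrite eq_le C0.
by rewrite expr0n/= B00 mulr0.
Qed.

Lemma E_sqr_ge0 f : 0 <= E (fun x => f x ^+ 2).
Proof. by apply: E_ge0 => x; rewrite sqr_ge0. Qed.

Lemma cauchy_schwarz_sqrt f g : L2 f -> L2 g ->
  E (fun x => `|f x * g x|) <=
  Num.sqrt (E (fun x => f x ^+ 2)) * Num.sqrt (E (fun x => g x ^+ 2)).
Proof.
move=> f2 g2; rewrite -sqrtrM ?E_sqr_ge0//.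
rewrite -[leLHS]ger0_norm ?E_ge0//.
by rewrite -sqrtr_sqr ler_wsqrtr// cauchy_schwarz.
Qed.

(** Strong convergence in L^2 implies weak convergence, which is how the identities below pass to
    the limit. *)
Lemma L2_cvgM (f_ : nat -> T -> R) f g :
  (forall n, L2 (f_ n)) -> L2 f -> L2 g ->
  E (fun x => (f_ n x - f x) ^+ 2) @[n --> \oo] --> 0 ->
  E (fun x => f_ n x * g x) @[n --> \oo] --> E (fun x => f x * g x).
Proof.
move=> f_2 f2 g2 cf.
apply: (@le_dist_cvg _ _ (fun n => Num.sqrt (E (fun x => (f_ n x - f x) ^+ 2)) *
    Num.sqrt (E (fun x => g x ^+ 2)))).
  move=> n; apply: le_trans (cauchy_schwarz_sqrt (L2B (f_2 n) f2) g2).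
  rewrite -EB; [|exact: L2M..].
  apply: le_trans (le_normE _) _; first by apply: itgB; exact: L2M.
  by under eq_Rintegral do rewrite -mulrBl.
rewrite -[X in _ --> X](mul0r (Num.sqrt (E (fun x => g x ^+ 2)))).
apply: cvgMl; rewrite -[X in _ --> X](@sqrtr0 R).
by apply: cvg_comp cf _; exact: sqrt_continuous.
Qed.

End finite.

(** * Derivatives on the line *)

Section calculus.
Context (R : realType).
Implicit Types (f g : R -> R) (x l : R).

Definition der f x l := is_derive (x : R) (1 : R) f l.

Lemma der_eq f x l l' : der f x l -> l = l' -> der f x l'.
Proof. by move=> + <-. Qed.

Lemma der_ext f g x l : f =1 g -> der f x l -> der g x l.
Proof. by move=> /funext ->. Qed.

Lemma der_cst k x : der (fun=> k) x 0.
Proof. exact: is_derive_cst. Qed.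

Lemma der_id x : der (fun t => t) x 1.
Proof. exact: is_derive_id. Qed.

Lemma derD f g x a b : der f x a -> der g x b ->
  der (fun t => f t + g t) x (a + b).
Proof. by move=> fa gb; exact: is_deriveD. Qed.

Lemma derN f x a : der f x a -> der (fun t => - f t) x (- a).
Proof. by move=> fa; exact: is_deriveN. Qed.

Lemma derB f g x a b : der f x a -> der g x b ->
  der (fun t => f t - g t) x (a - b).
Proof. by move=> fa gb; exact: is_deriveB. Qed.

Lemma derM f g x a b : der f x a -> der g x b ->
  der (fun t => f t * g t) x (a * g x + f x * b).
Proof.
move=> fa gb; apply: der_eq (is_deriveM fa gb) _.
by rewrite addrC /GRing.scale/= (mulrC a).
Qed.

Lemma derZ k f x a : der f x a -> der (fun t => k * f t) x (k * a).
Proof.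
by move=> fa; apply: der_eq (derM (der_cst k x) fa) _; rewrite mul0r add0r.
Qed.

Lemma der_comp f g x a b : der f (g x) a -> der g x b ->
  der (fun t => f (g t)) x (a * b).
Proof. by move=> fa gb; exact: (is_derive1_comp fa gb). Qed.

Lemma der_sqr x : der (fun t => t ^+ 2) x (2 * x).
Proof.
have H := derM (der_id x) (der_id x).
by apply: der_ext (der_eq H _) => [t|]; rewrite ?expr2//; ring.
Qed.

Lemma der_shift f x c l : der f (c + x) l -> der (fun t => f (c + t)) x l.
Proof.
move=> fl; have H := derD (der_cst c x) (der_id x).
have := @der_comp f (fun t => c + t) x l _ fl H.
by rewrite add0r mulr1.
Qed.

Lemma der_continuous f x l : der f x l -> {for x, continuous f}.
Proof.
by case=> fl _; apply/differentiable_continuous/derivable1_diffP.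
Qed.

Lemma MVTR f (f' : R -> R) x y : (forall z, der f z (f' z)) ->
  exists z, `|z - x| <= `|y - x| /\ f y - f x = f' z * (y - x).
Proof.
move=> ff'.
have mvt a b : a <= b -> exists2 z, z \in `[a, b] & f b - f a = f' z * (b - a).
  move=> ab; apply: MVT_segment ab _ _ => [z _|]; first exact: ff'.
  by apply: continuous_subspaceT => z; exact: der_continuous (ff' z).
have [xy|/ltW yx] := leP x y.
  have [z] := mvt _ _ xy; rewrite in_itv/= => /andP[xz zy] e; exists z; split=> //.
  by rewrite !ger0_norm; lra.
have [z] := mvt _ _ yx; rewrite in_itv/= => /andP[xz zy] e; exists z; split.
  by rewrite !ler0_norm; lra.
by rewrite -[LHS]opprB e -mulrN opprB.
Qed.

Lemma der_lip f (f' : R -> R) L x y : (forall z, der f z (f' z)) ->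
  (forall z, `|f' z| <= L) -> `|f y - f x| <= L * `|y - x|.
Proof.
move=> ff' f'L; have [z [_ ->]] := MVTR x y ff'.
by rewrite normrM ler_wpM2r.
Qed.

Lemma der_taylor f (f' : R -> R) L x t : (forall z, der f z (f' z)) ->
  (forall y z, `|f' y - f' z| <= L * `|y - z|) ->
  `|f (x + t) - f x - t * f' x| <= L * t ^+ 2.
Proof.
move=> ff' f'L; have [z []] := MVTR x (x + t) ff'.
rewrite (addrC x) addrK => zt ->.
rewrite (_ : f' z * t - t * f' x = (f' z - f' x) * t); last by ring.
have L0 : 0 <= L by have := f'L 1 0; rewrite subr0 normr1 mulr1; exact: le_trans.
rewrite normrM -(real_normK (num_real t)) expr2 mulrA ler_wpM2r//.
by apply: le_trans (f'L _ _) _; rewrite ler_wpM2l.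
Qed.

(** A quadratic error bound can be integrated or composed with explicit constants, which makes it a
    convenient substitute for differentiating under an expectation. *)
Lemma der_quad f x l K :
  (forall t, `|f (x + t) - f x - t * l| <= K * t ^+ 2) -> der f x l.
Proof.
move=> H.
have K0 : 0 <= K.
  by have := H 1; rewrite expr1n mulr1; apply: le_trans.
have c : h^-1 *: ((f \o shift x) (h *: 1) - f x) @[h --> 0^'] --> l.
  apply/cvgrPdist_le => /= e e0; near=> h.
  have h0 : h != 0 by near: h; exact: nbhs_dnbhs_neq.
  rewrite /GRing.scale/= mulr1 (addrC h) distrC.
  rewrite (_ : _ - l = h^-1 * (f (x + h) - f x - h * l)); last first.
    by rewrite [RHS]mulrBr mulKf.
  rewrite normrM normfV ler_pdivrMl ?normr_gt0//.
  apply: le_trans (H h) _; rewrite -(real_normK (num_real h)) mulrC expr2 -mulrA.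
  rewrite ler_wpM2l//.
  have : `|h| <= e / (K + 1).
    by near: h; apply: dnbhs0_le; rewrite divr_gt0//; lra.
  rewrite ler_pdivlMr; last lra.
  move=> he; have := normr_ge0 h; nra.
split; first by apply/cvg_ex; exists l.
exact/cvg_lim.
Unshelve. all: by end_near. Qed.

Lemma FTC_itv f (f' : R -> R) a b : a <= b -> (forall z, der f z (f' z)) ->
  continuous f' ->
  Rintegral lebesgue_measure `[a, b] f' = f b - f a.
Proof.
rewrite le_eqVlt => /predU1P[<- _ _|ab ff' cf'].
  by rewrite set_itv1 Rintegral_set1 subrr.
rewrite /Rintegral (@continuous_FTC2 _ f' f)//.
- by apply: continuous_subspaceT.
- have cf x := der_continuous (ff' x).
  split.
  + by move=> x _; case: (ff' x).
  + by apply: cvg_at_right_filter; exact: cf.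
  + by apply: cvg_at_left_filter; exact: cf.
- by move=> x _; rewrite derive1E; case: (ff' x).
Qed.

Lemma continuous_measurable f : continuous f -> measurable_fun setT f.
Proof. exact: continuous_measurable_fun. Qed.

Local Notation leb := (@lebesgue_measure R).

Lemma itg_itv f a b : continuous f -> leb.-integrable `[a, b] (EFin \o f).
Proof.
move=> cf; apply: continuous_compact_integrable; first exact: segment_compact.
exact: continuous_subspaceT.
Qed.

Lemma Rintegral_itv_indic f (D : set R) : measurable D ->
  Rintegral leb D f = Rintegral leb setT (fun x => \1_D x * f x).
Proof.
move=> mD; rewrite Rintegral_mkcond; apply: eq_Rintegral => x _.
by rewrite patchE indicE; case: ifPn; rewrite ?mul1r ?mul0r.
Qed.

(* The boundary terms are removed by the cutoff [1 - x^2/n^2] on [[-n, n]]. *)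
Lemma lebesgue_der_eq0 f (f' : R -> R) : (forall z, der f z (f' z)) ->
  continuous f' -> itg leb f -> itg leb f' -> Rintegral leb setT f' = 0.
Proof.
move=> ff' cf' If If'.
have cf : continuous f by move=> x; exact: der_continuous (ff' x).
pose D (n : nat) : set R := `[- (n.+1%:R : R), n.+1%:R]%classic.
have mD n : measurable (D n) by exact: measurable_itv.
pose chi (n : nat) (x : R) := 1 - x ^+ 2 / n.+1%:R ^+ 2.
have chi_der n x : der (chi n) x (- (2 * x / n.+1%:R ^+ 2)).
  have := derB (der_cst 1 x) (derZ (n.+1%:R ^- 2) (der_sqr x)).
  move=> H; apply: der_ext (der_eq H _); first by move=> t; rewrite /chi mulrC.
  by rewrite sub0r mulrC.
have cchi n : continuous (chi n) by move=> x; exact: der_continuous (chi_der n x).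
have D1 n x : D n x -> x ^+ 2 / n.+1%:R ^+ 2 <= 1.
  rewrite /D/= in_itv/= => /andP[a b]; rewrite ler_pdivrMr ?exprn_gt0// mul1r.
  have xn : `|x| <= n.+1%:R by rewrite ler_norml a.
  by rewrite -(real_normK (num_real x)) lerXn2r// nnegrE.
have chi1 n x : `|\1_(D n) x * chi n x| <= 1.
  rewrite indicE; have [xD|] := boolP (x \in D n); last by rewrite mul0r normr0.
  rewrite mul1r /chi ger0_norm; first by rewrite gerBl divr_ge0// ?sqr_ge0.
  by rewrite subr_ge0 D1//; exact: set_mem.
pose u n (x : R) := \1_(D n) x * chi n x * f' x.
have mu' n : measurable_fun setT (fun x => \1_(D n) x * chi n x).
  by apply: measurable_funM; [exact: measurable_indic|exact: continuous_measurable].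
have Iu n : itg leb (u n).
  apply: (le_itg _ (itg_norm If')).
    by apply: measurable_funM; [exact: mu'|exact: continuous_measurable].
  by move=> x; rewrite normrM ler_piMl.
pose v n (x : R) := \1_(D n) x * (2 * x / n.+1%:R ^+ 2) * f x.
have mv n : measurable_fun setT (v n).
  apply: measurable_funM; last exact: continuous_measurable.
  apply: measurable_funM; first exact: measurable_indic.
  by apply: measurable_funM => //; apply: measurable_funM.
have vb n x : `|v n x| <= 2 / n.+1%:R * `|f x|.
  rewrite normrM ler_wpM2r// indicE.
  have [/set_mem|] := boolP (x \in D n); last first.
    by rewrite mul0r normr0 divr_ge0.
  rewrite /D/= in_itv/= -ler_norml => xn.
  have n0 : (0 : R) < n.+1%:R by [].
  rewrite mul1r (_ : 2 * x / _ = 2 / n.+1%:R * (x / n.+1%:R)); last first.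
    by rewrite expr2; field; rewrite gt_eqF.
  rewrite normrM ger0_norm ?divr_ge0// ler_piMr ?divr_ge0//.
  by rewrite normrM normfV (gtr0_norm n0) ler_pdivrMr// mul1r.
have Iv n : itg leb (v n).
  apply: (le_itg _ (itgZl (2 / n.+1%:R) (itg_norm If))); first exact: mv.
  exact: vb.
have uv n : Rintegral leb setT (u n) = Rintegral leb setT (v n).
  apply/eqP; rewrite -subr_eq0 -EB//.
  have -> : Rintegral leb setT (fun x => u n x - v n x) =
      Rintegral leb (D n) (fun x => f' x * chi n x + f x * (- (2 * x / n.+1%:R ^+ 2))).
    rewrite [RHS]Rintegral_itv_indic//; apply: eq_Rintegral => x _.
    by rewrite /u /v; ring.
  (* [chi n] vanishes at both ends of [D n], so the boundary values of [f * chi n] are zero. *)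
  rewrite (@FTC_itv (fun x => f x * chi n x)).
  - rewrite /chi sqrrN divff ?expf_neq0//; apply/eqP; ring.
  - by rewrite -subr_ge0 opprK addr_ge0.
  - by move=> z; apply: derM.
  - move=> x; apply: cvgD; first by apply: cvgM; [exact: cf'|exact: cchi].
    apply: cvgM; first exact: cf.
    by apply: cvgN; apply: cvgMl; apply: cvgMr; exact: cvg_id.
have [_ cu] : itg leb f' /\
    Rintegral leb setT (u n) @[n --> \oo] --> Rintegral leb setT f'.
  apply: (E_dominated _ (itg_norm If')).
  - by move=> n; exact: itg_meas (Iu n).
  - move=> x; rewrite -[X in _ --> X]mul1r; apply: cvgMl.
    rewrite -[X in _ --> X]mul1r; apply: cvgM.
      apply: cvg_near_cst; near=> n; rewrite indicE mem_set//= /D/= in_itv/=.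
      rewrite -ler_norml; apply: (@le_trans _ _ n%:R); last by rewrite ler_nat.
      by near: n; exact: nbhs_infty_ger.
    rewrite /chi; rewrite -[X in _ --> X](subr0 1); apply: cvgB; first exact: cvg_cst.
    rewrite -[X in _ --> X](mulr0 (x ^+ 2)); apply: cvgMr.
    rewrite -[X in _ --> X](mulr0 0); under eq_fun do rewrite -exprVn expr2.
    by apply: cvgM; exact: cvg_harmonic.
  - by move=> n x; rewrite /u normrM ler_piMl.
have cv : Rintegral leb setT (u n) @[n --> \oo] --> 0.
  apply: (@le_dist_cvg _ _ (fun n => 2 / n.+1%:R * Rintegral leb setT (fun x => `|f x|))).
    move=> n; rewrite subr0 uv -EZl; last exact: itg_norm.
    by apply: le_normE_le => //; exact/itgZl/itg_norm.
  rewrite -[X in _ --> X](mul0r (Rintegral leb setT (fun x => `|f x|))); apply: cvgMl.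
  rewrite -[X in _ --> X](mulr0 2); apply: cvgMr.
  exact: cvg_harmonic.
exact: cvg_unique cu cv.
Unshelve. all: by end_near. Qed.

End calculus.

(** * Normal laws *)

Section density.
Context d (T : measurableType d) (R : realType).
Variables (mu nu : {measure set T -> \bar R}) (p : T -> R).
Hypothesis p0 : forall x, 0 <= p x.
Hypothesis mp : measurable_fun setT p.
Hypothesis nuE : forall A, measurable A -> nu A = (\int[mu]_(x in A) (p x)%:E)%E.

Import HBNNSimple.
Local Open Scope ereal_scope.

(** [nuE] settles indicators, linearity simple functions, and monotone convergence the rest. *)
Lemma ge0_integral_density (f : T -> \bar R) : measurable_fun setT f ->
  (forall x, 0 <= f x) -> \int[nu]_x f x = \int[mu]_x (f x * (p x)%:E).
Proof.
move=> mf f0; pose f_ := nnsfun_approx measurableT mf.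
have cf x : (f_ n x)%:E @[n --> \oo] --> f x.
  by apply: cvg_nnsfun_approx.
have ndf x m n : (m <= n)%N -> (f_ m x <= f_ n x)%R.
  by move=> mn; exact/lefP/nd_nnsfun_approx.
transitivity (limn (fun n => \int[nu]_x (f_ n x)%:E)).
  rewrite -monotone_convergence//.
  - by apply: eq_integral => y _; apply/esym/cvg_lim.
  - by move=> n; exact/measurable_EFinP/measurable_funP.
  - by move=> n y _; rewrite lee_fin.
  - by move=> y _ m n mn; rewrite lee_fin ndf.
rewrite [X in limn X](_ : _ = (fun n => \int[mu]_x ((f_ n x)%:E * (p x)%:E))); last first.
  apply/funext => n.
  transitivity (\sum_(k \in range (f_ n)) \int[nu]_x (k * \1_(f_ n @^-1` [set k]) x)%:E).
    rewrite -ge0_integral_fsum//.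
    - by apply: eq_integral => x _; rewrite fsumEFin// -fimfunE.
    - by move=> y; exact/measurable_EFinP/measurable_funM.
    - by move=> y x _; rewrite nnfun_muleindic_ge0.
  transitivity (\sum_(k \in range (f_ n)) \int[mu]_x ((k * \1_(f_ n @^-1` [set k]) x)%:E * (p x)%:E)); last first.
    rewrite -ge0_integral_fsum//.
    - apply: eq_integral => x _; rewrite [in RHS](fimfunE (f_ n)) -fsumEFin//.
      rewrite ge0_mule_fsuml// => k.
      by rewrite nnfun_muleindic_ge0.
    - move=> y; apply: emeasurable_funM; last exact/measurable_EFinP.
      exact/measurable_EFinP/measurable_funM.
    - by move=> y x _; rewrite mule_ge0 ?lee_fin// -lee_fin nnfun_muleindic_ge0.
  apply: eq_fsbigr => k kr.
  have k0 : (0 <= k)%R by move: kr; rewrite inE => -[t _ <-].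
  rewrite integralZl_indic_nnsfun// integral_indic//= setIT nuE//.
  under [RHS]eq_integral do rewrite EFinM -muleA.
  rewrite ge0_integralZl//.
  - congr (_ * _); rewrite integral_mkcond; apply: eq_integral => x _.
    by rewrite patchE indicE; case: ifPn => _; rewrite ?mul1e ?mul0e.
  - apply: emeasurable_funM; last exact/measurable_EFinP.
    exact/measurable_EFinP/measurable_indic.
  - by move=> x _; rewrite mule_ge0 ?lee_fin.
rewrite -monotone_convergence//.
- apply: eq_integral => x _; apply/cvg_lim => //.
  by apply: cvgeMr => //; exact: cf.
- move=> n; apply: emeasurable_funM; exact/measurable_EFinP.
- by move=> n x _; rewrite mule_ge0 ?lee_fin.
- by move=> x _ m n mn; rewrite lee_wpmul2r ?lee_fin// ndf.
Qed.

Lemma integral_density (f : T -> R) : measurable_fun setT f ->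
  \int[nu]_x (f x)%:E = \int[mu]_x (f x * p x)%:E.
Proof.
move=> mf; rewrite integralE [RHS]integralE.
have mf' : measurable_fun setT (EFin \o f) by exact/measurable_EFinP.
rewrite (ge0_integral_density (measurable_funepos mf'))//.
rewrite (ge0_integral_density (measurable_funeneg mf'))//.
congr (_ - _); apply: eq_integral => x _.
- rewrite !funeposE/= -!EFin_max -EFinM; congr EFin.
  by rewrite maxr_pMl// mul0r.
- rewrite !funenegE/= -!EFin_max -EFinM; congr EFin.
  by rewrite maxr_pMl// mul0r mulNr.
Qed.

Lemma itg_density (f : T -> R) : measurable_fun setT f ->
  itg nu f <-> itg mu (fun x => f x * p x)%R.
Proof.
move=> mf.
have e : \int[nu]_x `|(f x)%:E| = \int[mu]_x `|(f x * p x)%:E|.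
  rewrite (integral_density (f := fun x => `|f x|%R)); last exact: measurableT_comp.
  by apply: eq_integral => x _; rewrite /= normrM (ger0_norm (p0 x)).
split=> /integrableP[_ foo]; apply/integrableP; split.
- by apply/measurable_EFinP; apply: measurable_funM.
- by rewrite /= -e.
- exact/measurable_EFinP.
- by rewrite /= e.
Qed.

Lemma E_density (f : T -> R) : measurable_fun setT f ->
  Rintegral nu setT f = Rintegral mu setT (fun x => f x * p x)%R.
Proof. by move=> mf; rewrite /Rintegral integral_density. Qed.

End density.

(** Raise [1 + y <= expR y] at [y = x / k] to the power [k]; for [k = 0] the constant is
    [0 ^+ 0 = 1]. *)
Lemma exp_ge_pow (R : realType) (k : nat) (x : R) : 0 <= x ->
  x ^+ k <= k%:R ^+ k * expR x.
Proof.
move=> x0; case: k => [|k]; first by rewrite !expr0 mul1r -expR0 ler_expR.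
have k0 : (0 : R) < k.+1%:R by [].
rewrite -ler_pdivrMl ?exprn_gt0// -exprVn -exprMn.
rewrite (_ : x = k.+1%:R * (k.+1%:R^-1 * x)); last by rewrite mulVKf// gt_eqF.
rewrite mulKf ?gt_eqF// expRM_natl lerXn2r// ?nnegrE ?expR_ge0//.
  by rewrite mulr_ge0// invr_ge0 ltW.
by apply: le_trans (expR_ge1Dx _); rewrite lerDr.
Qed.

Section normal.
Context (R : realType) (m s : R).
Hypothesis s0 : s != 0.
Local Notation leb := (@lebesgue_measure R).
Local Notation N := (normal_prob m s).
Local Notation g := (normal_pdf m s).

Lemma normal_itg (f : R -> R) : measurable_fun setT f ->
  itg N f <-> itg leb (fun x : R => f x * g x).
Proof.
by apply: (@itg_density _ _ _ leb N g) => //; [exact: normal_pdf_ge0|exact: measurable_normal_pdf].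
Qed.

Lemma normal_E (f : R -> R) : measurable_fun setT f ->
  Rintegral N setT f = Rintegral leb setT (fun x : R => f x * g x).
Proof.
by apply: (@E_density _ _ _ leb N g) => //; [exact: normal_pdf_ge0|exact: measurable_normal_pdf].
Qed.

Lemma normal_pdf_der x : der g x (- ((x - m) / s ^+ 2) * g x).
Proof.
rewrite (_ : g = (fun x => normal_peak s * expR (- ((x - m) ^+ 2) / (s ^+ 2 *+ 2)))); last first.
  by apply/funext => y; rewrite normal_pdfE.
have dm : der (fun x => x - m) x 1 by apply: der_eq (derB (der_id x) (der_cst m x)) _; rewrite subr0.
have H := derZ (s ^+ 2 *+ 2)^-1 (derN (@der_comp _ (fun u => u ^+ 2) (fun x => x - m) x _ _ (der_sqr (x - m)) dm)).
have := derZ (normal_peak s) (der_comp (is_derive_expR _) H).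
move=> K; apply: der_ext (der_eq K _); first by move=> t /=; rewrite (mulrC _ (- _)).
by rewrite (mulrC (- _) (_ ^-1)); field.
Qed.

(** The derivative of [f * g] has Lebesgue integral zero, and the density satisfies
    [g' = - (x - m) / s ^+ 2 * g]. *)
Lemma normal_ibp (f f' : R -> R) : (forall x, der f x (f' x)) -> continuous f' ->
  itg N f -> itg N (fun x : R => (x - m) * f x) -> itg N f' ->
  Rintegral N setT (fun x : R => (x - m) * f x) = s ^+ 2 * Rintegral N setT f'.
Proof.
move=> ff' cf' If Ixf If'.
have cf : continuous f by move=> x; exact: der_continuous (ff' x).
have mf : measurable_fun setT f by exact: continuous_measurable.
have mf' : measurable_fun setT f' by exact: continuous_measurable.
have mxf : measurable_fun setT (fun x : R => (x - m) * f x) by apply: measurable_funM => //; exact: measurable_funB.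
have Ixf' := (normal_itg mxf).1 Ixf.
have If'' := (normal_itg mf').1 If'.
pose h x := f' x * g x - s ^- 2 * ((x - m) * f x * g x).
have hE x : der (fun x => f x * g x) x (h x).
  apply: der_eq (derM (ff' x) (normal_pdf_der x)) _.
  by rewrite /h; field.
have cg : continuous g by exact: continuous_normal_pdf.
have : Rintegral leb setT h = 0.
  apply: (lebesgue_der_eq0 hE).
  - move=> x; apply: cvgB; first by apply: cvgM; [exact: cf'|exact: cg].
    apply: cvgMr; apply: cvgM; last exact: cg.
    by apply: cvgM; [apply: cvgB; [exact: cvg_id|exact: cvg_cst]|exact: cf].
  - exact: (normal_itg mf).1.
  - exact: (itgB If'' (itgZl _ Ixf')).
rewrite /h EB//; last exact: itgZl.
rewrite EZl// (normal_E mxf) (normal_E mf') => /eqP.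
rewrite subr_eq0 => /eqP ->; rewrite mulrA mulfV ?mul1r//.
by rewrite expf_neq0.
Qed.

(** A power times the density of deviation [s] is dominated by a multiple of the density of
    deviation [2 * s]. With [r = |x - m|] the power is at most [k ^+ k * expR r], and completing the
    square gives r - r^2/(2 s^2) <= 2 s^2 - r^2/(8 s^2), the origin of the factor
    [expR (2 * s ^+ 2)]. *)
Lemma normal_moment (k : nat) : itg N (fun x : R => `|x - m| ^+ k).
Proof.
have mk : measurable_fun setT (fun x : R => `|x - m| ^+ k).
  by apply: measurable_funX; apply: measurableT_comp => //; exact: measurable_funB.
apply/(normal_itg mk).
have s20 : 2 * s != 0 by rewrite mulf_neq0.
have I := itgZl (k%:R ^+ k * expR (2 * s ^+ 2) * normal_peak s / normal_peak (2 * s))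
   (integrable_normal_pdf m (2 * s)).
apply: (le_itg _ I).
  apply: measurable_funM => //; exact: measurable_normal_pdf.
move=> x; rewrite normrM ger0_norm ?exprn_ge0// ger0_norm ?normal_pdf_ge0//.
rewrite !normal_pdfE// /normal_fun.
have p2 : normal_peak (2 * s) != 0 by rewrite gt_eqF// normal_peak_gt0.
rewrite [leRHS](_ : _ = normal_peak s *
  (k%:R ^+ k * (expR (2 * s ^+ 2) * expR (- (x - m) ^+ 2 / ((2 * s) ^+ 2 *+ 2))))); last by field.
rewrite mulrCA ler_wpM2l ?normal_peak_ge0//.
apply: le_trans (ler_wpM2r (expR_ge0 _) (exp_ge_pow k (normr_ge0 (x - m)))) _.
rewrite -mulrA ler_wpM2l ?exprn_ge0// -!expRD ler_expR.
have s2 : 0 < s ^+ 2 by rewrite exprn_even_gt0.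
rewrite -subr_ge0.
rewrite (_ : _ - _ = (3 / 8) / s ^+ 2 * (`|x - m| - (4 / 3) * s ^+ 2) ^+ 2 + (4 / 3) * s ^+ 2); last first.
  by rewrite -(real_normK (num_real (x - m))); field.
apply: addr_ge0; last by rewrite mulr_ge0// ltW.
by rewrite mulr_ge0 ?sqr_ge0// divr_ge0 ?ltW.
Qed.

Lemma normal_itg_poly (f : R -> R) (K : R) (k : nat) : measurable_fun setT f ->
  (forall x, `|f x| <= K * `|x - m| ^+ k) -> itg N f.
Proof.
move=> mf fK; apply: (le_itg _ (itgZl K (normal_moment k))); first exact: mf.
exact: fK.
Qed.

(** The characteristic function without complex numbers: cosine and sine are both bounded solutions
    of [f'' = - f]. Integration by parts turns the derivative in [t] into [c' = - (s ^+ 2 * t) * c],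
    so [c] divided by the Gaussian is constant. *)
Lemma normal_trig_ode (f f' : R -> R) :
  (forall x, der f x (f' x)) -> (forall x, der f' x (- f x)) ->
  (forall x, `|f x| <= 1) -> (forall x, `|f' x| <= 1) ->
  forall t, Rintegral N setT (fun x : R => f (t * (x - m))) =
    f 0 * expR (- (t ^+ 2 * s ^+ 2 / 2)).
Proof.
move=> ff' f'f f1 f'1.
have cf : continuous f by move=> x; exact: der_continuous (ff' x).
have cf' : continuous f' by move=> x; exact: der_continuous (f'f x).
have ct t : continuous (fun x : R => t * (x - m)).
  by move=> x; apply: cvgMr; apply: cvgB; [exact: cvg_id|exact: cvg_cst].
have cft t : continuous (fun x : R => f (t * (x - m))).
  by move=> x; apply: continuous_comp; [exact: ct|exact: cf].
have cft' t : continuous (fun x : R => f' (t * (x - m))).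
  by move=> x; apply: continuous_comp; [exact: ct|exact: cf'].
have mft t := continuous_measurable (cft t).
have mft' t := continuous_measurable (cft' t).
have If t : itg N (fun x : R => f (t * (x - m))) by apply: itg_bounded => [|x]; [exact: mft|exact: f1].
have If' t : itg N (fun x : R => f' (t * (x - m))) by apply: itg_bounded => [|x]; [exact: mft'|exact: f'1].
have Ixf' t : itg N (fun x : R => (x - m) * f' (t * (x - m))).
  apply: (@normal_itg_poly _ 1 1).
    by apply: measurable_funM => //; exact: measurable_funB.
  by move=> x; rewrite mul1r expr1 normrM ler_piMr.
pose c t := Rintegral N setT (fun x : R => f (t * (x - m))).
have dc t : der c t (- (s ^+ 2 * t) * c t).
  have -> : - (s ^+ 2 * t) * c t = Rintegral N setT (fun x : R => (x - m) * f' (t * (x - m))).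
    rewrite (@normal_ibp _ (fun x => - t * f (t * (x - m))))//.
    - by rewrite EZl; [rewrite -/(c t); ring|exact: If].
    - move=> x; have H := derZ t (derB (der_id x) (der_cst m x)).
      by apply: der_eq (@der_comp _ f' (fun x => t * (x - m)) x _ _ (f'f (t * (x - m))) H) _; ring.
    - by move=> x; apply: cvgMr; exact: cft.
    - exact: itgZl.
  (* Taylor's bound for [f], whose derivative is 1-Lipschitz, is integrated against the second
     moment. *)
  apply: (@der_quad _ _ _ _ (Rintegral N setT (fun x : R => `|x - m| ^+ 2))) => h.
  rewrite /c -EB// -EZl// -EB; [|exact: itgB|exact: itgZl].
  rewrite -EZr; last exact: normal_moment.
  apply: le_normE_le.
  - by apply: itgB; [exact: itgB|exact: itgZl].
  - exact/itgZr/normal_moment.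
  - move=> x /=; rewrite mulrDl mulrA.
    have -> : `|x - m| ^+ 2 * h ^+ 2 = 1 * (h * (x - m)) ^+ 2.
      by rewrite mul1r exprMn real_normK ?num_real// mulrC.
    apply: der_taylor => // y z.
    by apply: (@der_lip _ _ (fun z => - f z)) => // u; rewrite normrN.
pose e t : R := expR (t ^+ 2 * s ^+ 2 / 2).
have de t : der e t (s ^+ 2 * t * e t).
  have H := derZ (s ^+ 2 / 2) (der_sqr t).
  have K := der_comp (is_derive_expR _) H.
  apply: der_ext (der_eq K _) => [u|].
    by rewrite /e/=; congr expR; ring.
  rewrite /e; have -> : s ^+ 2 / 2 * t ^+ 2 = t ^+ 2 * s ^+ 2 / 2 by ring.
  by field.
move=> t; have := @is_derive_0_is_cst R (fun t => c t * e t) t 0.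
have : forall t, der (fun t => c t * e t) t 0.
  by move=> u; apply: der_eq (derM (dc u) (de u)) _; ring.
move=> H /(_ H).
rewrite {2}/c {2}/e expr0n/= mul0r mul0r expR0 mulr1.
have -> : Rintegral N setT (fun x : R => f (0 * (x - m))) = f 0.
  under eq_Rintegral do rewrite mul0r.
  by rewrite Rintegral_cst//= probability_setT mulr1.
by move=> <-; rewrite /c /e expRN mulfK// gt_eqF ?expR_gt0.
Qed.

Lemma normal_cos t : Rintegral N setT (fun x : R => cos (t * (x - m))) =
  expR (- (t ^+ 2 * s ^+ 2 / 2)).
Proof.
rewrite (@normal_trig_ode cos (fun x => - sin x)) ?cos0 ?mul1r//.
- by move=> x; exact: is_derive_cos.
- by move=> x; apply: derN; exact: is_derive_sin.
- by move=> x; rewrite ler_norml cos_geN1 cos_le1.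
- by move=> x; rewrite normrN ler_norml sin_geN1 sin_le1.
Qed.

Lemma normal_sin t : Rintegral N setT (fun x : R => sin (t * (x - m))) = 0.
Proof.
rewrite (@normal_trig_ode sin cos) ?sin0 ?mul0r//.
- by move=> x; exact: is_derive_sin.
- by move=> x; exact: is_derive_cos.
- by move=> x; rewrite ler_norml sin_geN1 sin_le1.
- by move=> x; rewrite ler_norml cos_geN1 cos_le1.
Qed.

Lemma normal_variance :
  itg N (fun x : R => (x - m) ^+ 2) /\ Rintegral N setT (fun x : R => (x - m) ^+ 2) = s ^+ 2.
Proof.
have I2 : itg N (fun x : R => (x - m) * (x - m)).
  apply: (@normal_itg_poly _ 1 2).
    by apply: measurable_funM; exact: measurable_funB.
  by move=> x; rewrite mul1r normrM.
split; first exact: I2.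
rewrite -[RHS]mulr1 -[X in _ * X](_ : Rintegral N setT (fun=> 1) = 1); last first.
  by rewrite Rintegral_cst//= probability_setT mulr1.
rewrite -(@normal_ibp (fun x => x - m))//.
- by move=> x; apply: der_eq (derB (der_id x) (der_cst m x)) _; rewrite subr0.
- by move=> x; exact: cvg_cst.
- apply: (@normal_itg_poly _ 1 1); first exact: measurable_funB.
  by move=> x; rewrite mul1r.
- exact: itg_cst.
Qed.

End normal.

(** * Fourier uniqueness and independence *)

Section fubini.
Context d1 d2 (T1 : measurableType d1) (T2 : measurableType d2) (R : realType).
Variables (m1 : {finite_measure set T1 -> \bar R}).
Variables (m2 : {sigma_finite_measure set T2 -> \bar R}).
Variables (f : T1 * T2 -> R) (K : T1 -> R).
Hypothesis IK : itg m1 K.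
Hypothesis mf : measurable_fun setT f.
Hypothesis f2 : forall x, itg m2 (fun y => f (x, y)).
Hypothesis fK : forall x, Rintegral m2 setT (fun y => `|f (x, y)|) <= K x.

Lemma itg_prod : itg (m1 \x m2)%E f.
Proof.
apply/integrable12ltyP; first exact/measurable_EFinP.
apply: (@le_lt_trans _ _ (\int[m1]_x (K x)%:E)%E); last by rewrite (E_EFin IK) ltry.
apply: ge0_le_integral => //.
- by move=> x _; apply: integral_ge0.
- apply: (measurable_fun_fubini_tonelli_F (fun z => `|(f z)%:E|%E)) => //.
  by apply/measurable_EFinP; exact: measurableT_comp.
- by apply/measurable_EFinP; exact: itg_meas IK.
- move=> x _; rewrite (E_EFin (f := fun y => `|f (x, y)|)) ?lee_fin//.
  exact: itg_norm.
Qed.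

Lemma E_fubini : (forall y, itg m1 (fun x => f (x, y))) ->
  Rintegral m1 setT (fun x => Rintegral m2 setT (fun y => f (x, y))) =
  Rintegral m2 setT (fun y => Rintegral m1 setT (fun x => f (x, y))).
Proof.
move=> f1; have := Fubini itg_prod => /(congr1 fine).
rewrite /Rintegral => H; apply: etrans (etrans H _); congr fine;
  apply: eq_integral => z _; rewrite fineK//.
- exact: (integrable_fin_num measurableT (f2 z)).
- exact: (integrable_fin_num measurableT (f1 z)).
Qed.

Lemma itg_fubini : itg m1 (fun x => Rintegral m2 setT (fun y => f (x, y))).
Proof.
have := integrable_fubini_F itg_prod; apply: eq_integrable => // x _.
rewrite /fubini_F/= /Rintegral fineK//.
exact: (integrable_fin_num measurableT (f2 x)).
Qed.

End fubini.

Section trigonometric_bounds.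
Context d (T : measurableType d) (R : realType).

Lemma measurable_cos_fun (f : T -> R) : measurable_fun setT f ->
  measurable_fun setT (fun w => cos (f w)).
Proof.
by move=> mf; apply: (measurableT_comp _ mf); apply: continuous_measurable; exact: continuous_cos.
Qed.

Lemma measurable_sin_fun (f : T -> R) : measurable_fun setT f ->
  measurable_fun setT (fun w => sin (f w)).
Proof.
by move=> mf; apply: (measurableT_comp _ mf); apply: continuous_measurable; exact: continuous_sin.
Qed.

Lemma normr_cos_le1 (x : R) : `|cos x| <= 1.
Proof. by rewrite ler_norml cos_geN1 cos_le1. Qed.

Lemma normr_sin_le1 (x : R) : `|sin x| <= 1.
Proof. by rewrite ler_norml sin_geN1 sin_le1. Qed.

End trigonometric_bounds.

Section fourier1.
Context d (T : measurableType d) (R : realType) (P : {finite_measure set T -> \bar R}).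
Variables (V G : T -> R) (M : R).
Hypothesis mV : measurable_fun setT V.
Hypothesis mG : measurable_fun setT G.
Hypothesis GM : forall w, `|G w| <= M.
Local Notation E f := (Rintegral P setT f).
Hypothesis cosG : forall t, E (fun w => cos (t * V w) * G w) = 0.
Hypothesis sinG : forall t, E (fun w => sin (t * V w) * G w) = 0.

Let M0 : 0 <= M. Proof. exact: le_trans (GM point). Qed.

Let itgMG (f : T -> R) : measurable_fun setT f -> (forall w, `|f w| <= 1) ->
  itg P (fun w => f w * G w).
Proof.
move=> mf f1; apply: (itgMb mf f1); apply: itg_bounded GM; exact: mG.
Qed.

Let cos_shift_eq0 t y : E (fun w => cos ((V w - y) * t) * G w) = 0.
Proof.
have mtV : measurable_fun setT (fun w => t * V w) by exact: measurable_funM.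
transitivity (E (fun w => cos (t * y) * (cos (t * V w) * G w) +
    sin (t * y) * (sin (t * V w) * G w))).
  apply: eq_Rintegral => w _.
  by rewrite (_ : (V w - y) * t = t * V w - t * y) ?cosB; ring.
have Ic : itg P (fun w => cos (t * V w) * G w).
  apply: itgMG; first exact: measurable_cos_fun.
  by move=> w; rewrite ler_norml cos_geN1 cos_le1.
have Is : itg P (fun w => sin (t * V w) * G w).
  apply: itgMG; first exact: measurable_sin_fun.
  by move=> w; rewrite ler_norml sin_geN1 sin_le1.
by rewrite ED ?EZl ?cosG ?sinG ?mulr0 ?addr0//; exact: itgZl.
Qed.

(** A Gaussian of width [s] is the characteristic function of the centered normal law of deviation
    [s^-1]; Fubini then reduces the claim to [cos_shift_eq0]. *)
Let gauss_eq0 y (s : R) : s != 0 -> E (fun w => normal_fun y s (V w) * G w) = 0.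
Proof.
move=> s0; have s0' : s^-1 != 0 by rewrite invr_eq0.
transitivity (E (fun w => Rintegral (normal_prob 0 s^-1) setT
    (fun x : R => cos ((V w - y) * x) * G w))).
  apply: eq_Rintegral => w _; rewrite EZr.
    have <- : Rintegral (normal_prob 0 s^-1) setT (fun x : R => cos ((V w - y) * (x - 0))) =
      Rintegral (normal_prob 0 s^-1) setT (fun x : R => cos ((V w - y) * x)).
      by apply: eq_Rintegral => x _; rewrite subr0.
    rewrite normal_cos//; congr (expR _ * _); field => //.
  apply: itg_bounded (1) _ _.
    by apply: continuous_measurable => x; apply: continuous_comp;
      [apply: cvgMr; exact: cvg_id|exact: continuous_cos].
  by move=> x; rewrite ler_norml cos_geN1 cos_le1.
pose f (z : T * R) := cos ((V z.1 - y) * z.2) * G z.1.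
have mf : measurable_fun setT f.
  apply: measurable_funM; last exact: measurableT_comp.
  apply: measurableT_comp; first by apply: continuous_measurable; exact: continuous_cos.
  apply: measurable_funM; last exact: measurable_snd.
  by apply: measurable_funB => //; exact: measurableT_comp.
have fM z : `|f z| <= M.
  rewrite normrM -[leRHS]mul1r ler_pM//.
  by rewrite ler_norml cos_geN1 cos_le1.
have f2 x : itg (normal_prob 0 s^-1) (fun z => f (x, z)).
  by apply: (@itg_bounded _ _ _ _ _ M) => //; exact: measurableT_comp.
rewrite (@E_fubini _ _ _ _ _ P (normal_prob 0 s^-1) f (fun=> M) (itg_cst P M))//.
- by under eq_Rintegral do rewrite cos_shift_eq0; exact: E0.
- move=> x; rewrite -[leRHS]mulr1 -[X in _ <= M * X](_ : Rintegral (normal_prob 0 s^-1) setT (fun=> 1) = 1); last first.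
    by rewrite Rintegral_cst//= probability_setT mulr1.
  rewrite -EZl; last exact: itg_cst.
  apply: le_E; [exact: itg_norm|exact/itgZl/itg_cst|].
  by move=> z; rewrite mulr1.
- by move=> x; apply: (@itg_bounded _ _ _ _ _ M) => //; exact: measurableT_comp.
Qed.

(** The convolution of [phi] with a normal density is a mixture of the Gaussians handled by
    [gauss_eq0], centred at the integration variable. *)
Let smooth_eq0 (phi : R -> R) (s : R) : s != 0 -> measurable_fun setT phi ->
  (forall x, `|phi x| <= 1) ->
  itg P (fun w => Rintegral (normal_prob (V w) s) setT phi * G w) /\
  E (fun w => Rintegral (normal_prob (V w) s) setT phi * G w) = 0.
Proof.
move=> s0 mphi phi1.
have Iphi m : itg (normal_prob m s) phi.
  by apply: itg_bounded => [|x]; [exact: mphi|exact: phi1].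
have I m := (normal_itg m s mphi).1 (Iphi m).
have -> : (fun w => Rintegral (normal_prob (V w) s) setT phi * G w) =
   (fun w => Rintegral lebesgue_measure setT
     (fun x : R => phi x * normal_pdf (V w) s x * G w)).
  by apply/funext => w; rewrite EZr// normal_E.
pose f (z : T * R) := phi z.2 * normal_pdf (V z.1) s z.2 * G z.1.
have mf : measurable_fun setT f.
  apply: measurable_funM; last exact: measurableT_comp.
  apply: measurable_funM; first exact: measurableT_comp.
  under eq_fun do rewrite normal_pdfE//.
  apply: measurable_funM => //; apply: measurableT_comp => //.
  apply: measurable_funM => //; apply: measurableT_comp => //.
  apply: measurable_funX; apply: measurable_funB; first exact: measurable_snd.
  exact: measurableT_comp.
have f2 x : itg lebesgue_measure (fun z => f (x, z)) by exact: (itgZr (G x) (I (V x))).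
have fM x : Rintegral lebesgue_measure setT (fun y => `|f (x, y)|) <= M.
  rewrite -[leRHS]mulr1 -[X in _ <= M * X](_ : Rintegral lebesgue_measure setT (normal_pdf (V x) s) = 1); last first.
    by rewrite /Rintegral integral_normal_pdf.
  have In := integrable_normal_pdf (V x) s.
  rewrite -EZl//; apply: le_E; [exact: itg_norm|exact: itgZl|].
  move=> z; rewrite /f/= !normrM mulrC ler_pM// (ger0_norm (normal_pdf_ge0 _ _ _)).
  by rewrite ler_piMl// normal_pdf_ge0.
split; first exact: (@itg_fubini _ _ _ _ _ P lebesgue_measure f (fun=> M) (itg_cst P M)).
rewrite (@E_fubini _ _ _ _ _ P lebesgue_measure f (fun=> M) (itg_cst P M))//.
- rewrite -[RHS](@E0 _ _ R lebesgue_measure); apply: eq_Rintegral => y _.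
  transitivity (E (fun w => phi y * normal_peak s * (normal_fun y s (V w) * G w))).
    apply: eq_Rintegral => w _; rewrite /f/= normal_pdfE// /normal_fun.
    rewrite -(opprB (V w)) sqrrN; ring.
  rewrite EZl ?gauss_eq0 ?mulr0//; apply: itgMG.
    by apply: measurableT_comp => //; exact: measurable_normal_fun.
  move=> w; rewrite ger0_norm ?expR_ge0// -[leRHS]expR0 ler_expR.
  by rewrite mulNr oppr_le0 divr_ge0 ?sqr_ge0// mulrn_wge0// sqr_ge0.
- move=> y; apply: (@itg_bounded _ _ _ _ _ (normal_peak s * M)).
    exact: measurableT_comp.
  move=> w; rewrite /f/= !normrM ler_pM// (ger0_norm (normal_pdf_ge0 _ _ _)).
  by rewrite -[leRHS]mul1r ler_pM// ?normal_pdf_ge0// normal_pdf_ub.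
Qed.

(** Smoothing at scale [s] moves a Lipschitz function by at most [L * s], so the expectation is at
    most [B * s] for every [s > 0], hence zero. *)
Let lipschitz_eq0 (phi : R -> R) (L : R) : (forall x, `|phi x| <= 1) ->
  (forall x y, `|phi x - phi y| <= L * `|x - y|) -> continuous phi ->
  E (fun w => phi (V w) * G w) = 0.
Proof.
move=> phi1 phiL cphi; have mphi := continuous_measurable cphi.
have L0 : 0 <= L by have := phiL 1 0; rewrite subr0 normr1 mulr1; exact: le_trans.
pose B := L * M * fine (P setT).
suff H (s : R) : 0 < s -> `|E (fun w => phi (V w) * G w)| <= B * s.
  apply/eqP; rewrite -normr_eq0 eq_le normr_ge0 andbT leNgt; apply/negP => p.
  have B0 : 0 <= B.
    have := H 1 ltr01; rewrite mulr1; exact: le_trans.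
  have := H (`|E (fun w => phi (V w) * G w)| / (B + 1)).
  set x := `|_|; rewrite divr_gt0//; last by rewrite ltr_wpDl.
  move=> /(_ isT); rewrite mulrA ler_pdivlMr; last by rewrite ltr_wpDl.
  by rewrite leNgt -subr_gt0 (_ : _ - _ = x); [rewrite p|ring].
move=> s0; have sn0 : s != 0 by rewrite gt_eqF.
have Iphi m : itg (normal_prob m s) phi.
  by apply: itg_bounded => [|x]; [exact: mphi|exact: phi1].
have mpV : measurable_fun setT (fun w => phi (V w)) by exact: measurableT_comp.
have near_phi m : `|phi m - Rintegral (normal_prob m s) setT phi| <= L * s.
  have -> : phi m - Rintegral (normal_prob m s) setT phi =
      Rintegral (normal_prob m s) setT (fun x : R => phi m - phi x).
    rewrite EB//; last exact: itg_cst.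
    by rewrite Rintegral_cst//= probability_setT mulr1.
  have [I2 E2] := normal_variance m sn0.
  (* The bound [r <= (s + r ^+ 2 / s) / 2] replaces the first absolute moment by the variance
     [s ^+ 2]. *)
  have <- : Rintegral (normal_prob m s) setT (fun x : R => L / 2 * (s + s^-1 * (x - m) ^+ 2)) = L * s.
    have I3 : itg (normal_prob m s) (fun x : R => s^-1 * (x - m) ^+ 2) by exact: itgZl.
    rewrite EZl; last by apply: itgD => //; exact: itg_cst.
    rewrite ED//; last exact: itg_cst.
    rewrite EZl// E2 Rintegral_cst//= probability_setT mulr1; field => //.
  apply: le_normE_le.
  - by apply: itgB => //; exact: itg_cst.
  - by apply: itgZl; apply: itgD; [exact: itg_cst|exact: itgZl].
  - move=> x; apply: le_trans (phiL _ _) _; rewrite -mulrA ler_wpM2l// distrC.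
    rewrite -(real_normK (num_real (x - m))).
    have := sqr_ge0 (`|x - m| - s); set r := `|x - m| => H.
    rewrite -subr_ge0 (_ : _ - _ = 2^-1 * s^-1 * (r - s) ^+ 2); last by field.
    by rewrite mulr_ge0// mulr_ge0// invr_ge0// ltW.
have [Iav E_av] := smooth_eq0 sn0 mphi phi1.
have -> : E (fun w => phi (V w) * G w) =
   E (fun w => (phi (V w) - Rintegral (normal_prob (V w) s) setT phi) * G w).
  under [RHS]eq_Rintegral do rewrite mulrBl.
  by rewrite EB ?E_av ?subr0//; exact: itgMG.
have -> : B * s = E (fun=> L * s * M).
  by rewrite Rintegral_cst// /B; ring.
apply: le_normE_le; last by move=> w; rewrite normrM ler_pM.
- apply: itg_ext (itgB (itgMG mpV _) Iav) => // w.
  by rewrite mulrBl.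
- exact: itg_cst.
Qed.

(** Continuous piecewise linear functions converge to the indicator of the open ray from below. The
    factor [G] carries whatever depends on the other variables, so that indicators can replace
    trigonometric functions one variable at a time. *)
Lemma fourier_ray a : E (fun w => \1_`]a, +oo[ (V w) * G w) = 0.
Proof.
pose phi (k : nat) (x : R) := Num.min 1 (Num.max 0 (k%:R * (x - a))).
have phi1 k x : `|phi k x| <= 1.
  rewrite ger0_norm /phi; first by rewrite ge_min lexx.
  by rewrite le_min ler01 le_max lexx.
have phiL k x y : `|phi k x - phi k y| <= k%:R * `|x - y|.
  have mm (u v : R) : `|Num.min 1 (Num.max 0 u) - Num.min 1 (Num.max 0 v)| <= `|u - v|.
    have d1 := ler_norm (u - v); have d2 := ler_norm (v - u).
    rewrite (distrC v) in d2; rewrite ler_norml.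
    have [u0|u0] := leP 0 u; have [v0|v0] := leP 0 v; rewrite ?(min_r ler01)//.
    - by case: (leP 1 u) => ?; case: (leP 1 v) => ?; apply/andP; split; lra.
    - by case: (leP 1 u) => ?; apply/andP; split; lra.
    - by case: (leP 1 v) => ?; apply/andP; split; lra.
    - by apply/andP; split; lra.
  apply: le_trans (mm _ _) _.
  by rewrite -mulrBr normrM ger0_norm// ler_wpM2l// (_ : x - a - _ = x - y)//; ring.
have cphi k : continuous (phi k).
  move=> x; apply/cvgrPdist_le => /= e e0.
  near=> y; apply: le_trans (phiL _ _ _) _.
  have k0 : (0 : R) < k%:R + 1 by rewrite ltr_wpDl.
  apply: (@le_trans _ _ ((k%:R + 1) * (e / (k%:R + 1)))); last first.
    by rewrite mulrC divfK// gt_eqF.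
  apply: ler_pM => //; first by rewrite lerDl.
  by near: y; apply: cvgr_dist_le; [exact: cvg_id|rewrite divr_gt0].
pose u k w := phi k (V w) * G w.
have [_ H] : itg P (fun w => \1_`]a, +oo[ (V w) * G w) /\
    E (u k) @[k --> \oo] --> E (fun w => \1_`]a, +oo[ (V w) * G w).
  apply: (@E_dominated _ _ _ _ _ _ (fun=> M)).
  - move=> k; apply: measurable_funM => //; apply: measurableT_comp => //.
    exact: continuous_measurable.
  - exact: itg_cst.
  - move=> w; apply: cvgMl; apply: cvg_near_cst; near=> k.
    rewrite indicE mem_setE in_itv/= andbT /phi; have [aV|Va] := ltP a (V w); last first.
      rewrite (_ : Num.max _ _ = 0) ?minEle ?ler10//.
      by apply/max_idPl; rewrite mulr_ge0_le0// subr_le0.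
    apply/min_idPl; rewrite le_max; apply/orP; right.
    rewrite -ler_pdivrMr ?subr_gt0//; near: k; exact: nbhs_infty_ger.
  - by move=> k w; rewrite /u normrM -[leRHS]mul1r ler_pM.
have u0 k : E (u k) = 0 by exact: lipschitz_eq0 (phi1 k) (phiL k) (cphi k).
move: H; under eq_fun do rewrite u0.
by move=> /(cvg_unique (@Rhausdorff R) (cvg_cst 0)).
Unshelve. all: by end_near. Qed.

End fourier1.

Section tuple_rays.
Context (R : realType) (r : nat).

Definition rays (a : 'I_r -> R) : set (r.-tuple R) :=
  [set t | forall i, a i < tnth t i].

Lemma measurable_rays a : measurable (rays a).
Proof.
have -> : rays a = \big[setI/setT]_(i < r) ((fun t => tnth t i) @^-1` `]a i, +oo[).
  apply/seteqP; split=> t.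
    by move=> H; rewrite -bigcap_seq => i _ /=; rewrite in_itv/= andbT; exact: H.
  rewrite -bigcap_seq => H i; have := H i; rewrite /= in_itv/= andbT; apply.
  by rewrite mem_index_enum.
apply: bigsetI_measurable => i _.
rewrite -[X in measurable X]setTI; apply: measurable_tnth => //.
Qed.

(** Open orthants form a class stable under intersection that generates the product sigma-algebra
    and exhausts the space. *)
Lemma tuple_measure_unique (m1 m2 : {measure set (r.-tuple R) -> \bar R}) :
  (m1 setT < +oo)%E -> (forall a, m1 (rays a) = m2 (rays a)) ->
  forall A, measurable A -> m1 A = m2 A.
Proof.
move=> m1oo m12 A mA.
pose G : set (set (r.-tuple R)) := range rays.
have sG : <<s G >> A.
  pose idG : g_sigma_algebraType G -> r.-tuple R := idfun.
  have : measurable_fun setT idG.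
    apply/measurable_fun_tnthP => i.
    apply: (@measurability _ _ _ _ _ _ (@RGenOInfty.G R)).
      exact: RGenOInfty.measurableE.
    move=> _ [_ [x ->] <-]; rewrite setTI.
    (* A half-space in one coordinate is a countable union of orthants whose other bounds tend to
       minus infinity. *)
    have -> : (fun t => tnth (idG t) i) @^-1` `]x, +oo[%classic =
        \bigcup_(n in [set: nat]) rays (fun j => if j == i then x else - n%:R).
      apply/seteqP; split => t /=.
        rewrite in_itv/= andbT => xt.
        have [n tn] : exists n : nat, forall j, - n%:R < tnth t j.
          have [n nP] : exists n : nat, forall j : 'I_r, `|tnth t j| < n%:R.
            have : \forall n \near \oo, forall j : 'I_r, `|tnth t j| < n%:R.
              by apply: filter_forall => j; exact: nbhs_infty_gtr.
            by move=> [n _ /(_ n (leqnn n))]; exists n.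
          exists n => j; have := nP j; rewrite ltr_norml => /andP[].
          by [].
        by exists n => // j; case: eqP => [->//|_]; exact: tn.
      by move=> [n _ /(_ i)]; rewrite eqxx in_itv/= andbT.
    apply: bigcup_measurable => n _.
    by apply: sub_sigma_algebra; exists (fun j => if j == i then x else - n%:R).
  by move=> /(_ measurableT A mA); rewrite setTI.
apply: (@g_sigma_algebra_measure_unique _ _ _ G _ (fun n => rays (fun=> - n%:R)) _ _ m1 m2 _ _ _ _ sG) => //.
- by move=> _ [a _ <-]; exact: measurable_rays.
- by move=> n; exists (fun=> - n%:R).
- apply/seteqP; split=> // t _.
  have : \forall n \near \oo, forall j : 'I_r, `|tnth t j| < n%:R.
    by apply: filter_forall => j; exact: nbhs_infty_gtr.
  move=> [n _ /(_ n (leqnn n)) nP]; exists n => // j.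
  by have := nP j; rewrite ltr_norml => /andP[].
- move=> _ _ [a _ <-] [b _ <-]; exists (fun i => Num.max (a i) (b i)) => //.
  apply/seteqP; split=> t.
    by move=> H; split=> i; have := H i; rewrite gt_max => /andP[].
  by move=> [Ha Hb] i; rewrite gt_max Ha Hb.
- by move=> _ [a _ <-].
- move=> n; apply: le_lt_trans m1oo; apply: le_measure; rewrite ?inE//.
  exact: measurable_rays.
Qed.

End tuple_rays.

Section fourier.
Context d (T : measurableType d) (R : realType) (P : {finite_measure set T -> \bar R}).
Variable V : nat -> T -> R.
Hypothesis mV : forall i, measurable_fun setT (V i).
Local Notation E f := (Rintegral P setT f).
Local Notation lin r b w := (\sum_(i < r) b (nat_of_ord i) * V i w).

Lemma measurable_lin r (b : nat -> R) : measurable_fun setT (fun w => lin r b w).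
Proof. by apply: measurable_sum => i; exact: measurable_funM. Qed.

(** Induction on the number of variables: the indicator of the last one is absorbed into [G], which
    is why [G] is an arbitrary bounded function. The hypotheses for the new [G] follow from
    [fourier_ray], whose own hypotheses come from the product-to-sum formulas. *)
Lemma fourier_rays r (G : T -> R) (M : R) : measurable_fun setT G ->
  (forall w, `|G w| <= M) ->
  (forall b, E (fun w => cos (lin r b w) * G w) = 0) ->
  (forall b, E (fun w => sin (lin r b w) * G w) = 0) ->
  forall a : nat -> R, E (fun w => (\prod_(i < r) \1_`]a i, +oo[ (V i w)) * G w) = 0.
Proof.
elim: r G M => [|r ih] G M mG GM cG sG a.
  rewrite -[RHS](cG (fun=> 0)); apply: eq_Rintegral => w _.
  by rewrite !big_ord0 cos0.
have IG (f : T -> R) : measurable_fun setT f -> (forall w, `|f w| <= 1) ->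
    itg P (fun w => f w * G w).
  by move=> mf f1; apply: (itgMb mf f1); apply: itg_bounded GM; exact: mG.
have linS b t w : lin r b w + t * V r w =
    lin r.+1 (fun i => if i == r then t else b i) w.
  rewrite big_ord_recr/= eqxx; congr (_ + _); apply: eq_bigr => i _.
  by rewrite ltn_eqF.
have Ic b : itg P (fun w => cos (lin r.+1 b w) * G w).
  by apply: IG => [|w]; [exact/measurable_cos_fun/measurable_lin|exact: normr_cos_le1].
have Is b : itg P (fun w => sin (lin r.+1 b w) * G w).
  by apply: IG => [|w]; [exact/measurable_sin_fun/measurable_lin|exact: normr_sin_le1].
have half (f g : T -> R) : itg P (fun w => f w * G w) -> itg P (fun w => g w * G w) ->
    E (fun w => f w * G w) = 0 -> E (fun w => g w * G w) = 0 ->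
    E (fun w => 2^-1 * (f w + g w) * G w) = 0.
  move=> If Ig f0 g0.
  transitivity (2^-1 * (E (fun w => f w * G w) + E (fun w => g w * G w))).
    rewrite -ED// -EZl; last exact: itgD.
    by apply: eq_Rintegral => w _; ring.
  by rewrite f0 g0 addr0 mulr0.
have half' (f g : T -> R) : itg P (fun w => f w * G w) -> itg P (fun w => g w * G w) ->
    E (fun w => f w * G w) = 0 -> E (fun w => g w * G w) = 0 ->
    E (fun w => 2^-1 * (f w - g w) * G w) = 0.
  move=> If Ig f0 g0.
  transitivity (2^-1 * (E (fun w => f w * G w) - E (fun w => g w * G w))).
    rewrite -EB// -EZl; last exact: itgB.
    by apply: eq_Rintegral => w _; ring.
  by rewrite f0 g0 subr0 mulr0.
have mGc b : measurable_fun setT (fun w => cos (lin r b w) * G w).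
  by apply: measurable_funM => //; exact/measurable_cos_fun/measurable_lin.
have mGs b : measurable_fun setT (fun w => sin (lin r b w) * G w).
  by apply: measurable_funM => //; exact/measurable_sin_fun/measurable_lin.
have GcM b w : `|cos (lin r b w) * G w| <= M.
  by rewrite normrM -[leRHS]mul1r ler_pM// normr_cos_le1.
have GsM b w : `|sin (lin r b w) * G w| <= M.
  by rewrite normrM -[leRHS]mul1r ler_pM// normr_sin_le1.
have mray : measurable_fun setT (fun w => \1_`]a r, +oo[ (V r w) : R).
  by apply: measurableT_comp => //; exact: measurable_indic.
pose G' w := \1_`]a r, +oo[ (V r w) * G w.
transitivity (E (fun w => (\prod_(i < r) \1_`]a i, +oo[ (V i w)) * G' w)).
  by apply: eq_Rintegral => w _; rewrite big_ord_recr/= /G' mulrA.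
apply: (ih G' M).
- exact: measurable_funM.
- move=> w; rewrite /G' normrM -[leRHS]mul1r ler_pM// indicE.
  by case: (_ \in _); rewrite ?normr0 ?normr1.
- move=> b; rewrite -[RHS](@fourier_ray _ _ _ P (V r) _ M (mV r) (mGc b) (GcM b) _ _ (a r)).
  + by apply: eq_Rintegral => w _; rewrite /G'; ring.
  + move=> t; rewrite -[RHS](half _ _ (Ic (fun i => if i == r then - t else b i)) (Ic (fun i => if i == r then t else b i)) (cG _) (cG _)).
    by apply: eq_Rintegral => w _; rewrite -(linS b t) -(linS b (- t)) mulNr cosB cosD; field.
  + move=> t; rewrite -[RHS](half' _ _ (Is (fun i => if i == r then t else b i)) (Is (fun i => if i == r then - t else b i)) (sG _) (sG _)).
    by apply: eq_Rintegral => w _; rewrite -(linS b t) -(linS b (- t)) mulNr sinB sinD; field.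
- move=> b; rewrite -[RHS](@fourier_ray _ _ _ P (V r) _ M (mV r) (mGs b) (GsM b) _ _ (a r)).
  + by apply: eq_Rintegral => w _; rewrite /G'; ring.
  + move=> t; rewrite -[RHS](half _ _ (Is (fun i => if i == r then - t else b i)) (Is (fun i => if i == r then t else b i)) (sG _) (sG _)).
    by apply: eq_Rintegral => w _; rewrite -(linS b t) -(linS b (- t)) mulNr sinB sinD; field.
  + move=> t; rewrite -[RHS](half' _ _ (Ic (fun i => if i == r then - t else b i)) (Ic (fun i => if i == r then t else b i)) (cG _) (cG _)).
    by apply: eq_Rintegral => w _; rewrite -(linS b t) -(linS b (- t)) mulNr cosB cosD; field.
Qed.

End fourier.

Section independence.
Context d (T : measurableType d) (R : realType) (P : probability T R) (r : nat).
Variables (U : {RV P >-> R}) (Y : 'I_r -> {RV P >-> R}).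
Local Notation E f := (Rintegral P setT f).
Variables (c : R -> R) (v : ('I_r -> R) -> R).
Hypotheses (c0 : c 0 = 1) (v0 : v (fun=> 0) = 1).
Hypothesis joint_cos : forall t b,
  E (fun w => cos (t * U w + \sum_(i < r) b i * Y i w)) = c t * v b.
Hypothesis joint_sin : forall t b,
  E (fun w => sin (t * U w + \sum_(i < r) b i * Y i w)) = 0.

Let S b w := \sum_(i < r) b i * Y i w.

Let mS b : measurable_fun setT (S b).
Proof. by apply: measurable_sum => i; exact: measurable_funM. Qed.

Let Icos (f : T -> R) : measurable_fun setT f -> itg P (fun w => cos (f w)).
Proof.
move=> mf; apply: (@itg_bounded _ _ _ P _ _ (measurable_cos_fun mf)) => w.
exact: normr_cos_le1.
Qed.

Let Isin (f : T -> R) : measurable_fun setT f -> itg P (fun w => sin (f w)).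
Proof.
move=> mf; apply: (@itg_bounded _ _ _ P _ _ (measurable_sin_fun mf)) => w.
exact: normr_sin_le1.
Qed.

Let mUS t b : measurable_fun setT (fun w => t * U w + S b w).
Proof. by apply: measurable_funD => //; exact: measurable_funM. Qed.

Let oppS b w : S (fun i => - b i) w = - S b w.
Proof. by rewrite /S -sumrN; apply: eq_bigr => i _; rewrite mulNr. Qed.

Let cosS b : E (fun w => cos (S b w)) = v b.
Proof.
rewrite -[RHS]mul1r -c0 -joint_cos; apply: eq_Rintegral => w _.
by rewrite mul0r add0r.
Qed.

Let sinS b : E (fun w => sin (S b w)) = 0.
Proof.
rewrite -[RHS](joint_sin 0 b); apply: eq_Rintegral => w _.
by rewrite mul0r add0r.
Qed.

Let vN b : v (fun i => - b i) = v b.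
Proof. by rewrite -!cosS; apply: eq_Rintegral => w _; rewrite oppS cosN. Qed.

Let cosU t : E (fun w => cos (t * U w)) = c t.
Proof.
rewrite -[RHS]mulr1 -v0 -joint_cos; apply: eq_Rintegral => w _.
by rewrite big1 ?addr0// => i _; rewrite mul0r.
Qed.

Let sinU t : E (fun w => sin (t * U w)) = 0.
Proof.
rewrite -[RHS](joint_sin t (fun=> 0)); apply: eq_Rintegral => w _.
by rewrite big1 ?addr0// => i _; rewrite mul0r.
Qed.

Let half (f g h : T -> R) k : itg P f -> itg P g ->
  (forall w, h w = 2^-1 * (f w + k * g w)) -> E h = 2^-1 * (E f + k * E g).
Proof.
move=> If Ig hE; rewrite -EZl// -ED//; last exact: itgZl.
rewrite -EZl; last by apply: itgD => //; exact: itgZl.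
by apply: eq_Rintegral => w _.
Qed.

(** The product-to-sum formulas express this and the next three products through the joint
    characteristic function at [b] and [- b]; evenness of [v] identifies the two values of the
    cosine part. *)
Let coscos t b : E (fun w => cos (t * U w) * cos (S b w)) = c t * v b.
Proof.
rewrite (half (k := 1) (Icos (mUS t b)) (Icos (mUS t (fun i => - b i)))).
  by rewrite !joint_cos vN mul1r; field.
by move=> w; rewrite mul1r oppS cosB cosD; field.
Qed.

Let sincos t b : E (fun w => sin (t * U w) * cos (S b w)) = 0.
Proof.
rewrite (half (k := 1) (Isin (mUS t b)) (Isin (mUS t (fun i => - b i)))).
  by rewrite !joint_sin; ring.
by move=> w; rewrite mul1r oppS sinB sinD; field.
Qed.

Let cossin t b : E (fun w => cos (t * U w) * sin (S b w)) = 0.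
Proof.
rewrite (half (k := -1) (Isin (mUS t b)) (Isin (mUS t (fun i => - b i)))).
  by rewrite !joint_sin; ring.
by move=> w; rewrite mulN1r oppS sinB sinD; field.
Qed.

Let sinsin t b : E (fun w => sin (t * U w) * sin (S b w)) = 0.
Proof.
rewrite (half (k := -1) (Icos (mUS t (fun i => - b i))) (Icos (mUS t b))).
  by rewrite !joint_cos vN; ring.
by move=> w; rewrite mulN1r oppS cosB cosD; field.
Qed.

Let mtU t : measurable_fun setT (fun w => t * U w).
Proof. exact: measurable_funM. Qed.

Let I1 a w : R := \1_`]a, +oo[ (U w).

Let mI1 a : measurable_fun setT (I1 a).
Proof. by apply: measurableT_comp => //; exact: measurable_indic. Qed.

Let I1_le1 a w : `|I1 a w| <= 1.
Proof. by rewrite /I1 indicE; case: (_ \in _); rewrite ?normr0 ?normr1. Qed.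

Let II1 a : itg P (I1 a).
Proof. by apply: itg_bounded => [|x]; [exact: mI1|exact: I1_le1]. Qed.

(** By [coscos] and [sincos] the centred variable [cos (S b) - v b] is orthogonal to every
    trigonometric function of [U], hence to indicators of rays. *)
Let ray_cos a b : E (fun w => I1 a w * cos (S b w)) = E (I1 a) * v b.
Proof.
have mG : measurable_fun setT (fun w => cos (S b w) - v b).
  by apply: measurable_funB => //; exact: measurable_cos_fun.
have GM w : `|cos (S b w) - v b| <= 1 + `|v b|.
  by apply: le_trans (ler_normB _ _) _; rewrite lerD2r normr_cos_le1.
have ICC : itg P (fun w => I1 a w * cos (S b w)).
  by apply: (itgMb (mI1 a) (I1_le1 a)); exact: Icos.
have H : E (fun w => I1 a w * (cos (S b w) - v b)) = 0.
  apply: (@fourier_ray _ _ _ P U _ _ _ mG GM) => [|t|t].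
  exact: measurable_funPT.
- under eq_Rintegral do rewrite mulrBr.
  rewrite EB.
  + by rewrite coscos EZr ?cosU ?subrr//; exact: Icos.
  + apply: (itgMb (measurable_cos_fun (mtU t))) (Icos (mS b)) => w.
    exact: normr_cos_le1.
  + exact/itgZr/Icos.
- under eq_Rintegral do rewrite mulrBr.
  rewrite EB.
  + by rewrite sincos EZr ?sinU ?mul0r ?subrr//; exact: Isin.
  + apply: (itgMb (measurable_sin_fun (mtU t))) (Icos (mS b)) => w.
    exact: normr_sin_le1.
  + exact/itgZr/Isin.
apply/eqP; rewrite -subr_eq0 -EZr// -EB//; last exact: itgZr.
apply/eqP; rewrite -[RHS]H; apply: eq_Rintegral => w _.
by rewrite mulrBr.
Qed.

Let ray_sin a b : E (fun w => I1 a w * sin (S b w)) = 0.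
Proof.
apply: (@fourier_ray _ _ _ P U (fun w => sin (S b w)) 1).
- exact: measurable_funPT.
- exact: measurable_sin_fun.
- by move=> w; exact: normr_sin_le1.
- by move=> t; exact: cossin.
- by move=> t; exact: sinsin.
Qed.

(** [fourier_rays] works along initial segments of a sequence, so the family is extended by zero. *)
Let V (k : nat) : T -> R := if insub k is Some i then Y i else cst 0.

Let VE (i : 'I_r) : V i = Y i.
Proof. by rewrite /V valK. Qed.

Let mV k : measurable_fun setT (V k).
Proof.
rewrite /V; case: insubP => [i _ _|_]; last exact: measurable_cst.
exact: measurable_funPT.
Qed.

Let VY a : [set w | forall i : 'I_r, a i < Y i w] =
  random_vector Y @^-1` rays a.
Proof.
by apply/seteqP; split=> w H i; have := H i; rewrite tnth_mktuple.
Qed.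

Let mY a : measurable (random_vector Y @^-1` rays a).
Proof.
rewrite -[X in measurable X]setTI.
apply: measurable_random_vector => //; exact: measurable_rays.
Qed.

Let prod_indic (a : nat -> R) w : \prod_(i < r) \1_`]a i, +oo[ (V i w) =
  \1_(random_vector Y @^-1` rays (fun i => a i)) w :> R.
Proof.
rewrite -VY indicE; have [/set_mem H|H] := boolP (w \in _).
  rewrite big1// => i _; rewrite VE indicE mem_set//= in_itv/= andbT.
  exact: H.
have [i Hi] : exists i : 'I_r, ~~ (a i < Y i w).
  by apply/existsP; rewrite -negb_forall; apply: contra H => /forallP H; rewrite inE.
rewrite (bigD1 i)//= VE indicE memNset ?mul0r//=.
by rewrite in_itv/= andbT; exact/negP.
Qed.

(** The second application of Fourier uniqueness, now in the variables [Y], with [G] the centred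
    indicator of the ray of [U]. *)
Let indep_rays (a0 : R) (a : nat -> R) :
  P (U @^-1` `]a0, +oo[ `&` random_vector Y @^-1` rays (fun i => a i)) =
  (P (U @^-1` `]a0, +oo[) * P (random_vector Y @^-1` rays (fun i => a i)))%E.
Proof.
set A := U @^-1` _; set B := _ @^-1` _.
have mA : measurable A by rewrite -[A]setTI; exact: measurable_funPT.
have mB : measurable B by exact: mY.
have Eindic D : measurable D -> P D = (E (\1_D : T -> R))%:E.
  by move=> mD; rewrite /Rintegral integral_indic// setIT fineK ?fin_num_measure.
rewrite Eindic; last exact: measurableI.
rewrite (Eindic A)// (Eindic B)// -EFinM; congr EFin.
have IB : itg P (\1_B : T -> R).
  apply: (@itg_bounded _ _ _ _ _ 1); first exact: measurable_indic.
  by move=> w; rewrite indicE; case: (_ \in _); rewrite ?normr0 ?normr1.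
have -> : E (\1_(A `&` B) : T -> R) = E (fun w => I1 a0 w * \1_B w).
  apply: eq_Rintegral => w _; have -> : I1 a0 w = \1_A w by [].
  by rewrite !indicE in_setI -natrM mulnb.
have -> : E (\1_A : T -> R) = E (I1 a0) by [].
pose G w := I1 a0 w - E (I1 a0).
have mG : measurable_fun setT G by exact: measurable_funB.
have GM w : `|G w| <= 1 + `|E (I1 a0)|.
  by apply: le_trans (ler_normB _ _) _; rewrite lerD2r.
have H := (fun h1 h2 => @fourier_rays _ _ _ P V mV r G _ mG GM h1 h2 a).
have linE (b : nat -> R) w : \sum_(i < r) b i * V i w = S (fun i => b i) w.
  by apply: eq_bigr => i _; rewrite VE.
have II a' b : itg P (fun w => I1 a' w * cos (S b w)).
  by apply: (itgMb (mI1 a') (I1_le1 a')); exact: Icos.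
have II' a' b : itg P (fun w => I1 a' w * sin (S b w)).
  by apply: (itgMb (mI1 a') (I1_le1 a')); exact: Isin.
have {H} := H _ _; rewrite -/G => H.
have : E (fun w => (\prod_(i < r) \1_`]a i, +oo[ (V i w)) * G w) = 0.
  apply: H => b.
  - transitivity (E (fun w => I1 a0 w * cos (S (fun i => b i) w) - E (I1 a0) * cos (S (fun i => b i) w))).
      by apply: eq_Rintegral => w _; rewrite linE /G; ring.
    rewrite EB//; last exact/itgZl/Icos.
    by rewrite ray_cos EZl ?cosS ?subrr//; exact: Icos.
  - transitivity (E (fun w => I1 a0 w * sin (S (fun i => b i) w) - E (I1 a0) * sin (S (fun i => b i) w))).
      by apply: eq_Rintegral => w _; rewrite linE /G; ring.
    rewrite EB//; last exact/itgZl/Isin.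
    by rewrite ray_sin EZl ?sinS ?mulr0 ?subrr//; exact: Isin.
move=> K; apply/eqP; rewrite -subr_eq0 -EZl// -EB//; last 2 first.
- by apply: (itgMb (mI1 a0) (I1_le1 a0)).
- exact: itgZl.
apply/eqP; rewrite -[RHS]K; apply: eq_Rintegral => w _.
by rewrite prod_indic /G; ring.
Qed.

(** The second factor is the probability space itself, not the law of [Y], so that a fibre over [w]
    still carries a whole path when integrating by parts. *)
Definition split_joint (z : R * T) : r.+1.-tuple R := concat (z.1, random_vector Y z.2).

Lemma measurable_split_joint : measurable_fun setT split_joint.
Proof.
apply: (measurableT_comp (@measurable_concat R r)).
apply: measurable_fun_pair; first exact: measurable_fst.
by apply: measurableT_comp; [exact: measurable_random_vector|exact: measurable_snd].
Qed.

HB.instance Definition _ := isMeasurableFun.Build _ _ _ _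
  split_joint measurable_split_joint.

Lemma indep_law A : measurable A -> distribution P (joint U Y) A =
  pushforward (distribution P U \x P)%E split_joint A.
Proof.
apply: (@tuple_measure_unique _ _ (distribution P (joint U Y))
  (pushforward (distribution P U \x P)%E split_joint)).
  apply: (@le_lt_trans _ _ 1%E); last exact: ltry.
  exact: probability_le1.
move=> a; pose a' (k : nat) := if insub k is Some i then a i else 0 : R.
have a'E (i : 'I_r.+1) : a' i = a i by rewrite /a' valK.
have lE (x : R) (t : r.-tuple R) : rays a (concat (x, t)) <->
    a' 0 < x /\ rays (fun i => a' i.+1) t.
  split => [H|[H0 H1] i].
    split; first by have := H ord0; rewrite -a'E.
    by move=> i; have := H (lift ord0 i); rewrite -a'E tnthS.
  rewrite -a'E; case: (unliftP ord0 i) => [j ->|->]; last exact: H0.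
  by rewrite tnthS; exact: H1.
have := indep_rays (a' 0) (fun k => a' k.+1).
have jE : joint U Y @^-1` rays a = U @^-1` `]a' 0, +oo[ `&`
    random_vector Y @^-1` rays (fun i => a' i.+1).
  by apply/seteqP; split => w; rewrite /preimage/= lE in_itv/= andbT.
have sE : split_joint @^-1` rays a =
    `]a' 0, +oo[ `*` (random_vector Y @^-1` rays (fun i => a' i.+1)).
  by apply/seteqP; split => -[x w]; rewrite /preimage/= lE in_itv/= andbT.
move=> H; transitivity (P (joint U Y @^-1` rays a)); first by [].
transitivity ((distribution P U \x P)%E (split_joint @^-1` rays a)); last by [].
rewrite jE H sE product_measure1E//.
Qed.

Lemma indep_E (K : r.+1.-tuple R -> R) : measurable_fun setT K ->
  itg P (fun w => K (joint U Y w)) ->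
  itg (distribution P U \x P)%E (fun z => K (split_joint z)) /\
  E (fun w => K (joint U Y w)) =
    Rintegral (distribution P U \x P)%E setT (fun z => K (split_joint z)).
Proof.
move=> mK IK.
have mK' : measurable_fun setT (EFin \o K) by exact/measurable_EFinP.
have e1 (f : r.+1.-tuple R -> \bar R) :
    (\int[distribution P (joint U Y)]_t f t =
     \int[pushforward (distribution P U \x P)%E split_joint]_t f t)%E.
  by apply: eq_measure_integral => A mA _; exact: indep_law.
have IS : itg (distribution P U \x P)%E (fun z => K (split_joint z)).
  apply/integrableP; split.
    by apply/measurable_EFinP; apply: measurableT_comp => //; exact: measurable_split_joint.
  have mn : measurable_fun setT (fun t => `|(K t)%:E|)%E by exact: measurableT_comp.
  rewrite -(@ge0_integral_pushforward _ _ _ _ _ split_joint _ _ setT _ measurableT mn)//.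
  rewrite -e1 ge0_integral_distribution//.
  by case/integrableP : IK.
split=> //; rewrite /Rintegral; congr fine.
rewrite -(@integral_distribution _ _ _ _ _ _ (joint U Y) (EFin \o K))//.
rewrite e1 integral_pushforward//; exact: measurable_split_joint.
Qed.

End independence.

(** * Gaussian integration by parts *)

Section inner_product.
Context (R : realType) (H : completeNormedModType R) (ip : inner_product H).
Implicit Types x y z : H.

Lemma innerDl x y z : ip (x + y) z = ip x z + ip y z.
Proof. by have := inner_linear ip 1 x y z; rewrite scale1r mul1r. Qed.

Lemma inner0l z : ip 0 z = 0.
Proof. by have := innerDl 0 0 z; rewrite addr0 => /eqP; rewrite -subr_eq subrr => /eqP. Qed.

Lemma innerZl a x z : ip (a *: x) z = a * ip x z.
Proof. by have := inner_linear ip a x 0 z; rewrite addr0 inner0l addr0. Qed.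

Lemma innerNl x z : ip (- x) z = - ip x z.
Proof. by rewrite -scaleN1r innerZl mulN1r. Qed.

Lemma innerBl x y z : ip (x - y) z = ip x z - ip y z.
Proof. by rewrite innerDl innerNl. Qed.

Lemma inner_suml (I : Type) (s : seq I) (F : I -> H) z :
  ip (\sum_(i <- s) F i) z = \sum_(i <- s) ip (F i) z.
Proof.
elim: s => [|i s ih]; first by rewrite !big_nil inner0l.
by rewrite !big_cons innerDl ih.
Qed.

Lemma innerDr x y z : ip z (x + y) = ip z x + ip z y.
Proof. by rewrite !(innerC _ z) innerDl. Qed.

Lemma innerZr a x z : ip z (a *: x) = a * ip z x.
Proof. by rewrite !(innerC _ z) innerZl. Qed.

Lemma innerBr x y z : ip z (x - y) = ip z x - ip z y.
Proof. by rewrite !(innerC _ z) innerBl. Qed.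

Lemma inner0r z : ip z 0 = 0.
Proof. by rewrite innerC inner0l. Qed.

Lemma inner_sumr (I : Type) (s : seq I) (F : I -> H) z :
  ip z (\sum_(i <- s) F i) = \sum_(i <- s) ip z (F i).
Proof.
by rewrite innerC inner_suml; apply: eq_bigr => i _; rewrite innerC.
Qed.

Lemma inner_ge0 x : 0 <= ip x x.
Proof. by rewrite inner_norm sqr_ge0. Qed.

Lemma normr_inner x y : `|ip x y| <= `|x| * `|y|.
Proof.
have [->|y0] := eqVneq y 0; first by rewrite inner0r !normr0 mulr0.
have yp : 0 < `|y| by rewrite normr_gt0.
have := inner_ge0 (`|y| ^+ 2 *: x - ip x y *: y).
rewrite innerBl !innerBr !innerZl !innerZr (innerC _ y x) !inner_norm.
set c := ip x y => h.
have : c ^+ 2 <= `|x| ^+ 2 * `|y| ^+ 2.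
  have y2 : 0 < `|y| ^+ 2 by rewrite exprn_gt0.
  by rewrite -(ler_pM2l y2) -subr_ge0; move: h; congr (_ <= _); ring.
move=> c2; rewrite -(ler_pXn2r (ltn0Sn 1)) ?nnegrE ?mulr_ge0//.
by rewrite exprMn real_normK ?num_real.
Qed.

End inner_product.

Definition rv d d' (T : measurableType d) (T' : measurableType d') (R : realType)
  (P : probability T R) (f : T -> T') (mf : measurable_fun setT f) : {RV P >-> T'} :=
  let m := isMeasurableFun.Build _ _ _ _ f mf in HB.pack f m.

Lemma law_transfer d d' (T : measurableType d) (T' : measurableType d') (R : realType)
    (P : probability T R) (nu : {measure set T' -> \bar R}) (X : T -> T') (f : T' -> R) :
  measurable_fun setT X -> (forall A, measurable A -> P (X @^-1` A) = nu A) ->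
  measurable_fun setT f ->
  (itg P (fun w => f (X w)) <-> itg nu f) /\
  (itg nu f -> Rintegral P setT (fun w => f (X w)) = Rintegral nu setT f).
Proof.
move=> mX XP mf; pose Y := rv P mX.
have e (g : T' -> \bar R) : (\int[distribution P Y]_x g x = \int[nu]_x g x)%E.
  by apply: eq_measure_integral => A mA _; exact: XP.
have mf' : measurable_fun setT (EFin \o f) by exact/measurable_EFinP.
have mfX : measurable_fun setT (fun w => f (X w)) by exact: (measurableT_comp mf mX).
have n : (\int[P]_w `|(f (X w))%:E| = \int[nu]_x `|(f x)%:E|)%E.
  rewrite -e -(@ge0_integral_distribution _ _ _ _ _ P Y (fun x => `|(f x)%:E|%E))//.
  exact: measurableT_comp.
have I : itg P (fun w => f (X w)) <-> itg nu f.
  split=> /integrableP[_ foo]; apply/integrableP; split.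
  - by [].
  - by rewrite -n.
  - exact/measurable_EFinP.
  - by rewrite n.
split=> // /I If.
rewrite /Rintegral -e (@integral_distribution _ _ _ _ _ P Y (EFin \o f))//.
Qed.

Section gaussian.
Context (R : realType) (H : completeNormedModType R) (ip : inner_product H).
Context d (T : measurableType d) (P : probability T R) (W : H -> {RV P >-> R}).
Hypothesis isoW : isonormal ip W.
Local Notation E f := (Rintegral P setT f).

Lemma W_meas h : measurable_fun setT (W h).
Proof. exact: measurable_funPT. Qed.

Lemma gauss_law r (h : 'I_r -> H) (b : 'I_r -> R) : exists s : R,
  forall f : R -> R, measurable_fun setT f ->
  (s != 0 -> itg (normal_prob 0 s) f) ->
  itg P (fun w => f (\sum_(i < r) b i * W (h i) w)) /\
  E (fun w => f (\sum_(i < r) b i * W (h i) w)) =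
    if s == 0 then f 0 else Rintegral (normal_prob 0 s) setT f.
Proof.
have [s sP] := isoW.1 r h b; exists s => f mf If.
have mS : measurable_fun setT (fun w => \sum_(i < r) b i * W (h i) w).
  by apply: measurable_sum => i; exact: measurable_funM.
have [s0|s0] := eqVneq s 0.
  have [|I ->] := @law_transfer _ _ _ _ _ P (dirac (0 : R)) _ f mS _ mf.
  - by move=> A mA; rewrite sP// /centered_gauss s0 eqxx.
  - have : itg (dirac (0 : R)) f.
      apply/integrableP; split; first exact/measurable_EFinP.
      rewrite integral_dirac ?diracT ?mul1e ?ltry//.
      by apply: measurableT_comp => //; exact/measurable_EFinP.
    move=> D; split; first exact/I.
    rewrite /Rintegral integral_dirac ?diracT ?mul1e//.
    exact/measurable_EFinP.
  - apply/integrableP; split; first exact/measurable_EFinP.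
    rewrite integral_dirac ?diracT ?mul1e ?ltry//.
    by apply: measurableT_comp => //; exact/measurable_EFinP.
have [|I Ie] := @law_transfer _ _ _ (measurableTypeR R) _ P (normal_prob 0 s) _ f mS _ mf.
  by move=> A mA; rewrite sP// /centered_gauss (negbTE s0).
by split; [exact/I/If|exact/Ie/If].
Qed.

Lemma gauss_poly_itg (f : R -> R) (K : R) (k : nat) h : measurable_fun setT f ->
  (forall x, `|f x| <= K * `|x| ^+ k) -> itg P (fun w => f (W h w)).
Proof.
move=> mf fK; have [s sP] := @gauss_law 1 (fun=> h) (fun=> 1).
have [|I _] := sP f mf.
  move=> s0; apply: (@normal_itg_poly _ 0 _ s0 _ K k) => // x; rewrite subr0; exact: fK.
by apply: itg_ext I => w; rewrite big_ord1 mul1r.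
Qed.

Lemma W_pow_itg h k : itg P (fun w => W h w ^+ k).
Proof.
apply: (@gauss_poly_itg (fun x => x ^+ k) 1 k); first exact: measurable_funX.
by move=> x; rewrite mul1r normrX.
Qed.

Lemma W_L2 h : L2 P (W h).
Proof. by split; [exact: W_meas|exact: W_pow_itg]. Qed.

Lemma W_pow_L2 h k : L2 P (fun w => W h w ^+ k).
Proof.
split; first by apply: measurable_funX; exact: W_meas.
by apply: itg_ext (W_pow_itg h (k * 2)) => w; rewrite exprM.
Qed.

Lemma W_cov g h : E (fun w => W g w * W h w) = ip g h.
Proof.
have := isoW.2 g h; rewrite unlock => e.
by rewrite /Rintegral e.
Qed.

Lemma W_comb_var r (h : 'I_r -> H) (b : 'I_r -> R) :
  E (fun w => (\sum_(i < r) b i * W (h i) w) ^+ 2) = `|\sum_(i < r) b i *: h i| ^+ 2.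
Proof.
transitivity (E (fun w => \sum_(i < r) \sum_(j < r) b i * b j * (W (h i) w * W (h j) w))).
  apply: eq_Rintegral => w _; rewrite expr2 mulr_suml; apply: eq_bigr => i _.
  by rewrite mulr_sumr; apply: eq_bigr => j _; ring.
have I i j : itg P (fun w => b i * b j * (W (h i) w * W (h j) w)).
  by apply: itgZl; apply: L2M; exact: W_L2.
rewrite E_sum; last by move=> i; exact: itg_sum.
rewrite -(inner_norm ip) inner_suml; apply: eq_bigr => i _.
rewrite E_sum// inner_sumr; apply: eq_bigr => j _.
rewrite EZl ?W_cov; first by rewrite innerZl innerZr mulrA.
by apply: L2M; exact: W_L2.
Qed.

Lemma gauss_trig r (h : 'I_r -> H) (b : 'I_r -> R) :
  E (fun w => cos (\sum_(i < r) b i * W (h i) w)) =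
    expR (- (`|\sum_(i < r) b i *: h i| ^+ 2 / 2)) /\
  E (fun w => sin (\sum_(i < r) b i * W (h i) w)) = 0.
Proof.
rewrite -W_comb_var; have [s sP] := gauss_law h b.
have sqrE : E (fun w => (\sum_(i < r) b i * W (h i) w) ^+ 2) = s ^+ 2.
  have [||_ ->] := sP (fun x => x ^+ 2); first exact: measurable_funX.
    move=> s0; apply: itg_ext (normal_variance 0 s0).1 => x; by rewrite subr0.
  have [->|s0] := eqVneq s 0; first by [].
  rewrite -(normal_variance 0 s0).2; apply: eq_Rintegral => x _.
  by rewrite subr0.
have Ic : itg (normal_prob 0 s) (@cos R).
  apply: (@itg_bounded _ _ _ _ _ 1); last exact: normr_cos_le1.
  by apply: continuous_measurable; exact: continuous_cos.
have Is : itg (normal_prob 0 s) (@sin R).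
  apply: (@itg_bounded _ _ _ _ _ 1); last exact: normr_sin_le1.
  by apply: continuous_measurable; exact: continuous_sin.
rewrite sqrE; split.
  have [_ ->] := sP (@cos R) (continuous_measurable (@continuous_cos R)) (fun=> Ic).
  have [->|s0] := eqVneq s 0; first by rewrite cos0 expr0n/= mul0r oppr0 expR0.
  rewrite -[s ^+ 2]mul1r -[X in X * s ^+ 2](expr1n _ 2) -(normal_cos 0 s0 1).
  by apply: eq_Rintegral => x _; rewrite subr0 mul1r.
have [_ ->] := sP (@sin R) (continuous_measurable (@continuous_sin R)) (fun=> Is).
have [_|s0] := eqVneq s 0; first by rewrite sin0.
rewrite -[RHS](normal_sin 0 s0 1).
by apply: eq_Rintegral => x _; rewrite subr0 mul1r.
Qed.

(** The normal density depends on its deviation only through the square, and the covariance identity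
    determines that square. *)
Lemma W_law h : h != 0 -> forall A, measurable A ->
  P (W h @^-1` A) = normal_prob 0 `|h| A.
Proof.
move=> h0 A mA.
have [s sP] := isoW.1 1%N (fun=> h) (fun=> 1).
have lawA B : measurable B -> P (W h @^-1` B) = centered_gauss s B.
  move=> mB; rewrite -sP//.
  suff -> : (fun w => \sum_(i < 1) 1 * W h w) = W h by [].
  by apply/funext => w; rewrite big_ord1 mul1r.
have s2 : s ^+ 2 = `|h| ^+ 2.
  rewrite -(inner_norm ip) -W_cov.
  have m2 : measurable_fun setT (fun x : R => x ^+ 2) by exact: measurable_funX.
  have [s0|s0] := eqVneq s 0.
    have [|I e] := @law_transfer _ _ _ _ _ P (dirac (0 : R)) _ _ (W_meas h) _ m2.
      by move=> B mB; rewrite lawA// /centered_gauss s0 eqxx.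
    transitivity (E (fun w => W h w ^+ 2)); last by [].
    rewrite e; last exact/I/W_pow_itg.
    by rewrite /Rintegral integral_dirac ?diracT ?mul1e ?s0//; exact/measurable_EFinP.
  have [|I e] := @law_transfer _ _ _ (measurableTypeR R) _ P (normal_prob 0 s) _ _ (W_meas h) _ m2.
    by move=> B mB; rewrite lawA// /centered_gauss (negbTE s0).
  transitivity (E (fun w => W h w ^+ 2)); last by [].
  rewrite e; last exact/I/W_pow_itg.
  rewrite -(normal_variance 0 s0).2; apply: eq_Rintegral => x _.
  by rewrite subr0.
have hn : 0 < `|h| by rewrite normr_gt0.
have s0 : s != 0.
  by apply/eqP => s0; move: s2; rewrite s0 expr0n/= => /esym/eqP; rewrite expf_eq0/= gt_eqF.
rewrite lawA// /centered_gauss (negbTE s0).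
rewrite /normal_prob; apply: eq_integral => x _.
by rewrite /normal_pdf (negbTE s0) gt_eqF// /normal_peak /normal_fun s2.
Qed.

(* [distribution P (W h)] and [normal_prob 0 `|h|] are measures on two
   non-convertible copies of the measurable space R. *)
Lemma W_dist h (f : R -> R) : h != 0 -> measurable_fun setT f ->
  itg (distribution P (W h)) f ->
  itg (normal_prob 0 `|h|) f /\
  Rintegral (distribution P (W h)) setT f = Rintegral (normal_prob 0 `|h|) setT f.
Proof.
move=> h0 mf If.
have [I e] := @law_transfer _ _ _ _ _ P (distribution P (W h)) _ f (W_meas h) (fun _ _ => erefl) mf.
have [I' e'] := @law_transfer _ _ _ (measurableTypeR R) _ P (normal_prob 0 `|h|) _ f (W_meas h) (W_law h0) mf.
have If' := I.2 If.
by rewrite -e// -e'; [split => //; exact/I'|exact/I'].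
Qed.

End gaussian.

Section cylinder.
Context (R : realType) (H : completeNormedModType R) (ip : inner_product H).
Implicit Types (Phi Psi : (H -> R) -> R) (om : H -> R) (h : H).

(* Functionals of W are functions on the space H -> R of all paths. *)
Definition cyl Phi := exists (r : nat) (g : 'I_r -> H) (F : r.-tuple R -> R),
  measurable_fun setT F /\ forall om, Phi om = F [tuple om (g i) | i < r].

(** The Cameron-Martin shift in the direction [h]: the coordinate [om g] has derivative [ip h g]
    along it, in accordance with [D (W g) = g]. *)
Definition shiftp om h (t : R) : H -> R := fun g => om g + t * ip h g.

Lemma shiftp0 om h : shiftp om h 0 = om.
Proof. by apply/funext => g; rewrite /shiftp mul0r addr0. Qed.

Lemma shiftpD om h s t : shiftp (shiftp om h s) h t = shiftp om h (s + t).
Proof. by apply/funext => g; rewrite /shiftp mulrDl addrA. Qed.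

Lemma measurable_mktuple d (T : measurableType d) r (f : 'I_r -> T -> R) :
  (forall i, measurable_fun setT (f i)) ->
  measurable_fun setT (fun x => [tuple f i x | i < r]).
Proof.
move=> mf; apply/measurable_fun_tnthP => i.
by rewrite (_ : _ \o _ = f i)//; apply/funext => x /=; rewrite tnth_mktuple.
Qed.

Lemma cyl_common Phi Psi : cyl Phi -> cyl Psi ->
  exists (r : nat) (g : 'I_r -> H) (F1 F2 : r.-tuple R -> R),
  [/\ measurable_fun setT F1, measurable_fun setT F2,
    forall om, Phi om = F1 [tuple om (g i) | i < r] &
    forall om, Psi om = F2 [tuple om (g i) | i < r]].
Proof.
move=> [r1 [g1 [F1 [mF1 E1]]]] [r2 [g2 [F2 [mF2 E2]]]].
exists (r1 + r2)%N, (fun i : 'I_(r1 + r2) => match fintype.split i with inl j => g1 j | inr j => g2 j end).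
exists (fun t => F1 [tuple tnth t (lshift r2 i) | i < r1]).
exists (fun t => F2 [tuple tnth t (rshift r1 i) | i < r2]).
split.
- by apply: measurableT_comp => //; apply: measurable_mktuple => i; exact: measurable_tnth.
- by apply: measurableT_comp => //; apply: measurable_mktuple => i; exact: measurable_tnth.
- move=> om; rewrite E1; congr F1; apply: eq_from_tnth => i.
  by rewrite !tnth_mktuple (unsplitK (inl _ i)).
- move=> om; rewrite E2; congr F2; apply: eq_from_tnth => i.
  by rewrite !tnth_mktuple (unsplitK (inr _ i)).
Qed.

Lemma cyl_comp2 (f : R * R -> R) Phi Psi : measurable_fun setT f ->
  cyl Phi -> cyl Psi -> cyl (fun om => f (Phi om, Psi om)).
Proof.
move=> mf cPhi cPsi; have [r [g [F1 [F2 [m1 m2 e1 e2]]]]] := cyl_common cPhi cPsi.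
exists r, g, (fun t => f (F1 t, F2 t)); split; last by move=> om; rewrite e1 e2.
by apply: (measurableT_comp mf); exact: measurable_fun_pair.
Qed.

Lemma cylD Phi Psi : cyl Phi -> cyl Psi -> cyl (fun om => Phi om + Psi om).
Proof.
apply: (@cyl_comp2 (fun z => z.1 + z.2)).
by apply: measurable_funD; [exact: measurable_fst|exact: measurable_snd].
Qed.

Lemma cylM Phi Psi : cyl Phi -> cyl Psi -> cyl (fun om => Phi om * Psi om).
Proof.
apply: (@cyl_comp2 (fun z => z.1 * z.2)).
by apply: measurable_funM; [exact: measurable_fst|exact: measurable_snd].
Qed.

Lemma cyl_cst k : cyl (fun=> k).
Proof. by exists 0%N, (fun=> 0), (fun=> k); split=> //; exact: measurable_cst. Qed.

Lemma cyl_coord h : cyl (fun om => om h).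
Proof.
exists 1%N, (fun=> h), (fun t => tnth t ord0); split; first exact: measurable_tnth.
by move=> om; rewrite tnth_mktuple.
Qed.

Lemma cyl_sum (I : Type) (s : seq I) (F : I -> (H -> R) -> R) :
  (forall i, cyl (F i)) -> cyl (fun om => \sum_(i <- s) F i om).
Proof.
move=> cF; elim: s => [|i s ih].
  by under eq_fun do rewrite big_nil; exact: cyl_cst.
by under eq_fun do rewrite big_cons; exact: cylD.
Qed.

(** [C] collects the coordinates behind the [G i] for more and more indices; the induction appends
    those of one further functional at a time. *)
Lemma cyl_comp r (F : r.-tuple R -> R) (G : 'I_r -> (H -> R) -> R) :
  measurable_fun setT F -> (forall i, cyl (G i)) ->
  cyl (fun om => F [tuple G i om | i < r]).
Proof.
move=> mF cG; pose C (I : 'I_r -> Prop) := exists (q : nat) (g : 'I_q -> H)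
  (K : 'I_r -> q.-tuple R -> R), (forall i, measurable_fun setT (K i)) /\
  forall i, I i -> forall om, G i om = K i [tuple om (g j) | j < q].
suff [q [g [K [mK KE]]]] : C (fun=> True).
  exists q, g, (fun t => F [tuple K i t | i < r]); split.
    by apply: (measurableT_comp mF); exact: measurable_mktuple.
  by move=> om; congr F; apply: eq_from_tnth => i; rewrite !tnth_mktuple KE.
suff /(_ r) : forall k, C (fun i => (i < k)%N).
  by move=> [q [g [K [mK KE]]]]; exists q, g, K; split=> // i _; exact: KE.
elim=> [|k [q [g [K [mK KE]]]]].
  by exists 0%N, (fun=> 0), (fun _ _ => 0); split=> // i; exact: measurable_cst.
have [rk|kr] := leqP r k.
  exists q, g, K; split=> // i _; apply: KE.
  exact: leq_trans (ltn_ord i) rk.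
have [r1 [g1 [F1 [mF1 E1]]]] := cG (Ordinal kr).
exists (r1 + q)%N, (fun i : 'I_(r1 + q) => match fintype.split i with inl j => g1 j | inr j => g j end).
exists (fun i t => if i == Ordinal kr then F1 [tuple tnth t (lshift q j) | j < r1]
   else K i [tuple tnth t (rshift r1 j) | j < q]); split.
  move=> i; case: (i == Ordinal kr); apply: measurableT_comp => //;
    by apply: measurable_mktuple => j; exact: measurable_tnth.
move=> i; rewrite ltnS leq_eqVlt => ik om; case: ifPn => [/eqP ->|ik'].
  rewrite E1; congr F1; apply: eq_from_tnth => j.
  by rewrite !tnth_mktuple (unsplitK (inl _ j)).
rewrite KE; last first.
  by case/predU1P : ik => // ik; case/negP: ik'; apply/eqP/val_inj.
congr (K i _); apply: eq_from_tnth => j.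
by rewrite !tnth_mktuple (unsplitK (inr _ j)).
Qed.

End cylinder.

Section ibp.
Context (R : realType) (H : completeNormedModType R) (ip : inner_product H).
Context d (T : measurableType d) (P : probability T R) (W : H -> {RV P >-> R}).
Hypothesis isoW : isonormal ip W.
Local Notation E f := (Rintegral P setT f).

Definition gpath (w : T) : H -> R := fun g => W g w.

Lemma cyl_measurable Phi : cyl Phi -> measurable_fun setT (fun w => Phi (gpath w)).
Proof.
move=> [r [g [F [mF FE]]]]; under eq_fun do rewrite FE.
apply: (measurableT_comp mF); apply: measurable_mktuple => i.
exact: measurable_funPT.
Qed.

Lemma der_unshift (f : R -> R) c l : der (fun t => f (c + t)) 0 l -> der f c l.
Proof.
move=> fl; have := @der_shift _ (fun t => f (c + t)) c (- c) l.
rewrite addNr => /(_ fl); apply: der_ext => t.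
by rewrite addrA subrr add0r.
Qed.

Lemma der_shiftp (Phi Psi : (H -> R) -> R) h :
  (forall om, der (fun t => Phi (shiftp ip om h t)) 0 (Psi om)) ->
  forall om t, der (fun t => Phi (shiftp ip om h t)) t (Psi (shiftp ip om h t)).
Proof.
move=> dPhi om t; apply: der_unshift.
by apply: der_ext (dPhi (shiftp ip om h t)) => s; rewrite shiftpD.
Qed.

Section ibp_nonzero.
Variables (h : H) (r : nat) (g : 'I_r -> H).
Hypothesis h0 : h != 0.

Let c i := ip h (g i) / `|h| ^+ 2.

Let hn : 0 < `|h|. Proof. by rewrite normr_gt0. Qed.

Let hhn : ip h h = `|h| ^+ 2. Proof. exact: inner_norm. Qed.

Let mV i : measurable_fun setT (fun w => W (g i) w - c i * W h w).
Proof. by apply: measurable_funB => //; exact: measurable_funM. Qed.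

(* The V i are the parts of the W (g i) independent of W h. *)
Let V i : {RV P >-> R} := rv P (mV i).

(** Pythagoras: the vectors [g i - c i *: h] are orthogonal to [h]. The splitting of the squared
    norm is what factorizes the joint characteristic function. *)
Let comb_normE t (b : 'I_r -> R) :
  `|(t - \sum_(i < r) b i * c i) *: h + \sum_(i < r) b i *: g i| ^+ 2 =
  t ^+ 2 * `|h| ^+ 2 + `|\sum_(i < r) b i *: (g i - c i *: h)| ^+ 2.
Proof.
set v := \sum_(i < r) b i *: (g i - c i *: h).
have -> : (t - \sum_(i < r) b i * c i) *: h + \sum_(i < r) b i *: g i = t *: h + v.
  rewrite scalerBl -addrA; congr (_ + _).
  rewrite scaler_suml -sumrN addrC -big_split/=; apply: eq_bigr => i _.
  by rewrite scalerBr scalerA.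
have hv : ip h v = 0.
  rewrite inner_sumr big1// => i _.
  rewrite innerZr innerBr innerZr hhn /c divfK ?subrr ?mulr0//.
  by rewrite expf_neq0// gt_eqF.
rewrite -!(inner_norm ip) innerDl !innerDr !innerZl !innerZr (innerC _ v) hv.
by rewrite !mulr0 addr0 add0r; ring.
Qed.

Let comb_trig t (b : 'I_r -> R) :
  E (fun w => cos (t * W h w + \sum_(i < r) b i * V i w)) =
    expR (- (t ^+ 2 * `|h| ^+ 2 / 2)) *
    expR (- (`|\sum_(i < r) b i *: (g i - c i *: h)| ^+ 2 / 2)) /\
  E (fun w => sin (t * W h w + \sum_(i < r) b i * V i w)) = 0.
Proof.
pose k (i : 'I_r.+1) := if unlift ord0 i is Some j then g j else h.
pose e (i : 'I_r.+1) := if unlift ord0 i is Some j then b j else t - \sum_(i < r) b i * c i.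
have k0 : k ord0 = h by rewrite /k unlift_none.
have kS i : k (lift ord0 i) = g i by rewrite /k liftK.
have e0 : e ord0 = t - \sum_(i < r) b i * c i by rewrite /e unlift_none.
have eS i : e (lift ord0 i) = b i by rewrite /e liftK.
have := gauss_trig isoW k e.
have -> : \sum_(i < r.+1) e i *: k i =
    (t - \sum_(i < r) b i * c i) *: h + \sum_(i < r) b i *: g i.
  by rewrite big_ord_recl k0 e0; congr (_ + _); apply: eq_bigr => i _; rewrite kS eS.
rewrite comb_normE.
have eE w : \sum_(i < r.+1) e i * W (k i) w = t * W h w + \sum_(i < r) b i * V i w.
  rewrite big_ord_recl k0 e0 mulrBl -addrA; congr (_ + _).
  rewrite mulr_suml -sumrN addrC -big_split/=; apply: eq_bigr => i _.
  rewrite kS eS; ring.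
under eq_Rintegral do rewrite eE.
under [X in _ /\ X = _ -> _]eq_Rintegral do rewrite eE.
by rewrite -expRD -opprD -mulrDl.
Qed.

(** By independence, [W h] can be integrated out with the orthogonal part of the path frozen. Along
    such a fibre [Phi] is a function of one normal variable of variance [|h| ^+ 2], to which
    [normal_ibp] applies. *)
Lemma ibp_nonzero (F1 F2 : r.-tuple R -> R) :
  measurable_fun setT F1 -> measurable_fun setT F2 ->
  let Phi om := F1 [tuple om (g i) | i < r] in
  let Psi om := F2 [tuple om (g i) | i < r] in
  (forall om, der (fun t => Phi (shiftp ip om h t)) 0 (Psi om)) ->
  (forall om, continuous (fun t => Psi (shiftp ip om h t))) ->
  L2 P (fun w => Phi (gpath w)) -> itg P (fun w => Psi (gpath w)) ->
  E (fun w => W h w * Phi (gpath w)) = E (fun w => Psi (gpath w)).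
Proof.
move=> mF1 mF2 Phi Psi dPhi cPsi L2Phi IPsi.
(* Recovers the vector of the [W (g i)] from [W h] and the residuals. *)
pose sh (t : r.+1.-tuple R) : r.-tuple R :=
  [tuple tnth t (lift ord0 i) + c i * thead t | i < r].
have msh : measurable_fun setT sh.
  apply: measurable_mktuple => i; apply: measurable_funD; first exact: measurable_tnth.
  by apply: measurable_funM => //; exact: measurable_tnth.
have jE w : sh (joint (W h) V w) = [tuple gpath w (g i) | i < r].
  apply: eq_from_tnth => i; rewrite !tnth_mktuple tnthS theadE tnth_mktuple.
  by rewrite /V/= /gpath subrK.
have thjE w : thead (joint (W h) V w) = W h w by rewrite theadE.
(* The path with its component along [h] removed; the value [x] of [W h] corresponds to the shift
   parameter [x / |h| ^+ 2]. *)
pose om w : H -> R := fun k => W k w - ip h k / `|h| ^+ 2 * W h w.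
have sE z : sh (split_joint V z) = [tuple shiftp ip (om z.2) h (z.1 / `|h| ^+ 2) (g i) | i < r].
  apply: eq_from_tnth => i; rewrite !tnth_mktuple tnthS theadE tnth_mktuple.
  by rewrite /V/= /shiftp /om /c; ring.
have thsE z : thead (split_joint V z) = z.1 by rewrite theadE.
pose e (t : R) := expR (- (t ^+ 2 * `|h| ^+ 2 / 2)).
pose v (b : 'I_r -> R) := expR (- (`|\sum_(i < r) b i *: (g i - c i *: h)| ^+ 2 / 2)).
have indep := @indep_E _ _ _ P r (W h) V e v _ _ (fun t b => (comb_trig t b).1) (fun t b => (comb_trig t b).2).
have e0 : e 0 = 1 by rewrite /e expr0n/= !mul0r oppr0 expR0.
have v0 : v (fun=> 0) = 1.
  by rewrite /v big1 ?normr0 ?expr0n/= ?mul0r ?oppr0 ?expR0// => i _; rewrite scale0r.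
have {}indep := indep e0 v0.
have mth : measurable_fun setT (@thead r R) by exact: measurable_tnth.
have m1 : measurable_fun setT (fun t => F1 (sh t)) by exact: measurableT_comp.
have m2 : measurable_fun setT (fun t => F2 (sh t)) by exact: measurableT_comp.
have m3 : measurable_fun setT (fun t : r.+1.-tuple R => thead t * F1 (sh t)) by exact: measurable_funM.
have [I1 _] := indep _ m1 (itg_ext (fun w => esym (congr1 F1 (jE w))) (L2_itg L2Phi)).
have [I2 E2] := indep _ m2 (itg_ext (fun w => esym (congr1 F2 (jE w))) IPsi).
have [|I3 E3] := indep _ m3.
  by apply: itg_ext (L2M (W_L2 isoW h) L2Phi) => w; rewrite thjE jE.
transitivity (E (fun w => thead (joint (W h) V w) * F1 (sh (joint (W h) V w)))).
  by apply: eq_Rintegral => w _; rewrite thjE jE.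
transitivity (E (fun w => F2 (sh (joint (W h) V w)))); last first.
  by apply: eq_Rintegral => w _; rewrite jE.
rewrite E3 E2 {E3 E2} /Rintegral -(integral21_prod_meas1 I3) -(integral21_prod_meas1 I2).
congr fine.
(* Integrability on the fibres is available only for almost every [w]. *)
have A1 := ae_integrable2 I1; have A2 := ae_integrable2 I2; have A3 := ae_integrable2 I3.
apply: ae_eq_integral => //.
- exact: (measurable_fubini_G I3).
- exact: (measurable_fubini_G I2).
apply: filterS3 A1 A2 A3 => w A1 A2 A3 _; rewrite /fubini_G.
set q : R := `|h| ^+ 2; have q0 : 0 < q by rewrite exprn_gt0.
(* The factor [q^-1] created by the inner derivative cancels the variance in [normal_ibp]. *)
pose f (x : R) := Phi (shiftp ip (om w) h (q^-1 * x)).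
pose f' (x : R) := q^-1 * Psi (shiftp ip (om w) h (q^-1 * x)).
have f1E x : F1 (sh (split_joint V (x, w))) = f x by rewrite sE mulrC.
have f2E x : F2 (sh (split_joint V (x, w))) = q * f' x.
  by rewrite sE /f' mulVKf ?gt_eqF// mulrC.
have df x : der f x (f' x).
  apply: der_eq (@der_comp _ _ (fun x => q^-1 * x) x _ _
    (der_shiftp dPhi (om w) (q^-1 * x)) (derZ _ (der_id x))) _.
  by rewrite mulr1 mulrC.
have cf' : continuous f'.
  move=> x; apply: cvgMr.
  apply: (@continuous_comp _ _ _ (fun x : R => q^-1 * x)
    (fun t => Psi (shiftp ip (om w) h t))); last exact: cPsi.
  by apply: cvgMr; exact: cvg_id.
have mf : measurable_fun setT f by apply: continuous_measurable => x; exact: der_continuous (df x).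
have mf' : measurable_fun setT f' by exact: continuous_measurable.
have J1 : itg (distribution P (W h)) f by apply: itg_ext A1 => x; rewrite f1E.
have J2 : itg (distribution P (W h)) (fun x => q * f' x).
  by apply: itg_ext A2 => x; rewrite f2E.
have J3 : itg (distribution P (W h)) (fun x => x * f x).
  by apply: itg_ext A3 => x; rewrite thsE f1E.
have [N1 _] := W_dist isoW h0 mf J1.
have [N2 e2] := W_dist isoW h0 (measurable_funM (@measurable_cst _ _ _ _ setT q) mf') J2.
have [N3 e3] := W_dist isoW h0 (measurable_funM (@measurable_id _ _ setT) mf) J3.
transitivity (\int[distribution P (W h)]_x (x * f x)%:E)%E.
  by apply: eq_integral => x _ /=; rewrite thsE f1E.
transitivity (\int[distribution P (W h)]_x (q * f' x)%:E)%E; last first.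
  by apply: eq_integral => x _ /=; rewrite f2E.
rewrite (E_EFin J3) (E_EFin J2); congr EFin; rewrite [LHS]e3 [RHS]e2.
have hn0 : `|h| != 0 by rewrite normr_eq0.
have N2' : itg (normal_prob 0 `|h|) f'.
  by apply: itg_ext (itgZl q^-1 N2) => x; rewrite mulKf ?gt_eqF.
rewrite EZl// -(@normal_ibp _ 0 _ hn0 f)//.
  by apply: eq_Rintegral => x _; rewrite subr0.
by apply: itg_ext N3 => x; rewrite subr0.
Qed.

End ibp_nonzero.

Lemma gaussian_ibp (Phi Psi : (H -> R) -> R) h : cyl Phi -> cyl Psi ->
  (forall om, der (fun t => Phi (shiftp ip om h t)) 0 (Psi om)) ->
  (forall om, continuous (fun t => Psi (shiftp ip om h t))) ->
  L2 P (fun w => Phi (gpath w)) -> itg P (fun w => Psi (gpath w)) ->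
  E (fun w => W h w * Phi (gpath w)) = E (fun w => Psi (gpath w)).
Proof.
move=> cPhi cPsi dPhi cP L2P IP.
have [h0|h0] := eqVneq h 0.
  have -> : E (fun w => Psi (gpath w)) = 0.
    rewrite -[RHS](@E0 _ _ _ P); apply: eq_Rintegral => w _.
    have := dPhi (gpath w); rewrite h0 /shiftp.
    under eq_fun do under eq_fun do rewrite inner0l mulr0 addr0.
    by move=> [_ <-]; case: (der_cst (Phi (gpath w)) 0).
  (* [W 0] vanishes only almost surely: its variance is zero, and Cauchy-Schwarz concludes. *)
  apply/eqP; rewrite -normr_eq0 -sqrf_eq0 eq_le sqr_ge0 andbT.
  have := cauchy_schwarz (W_L2 isoW h) L2P.
  rewrite [X in _ <= X * _ -> _](W_cov isoW) h0 inner0l mul0r; apply: le_trans.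
  rewrite lerXn2r// ?nnegrE//; first exact: E_ge0.
  by apply: le_normE; apply: L2M => //; exact: (W_L2 isoW).
have [r [g [F1 [F2 [m1 m2 e1 e2]]]]] := cyl_common cPhi cPsi.
have eP : Phi = (fun om => F1 [tuple om (g i) | i < r]) by apply/funext.
have eQ : Psi = (fun om => F2 [tuple om (g i) | i < r]) by apply/funext.
rewrite eP eQ; apply: ibp_nonzero => //.
- by move=> om; have := dPhi om; rewrite eP eQ.
- by move=> om; have := cP om; rewrite eQ.
- by rewrite eP in L2P.
- by rewrite eQ in IP.
Qed.

End ibp.

(** * Coordinatewise Lipschitz functions *)

Section coordinatewise.
Context (R : realType) (m : nat).
Implicit Types (f g : 'rV[R]_m -> R) (x v : 'rV[R]_m) (L : R).

(** Increments along the axes suffice for an l^1 Lipschitz bound, and averaging over axis-parallel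
    segments preserves them with the same constant. *)
Definition lipc L f := forall x i t, `|f (x + t *: delta_mx 0 i) - f x| <= L * `|t|.

(** A partial derivative with uniform quadratic error, a form that averaging and composition
    preserve with explicit constants. *)
Definition qder i f g := exists K : R, forall x t,
  `|f (x + t *: delta_mx 0 i) - f x - t * g x| <= K * t ^+ 2.

Lemma lipc_total L f x v : lipc L f -> `|f (x + v) - f x| <= L * \sum_i `|v 0 i|.
Proof.
move=> fL; rewrite {1}(row_sum_delta v).
elim: (index_enum _) x => [|i s ih] x.
  by rewrite !big_nil addr0 subrr normr0 mulr0.
rewrite !big_cons addrA.
rewrite -(subrK (f (x + v 0 i *: delta_mx 0 i)) (f (_ + _))) -addrA mulrDr addrC.
by apply: le_trans (ler_normD _ _) (lerD (fL _ _ _) (ih _)).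
Qed.

Lemma lipc_ge0 L f (i : 'I_m) : lipc L f -> 0 <= L.
Proof. by move=> /(_ 0 i 1); rewrite normr1 mulr1; exact: le_trans. Qed.

(** The increment is travelled one coordinate at a time; the Lipschitz bounds on the [g j] pay for
    evaluating them at [x] instead of at the intermediate corners. *)
Lemma qder_total f (g : 'I_m -> 'rV[R]_m -> R) : (forall i, qder i f (g i)) ->
  (forall i, exists L, lipc L (g i)) ->
  exists K : R, forall x v,
  `|f (x + v) - f x - \sum_i v 0 i * g i x| <= K * (\sum_i `|v 0 i|) ^+ 2.
Proof.
move=> /choice[K KP] /choice[L LP].
pose C := \sum_i (`|K i| + `|L i|).
have Ki i : `|K i| + `|L i| <= C.
  by rewrite /C (bigD1 i)//= lerDl sumr_ge0// => j _; rewrite addr_ge0.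
have C0 : 0 <= C by rewrite sumr_ge0// => j _; rewrite addr_ge0.
clearbody C; exists C => x v.
rewrite {1}(row_sum_delta v).
elim: (index_enum _) x => [|i s ih] x.
  by rewrite !big_nil addr0 subrr subr0 normr0 expr0n mulr0.
rewrite !big_cons addrA.
set y := x + v 0 i *: delta_mx 0 i; set S := \sum_(j <- s) `|v 0 j|.
have S0 : 0 <= S by apply: sumr_ge0.
have h1 := KP i x (v 0 i); have h2 := ih y.
have h3 : `|\sum_(j <- s) v 0 j * (g j y - g j x)| <= C * (S * `|v 0 i|).
  apply: le_trans (ler_norm_sum _ _ _) _; rewrite /S mulr_suml mulr_sumr.
  apply: ler_sum => j _; rewrite normrM [leRHS]mulrCA ler_wpM2l//.
  apply: le_trans (LP j _ _ _) _; rewrite ler_wpM2r//.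
  by apply: le_trans (Ki j); rewrite (le_trans (ler_norm _))// lerDr.
have -> : f (y + \sum_(j <- s) v 0 j *: delta_mx 0 j) - f x -
    (v 0 i * g i x + \sum_(j <- s) v 0 j * g j x) =
  (f (y + \sum_(j <- s) v 0 j *: delta_mx 0 j) - f y - \sum_(j <- s) v 0 j * g j y) +
  (f y - f x - v 0 i * g i x) + \sum_(j <- s) v 0 j * (g j y - g j x).
  under [in X in _ = _ + X]eq_bigr do rewrite mulrBr.
  by rewrite sumrB; ring.
apply: le_trans (ler_normD _ _) _; apply: le_trans (lerD (ler_normD _ _) h3) _.
have h1' : `|f y - f x - v 0 i * g i x| <= C * `|v 0 i| ^+ 2.
  apply: le_trans h1 _; rewrite real_normK ?num_real// ler_wpM2r ?sqr_ge0//.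
  by apply: le_trans (Ki i); rewrite (le_trans (ler_norm _))// lerDl.
apply: le_trans (lerD (lerD h2 h1') (lexx _)) _.
rewrite -!mulrDr ler_wpM2l// sqrrD -/S.
have : 0 <= S * `|v 0 i| by rewrite mulr_ge0.
rewrite (mulrC S); lra.
Qed.

Lemma row_entry_le_norm x i : `|x 0 i| <= `|x|.
Proof.
rewrite [`|x|]mx_normrE.
by apply: (@le_bigmax _ _ _ 0 (fun i => `|x i.1 i.2|) (0, i)).
Qed.

Lemma lipc_continuous L f : lipc L f -> continuous f.
Proof.
move=> fL x; apply/(@cvgrPdist_le _ _ _ (nbhs x)) => /= e e0.
have L0 : 0 <= `|L| * m%:R by rewrite mulr_ge0.
near=> y; rewrite distrC -[y](subrKC x).
apply: le_trans (lipc_total _ _ fL) _.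
apply: (@le_trans _ _ (`|L| * m%:R * `|y - x|)).
  rewrite -mulrA; apply: (@le_trans _ _ (`|L| * \sum_i `|(y - x) 0 i|)).
    by rewrite ler_wpM2r ?ler_norm// sumr_ge0.
  rewrite ler_wpM2l// mulr_natl -[X in _ *+ X]card_ord -sumr_const.
  by apply: ler_sum => i _; exact: row_entry_le_norm.
apply: (@le_trans _ _ ((`|L| * m%:R + 1) * (e / (`|L| * m%:R + 1)))); last first.
  by rewrite mulrC divfK// gt_eqF// ltr_wpDl.
apply: ler_pM => //; first by rewrite lerDl.
rewrite distrC; near: y; apply: cvgr_dist_le; first exact: cvg_id.
by rewrite divr_gt0// ltr_wpDl.
Unshelve. all: by end_near. Qed.

Lemma measurable_floor_set (k : R) (z : int) : measurable [set x : R | Num.floor (k * x) = z].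
Proof.
have -> : [set x : R | Num.floor (k * x) = z] = (fun y : R => k * y) @^-1` `[z%:~R, (z + 1)%:~R[.
  apply/seteqP; split => x /=; rewrite in_itv/=.
    by move=> <-; exact: floor_itv.
  by move=> h; exact/floor_def.
rewrite -[X in measurable X]setTI; have : measurable_fun setT (fun y : R => k * y).
  exact: measurable_funM.
by apply.
Qed.

(** Rounding the coordinates down to a grid of mesh [k.+1%:R^-1] gives functions with countably many
    values, which converge by the Lipschitz bound. The argument uses the sigma-algebra on tuples and
    none on row vectors. *)
Lemma measurable_lipc L f : lipc L f ->
  measurable_fun setT (fun t : m.-tuple R => f (\row_i tnth t i)).
Proof.
move=> fL.
pose disc (k : nat) (t : m.-tuple R) : 'rV[R]_m :=
  \row_i ((Num.floor (k.+1%:R * tnth t i))%:~R / k.+1%:R).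
apply: (@measurable_fun_cvg _ _ _ _ (fun k t => f (disc k t))).
  move=> k; have mz (z : {ffun 'I_m -> int}) :
      measurable [set t : m.-tuple R | forall i, Num.floor (k.+1%:R * tnth t i) = z i].
    have -> : [set t : m.-tuple R | forall i, Num.floor (k.+1%:R * tnth t i) = z i] =
       \big[setI/setT]_(i < m) ((fun t => tnth t i) @^-1` [set x : R | Num.floor (k.+1%:R * x) = z i]).
      apply/seteqP; split=> t.
        by move=> h; rewrite -bigcap_seq => i _; exact: h.
      by rewrite -bigcap_seq => h i; apply: h; rewrite /= mem_index_enum.
    apply: bigsetI_measurable => i _; rewrite -[X in measurable X]setTI.
    by apply: measurable_tnth => //; exact: measurable_floor_set.
  move=> _ Y mY; rewrite setTI.
  have -> : (fun t => f (disc k t)) @^-1` Y = \bigcup_(z in [set: {ffun 'I_m -> int}])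
      ([set t : m.-tuple R | forall i, Num.floor (k.+1%:R * tnth t i) = z i] `&`
       [set t | Y (f (\row_i ((z i)%:~R / k.+1%:R)))]).
    apply/seteqP; split=> t.
      move=> h; exists [ffun i => Num.floor (k.+1%:R * tnth t i)] => //.
      split=> /= [i|]; first by rewrite ffunE.
      by under eq_mx do rewrite ffunE.
    move=> [z _ [h1 h2]]; rewrite /preimage/= /disc.
    by under eq_mx do rewrite h1.
  apply: countable_bigcupT_measurable; first exact: countableP.
  move=> z; apply: measurableI; first exact: mz.
  have [Yz|Yz] := pselect (Y (f (\row_i ((z i)%:~R / k.+1%:R)))).
    by rewrite (_ : [set _ | _] = setT)//; apply/seteqP; split.
  by rewrite (_ : [set _ | _] = set0)//; apply/seteqP; split.
move=> t _; apply: (@le_dist_cvg _ _ (fun k => L * (m%:R * k.+1%:R^-1))); last first.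
  rewrite -[X in _ --> X](mulr0 L); apply: cvgMr.
  rewrite -[X in _ --> X](mulr0 m%:R); apply: cvgMr; exact: cvg_harmonic.
move=> k; rewrite distrC -(subrKC (disc k t) (\row_i _)).
apply: le_trans (lipc_total _ _ fL) _.
(* In dimension zero nothing forces [L] to be nonnegative, but every sum is empty. *)
case: (posnP m) => [m0|m0].
  rewrite !big1 ?mulr0 ?m0 ?mul0r ?mulr0// => -[i im]; by exfalso; rewrite m0 in im.
apply: ler_wpM2l; first exact: (lipc_ge0 (Ordinal m0) fL).
rewrite mulr_natl -[X in _ *+ X]card_ord -sumr_const; apply: ler_sum => i _.
rewrite !mxE; set x := tnth t i; have k0 : (0 : R) < k.+1%:R by [].
have /andP[h1 h2] := floor_itv (k.+1%:R * x).
rewrite ger0_norm.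
  by rewrite lerBlDr -[X in X + _]mul1r -mulrDl ler_pdivlMr// mulrC addrC ltW// -[1]/(1%:~R) -intrD.
by rewrite subr_ge0 ler_pdivrMr// [leRHS]mulrC; exact: h1.
Qed.

Lemma der_line f x v t l : is_derive (x + t *: v) v f l ->
  der (fun s => f (x + s *: v)) t l.
Proof.
have e : (fun h : R => h^-1 *: (((fun s => f (x + s *: v)) \o shift t) (h *: 1) - f (x + t *: v))) =
    (fun h : R => h^-1 *: ((f \o shift (x + t *: v)) (h *: v) - f (x + t *: v))).
  apply/funext => h /=; congr (_ *: (f _ - _)).
  by rewrite [h%:A]mulr1 scalerDl addrCA.
move=> [d <-]; split; first by rewrite /derivable e.
by rewrite /derive e.
Qed.

Section smooth_compact.
Variable f : 'rV[R]_m -> R.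
Hypotheses (sf : smooth f) (cf : compactly_supported f).

Lemma smooth_partial i : smooth (partial i f).
Proof. by move=> s; have := sf (rcons s i); rewrite foldr_rcons. Qed.

Lemma near0 x : ~ closure [set y | f y != 0] x -> \forall y \near x, f y = 0.
Proof.
move=> nx; have : nbhs x (~` closure [set y | f y != 0]).
  by apply: open_nbhs_nbhs; split=> //; apply: closed_openC; exact: closed_closure.
apply: filterS => y ny; apply/eqP; apply: contra_notT ny => fy.
exact: subset_closure.
Qed.

Lemma partial_near0 i x : (\forall y \near x, f y = 0) -> partial i f x = 0.
Proof.
move=> nf; rewrite /partial /derive; apply/cvg_lim => //.
apply: cvg_near_cst; near=> h.
rewrite [f x](nbhs_singleton nf) subr0 /= (_ : f _ = 0) ?scaler0//.
near: h.
suff : (fun h : R => h *: delta_mx 0 i + x : 'rV[R]_m) @ 0^' --> x by move=> /(_ _ nf).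
have -> : x = 0 *: delta_mx 0 i + x :> 'rV[R]_m by rewrite scale0r add0r.
rewrite {1}scale0r add0r.
apply: cvgD; last exact: cvg_cst.
apply: cvg_trans (@scalel_continuous _ _ (delta_mx 0 i : 'rV[R]_m) 0).
by apply: cvg_app; exact: cvg_within.
Unshelve. all: by end_near. Qed.

Lemma compactly_supported_partial i : compactly_supported (partial i f).
Proof.
apply: subclosed_compact cf _; first exact: closed_closure.
rewrite closureE; apply: smallest_sub; first exact: closed_closure.
move=> x /= fx; apply: contrapT => /near0 /(partial_near0 i) f0.
by rewrite f0 eqxx in fx.
Qed.

Lemma partial_bounded i : exists M, forall x, `|partial i f x| <= M.
Proof.
have [_ /(_ i) c] := sf [::].
have : bounded_set (partial i f @` closure [set y | f y != 0]).
  apply: compact_bounded; apply: continuous_compact => //.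
  exact: continuous_subspaceT.
move=> [M [_ MP]]; exists (`|M| + 1) => x.
have [fx|nx] := pselect (closure [set y | f y != 0] x).
  apply: (MP (`|M| + 1)); first by rewrite ltr_pwDr// ler_norm.
  by exists x.
rewrite (_ : partial i f x = 0) ?normr0 ?addr_ge0//.
have nf : \forall y \near x, f y = 0 by exact: near0.
by have := partial_near0 i nf.
Qed.

Lemma smooth_line i x t : der (fun s => f (x + s *: delta_mx 0 i)) t
  (partial i f (x + t *: delta_mx 0 i)).
Proof.
have [/(_ i (x + t *: delta_mx 0 i)) d _] := sf [::].
by apply: der_line; exact: derivableP.
Qed.

Lemma smooth_lipc : exists L, lipc L f.
Proof.
have /choice[M MP] := partial_bounded; exists (\sum_i `|M i|) => x i t.
have := der_lip 0 t (smooth_line i x) (fun z => MP i _).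
rewrite scale0r addr0 subr0 => /le_trans; apply; rewrite ler_wpM2r//.
rewrite (bigD1 i)//= (le_trans (ler_norm _))// lerDl sumr_ge0//.
Qed.

End smooth_compact.


Lemma smooth_qder f i : smooth f -> compactly_supported f -> qder i f (partial i f).
Proof.
move=> sf cf.
have [L LP] := smooth_lipc (smooth_partial sf i) (compactly_supported_partial cf (i:=i)).
exists L => x t.
have := @der_taylor _ _ _ L 0 t (smooth_line sf i x).
rewrite scale0r addr0 add0r; apply => y z.
by rewrite -(subrK z y) (addrC _ z) scalerDl addrA (addrC z) addrK; exact: LP.
Qed.

Lemma smooth_bounded f : smooth f -> compactly_supported f ->
  exists M, forall x, `|f x| <= M.
Proof.
move=> sf cf; have [L LP] := smooth_lipc sf cf.
have : bounded_set (f @` closure [set y | f y != 0]).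
  apply: compact_bounded; apply: continuous_compact => //.
  by apply: continuous_subspaceT; exact: lipc_continuous LP.
move=> [M [_ MP]]; exists (`|M| + 1) => x.
have [->|fx] := eqVneq (f x) 0; first by rewrite normr0 addr_ge0.
apply: (MP (`|M| + 1)); first by rewrite ltr_pwDr// ler_norm.
by exists x => //; exact: subset_closure.
Qed.

End coordinatewise.

(** * Limits in L^2 *)

Section l2_limits.
Context d (T : measurableType d) (R : realType) (P : probability T R).
Local Notation E f := (Rintegral P setT f).

(** Norms are extended reals, so convergence to zero makes them finite only from some index on. *)
Lemma Lnorm2_cvg (u : nat -> T -> R) : (forall n, measurable_fun setT (u n)) ->
  Lnorm P 2%:E (fun w => (u n w)%:E) @[n --> \oo] --> 0%E ->
  (\forall n \near \oo, L2 P (u n)) /\ E (fun w => u n w ^+ 2) @[n --> \oo] --> 0.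
Proof.
move=> mu0 /fine_cvgP[uf u0].
have uE n : Lnorm P 2%:E (fun w => (u n w)%:E) \is a fin_num ->
    (\int[P]_w (u n w ^+ 2)%:E = (fine (Lnorm P 2%:E (fun w => (u n w)%:E)) ^+ 2)%:E)%E.
  move=> fu; have := @poweR_Lnorm _ _ _ P (fun w => (u n w)%:E) 2.
  rewrite pnatr_eq0 => /(_ isT).
  rewrite -(fineK fu) poweR_EFin powR_mulrn ?fine_ge0 ?Lnorm_ge0// => ->.
  by apply: eq_integral => w _; rewrite abse_EFin poweR_EFin powR_mulrn// real_normK ?num_real.
split.
  apply: filterS uf => n fu; split=> //; apply: itg_ge0 => [|w|]; last by rewrite uE ?ltry.
    exact: measurable_funX.
  by rewrite sqr_ge0.
rewrite -[X in _ --> X](mulr0 (0 : R)); apply: cvg_trans (cvgM u0 u0).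
apply: near_eq_cvg; apply: filterS uf => n fu.
by rewrite /Rintegral uE//= expr2.
Qed.

Lemma Lp_cvg2 (F : nat -> T -> R) (G : T -> R) : (forall n, L2 P (F n)) ->
  measurable_fun setT G -> Lp_cvg P 2 F G ->
  L2 P G /\ E (fun w => (F n w - G w) ^+ 2) @[n --> \oo] --> 0.
Proof.
move=> LF mG FG; have mFG n : measurable_fun setT (fun w => F n w - G w).
  by apply: measurable_funB => //; exact: (LF n).1.
have [[n _ /(_ n (leqnn n)) h] h'] := Lnorm2_cvg mFG FG; split=> //.
have -> : G = fun w => F n w - (F n w - G w) by apply/funext => w; rewrite subKr.
exact: L2B.
Qed.

(** [G] is merely integrable. Cutting it at height [K] bounds the expectation by [K] times the L^1
    norm of [u n] plus [M] times the tail of [G]; first [K] is chosen, then [n]. *)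
Lemma bounded_L1_cvg (u : nat -> T -> R) (G : T -> R) M :
  (forall n, measurable_fun setT (u n)) -> (forall n w, `|u n w| <= M) ->
  E (fun w => `|u n w|) @[n --> \oo] --> 0 -> itg P G ->
  E (fun w => u n w * G w) @[n --> \oo] --> 0.
Proof.
move=> mu uM u0 IG; have mG := itg_meas IG.
have M0 : 0 <= M.
  (* A space of total mass one is inhabited. *)
  have [w _] : exists w : T, True.
    apply: contrapT => no; have : P setT = 0%E.
      by rewrite (_ : setT = set0) ?measure0//; apply/seteqP; split=> // x; case: no; exists x.
    by rewrite probability_setT => /eqP; rewrite onee_eq0.
  exact: le_trans (uM 0%N w).
pose G_ (K : nat) w := if `|G w| <= K%:R then 0 else `|G w|.
have mG_ K : measurable_fun setT (G_ K).
  apply: measurable_fun_ifT => //; last exact: measurableT_comp.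
  by apply: measurable_fun_ler => //; exact: measurableT_comp.
have G_0 : E (G_ K) @[K --> \oo] --> 0.
  rewrite -[X in _ --> X](@E0 _ _ _ P).
  apply: (proj2 (@E_dominated _ _ _ P G_ (fun=> 0) (fun w => `|G w|) mG_ (itg_norm IG) _ _)).
  - move=> w; apply: cvg_near_cst; near=> K; rewrite /G_ ifT//.
    by near: K; exact: nbhs_infty_ger.
  - by move=> K w; rewrite /G_; case: ifP; rewrite ?normr0 ?normr_id.
have IG_ K : itg P (G_ K).
  apply: (le_itg _ (itg_norm IG)) => // w.
  by rewrite /G_; case: ifP; rewrite ?normr0 ?normr_id.
have Iu n : itg P (fun w => `|u n w|) by apply: itg_norm; exact: itg_bounded (uM n).
have bnd n K : `|E (fun w => u n w * G w)| <= K%:R * E (fun w => `|u n w|) + M * E (G_ K).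
  rewrite -!EZl// -ED; [|exact: itgZl..].
  apply: le_normE_le.
  - exact: itgMb (uM n) IG.
  - by apply: itgD; exact: itgZl.
  - move=> w; rewrite normrM /G_; case: ifPn => [h|h].
      by rewrite mulr0 addr0 mulrC ler_wpM2r.
    by rewrite -[leLHS]add0r lerD ?mulr_ge0// ler_wpM2r.
apply/cvgrPdist_le => e e0.
have [K KP] : exists K : nat, M * E (G_ K) <= e / 2.
  have : \forall K \near \oo, M * E (G_ K) <= e / 2.
    have : M * E (G_ K) @[K --> \oo] --> 0.
      by rewrite -[X in _ --> X](mulr0 M); exact: cvgMr.
    move=> /cvgrPdist_le/(_ (e / 2)); rewrite divr_gt0// => /(_ isT); apply: filterS => K.
    by rewrite sub0r normrN; apply: le_trans; exact: ler_norm.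
  by move=> [K _ /(_ K (leqnn K))]; exists K.
have : K%:R * E (fun w => `|u n w|) @[n --> \oo] --> 0.
  by rewrite -[X in _ --> X](mulr0 (K%:R : R)); exact: cvgMr.
move=> /cvgrPdist_le/(_ (e / 2)); rewrite divr_gt0// => /(_ isT).
apply: filterS => n; rewrite !sub0r !normrN => h.
apply: le_trans (bnd n K) _; rewrite [leRHS]splitr lerD//.
exact: le_trans (ler_norm _) h.
Unshelve. all: by end_near. Qed.

End l2_limits.

Section hilbert_valued.
Context (R : realType) (H : completeNormedModType R) (ip : inner_product H).
Context d (T : measurableType d) (P : probability T R).
Hypothesis sepH : separable H.
Local Notation E f := (Rintegral P setT f).
Implicit Types D G : T -> H.

Definition hmeas D := forall A : set H, open A -> measurable (D @^-1` A).

Lemma hmeas_comp (f : H -> R) D : continuous f -> hmeas D ->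
  measurable_fun setT (fun w => f (D w)).
Proof.
move=> cf mD; apply: (measurability _ (RGenOpens.measurableE R)).
move=> _ [_ [a [b ->]] <-]; rewrite setTI.
have -> : (fun w => f (D w)) @^-1` `]a, b[ = D @^-1` (f @^-1` `]a, b[) by [].
apply: mD; apply: open_comp => [x _|]; first exact: cf.
exact: itv_open.
Qed.

Lemma inner_continuous k : continuous (ip k).
Proof.
move=> x; apply/cvgrPdist_le => e e0; near=> y.
rewrite -innerBr; apply: le_trans (normr_inner _ _ _) _.
apply: (@le_trans _ _ ((`|k| + 1) * (e / (`|k| + 1)))); last first.
  by rewrite mulrC divfK// gt_eqF// ltr_wpDl.
apply: ler_pM => //; first by rewrite lerDl.
near: y; apply: cvgr_dist_le; first exact: cvg_id.
by rewrite divr_gt0// ltr_wpDl.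
Unshelve. all: by end_near. Qed.

Lemma hmeas_inner k D : hmeas D -> measurable_fun setT (fun w => ip k (D w)).
Proof. by apply: hmeas_comp; exact: inner_continuous. Qed.

Lemma hmeas_norm D : hmeas D -> measurable_fun setT (fun w => `|D w|).
Proof. by apply: (hmeas_comp (f := fun x => `|x|)); exact: norm_continuous. Qed.

(** Separability enters here: the preimage of an open set under addition is a countable union of
    products of balls with centres in a dense countable set. *)
Lemma hmeasD D G : hmeas D -> hmeas G -> hmeas (fun w => D w + G w).
Proof.
move=> mD mG A oA; have [S cS dS] := sepH.
pose I := [set z : (H * H) * nat | S z.1.1 /\ S z.1.2 /\
  forall x y, ball z.1.1 (z.2.+1%:R^-1 : R) x -> ball z.1.2 (z.2.+1%:R^-1 : R) y -> A (x + y)].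
have cI : countable I.
  apply: (@sub_countable _ _ _ ((S `*` S) `*` setT)).
    by apply: subset_card_le => z [h1 [h2 _]].
  by apply: countableX; [exact: countableX|exact: countableP].
have -> : (fun w => D w + G w) @^-1` A = \bigcup_(z in I)
   ((D @^-1` ball z.1.1 (z.2.+1%:R^-1 : R)) `&` (G @^-1` ball z.1.2 (z.2.+1%:R^-1 : R))).
  apply/seteqP; split=> w.
    move=> Aw; have : nbhs (D w + G w) A by apply: open_nbhs_nbhs; split.
    move=> /nbhs_ballP[e /= e0 eA].
    (* Four distances are added below, each less than [n.+1%:R^-1]. *)
    have [n ne] : exists n : nat, n.+1%:R^-1 < e / 4.
      have := @near_infty_natSinv_lt R (PosNum (divr_gt0 e0 (ltr0n R 4))).
      by move=> [n _ /(_ n (leqnn n))]; exists n.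
    have n0 : 0 < n.+1%:R^-1 :> R by rewrite invr_gt0.
    have near x : exists2 s, S s & ball x (n.+1%:R^-1 : R) s.
      have [||s [hs Ss]] := dS (ball x (n.+1%:R^-1)); last by exists s.
        by exists x; exact: ballxx.
      exact: ball_open.
    have [s1 S1 b1] := near (D w); have [s2 S2 b2] := near (G w).
    exists (s1, s2, n); last by split; exact: ball_sym.
    split=> //; split=> //= x y b3 b4; apply: eA.
    move: b1 b2 b3 b4; rewrite -!ball_normE /ball_/= => b1 b2 b3 b4.
    have -> : D w + G w - (x + y) = (D w - s1) + (s1 - x) + ((G w - s2) + (s2 - y)).
      by rewrite !addrA !subrK opprD addrA [D w + G w - x]addrAC.
    apply: le_lt_trans (ler_normD _ _) _.
    have := ler_normD (D w - s1) (s1 - x); have := ler_normD (G w - s2) (s2 - y).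
    move: (n.+1%:R^-1 : R) ne b1 b2 b3 b4 => q; lra.
  by move=> [z [_ [_ zA]] [b1 b2]]; exact: zA.
rewrite bigcup_set_type; apply: countable_bigcupT_measurable.
  by rewrite (eq_countable (card_setT I)).
move=> z; apply: measurableI; [exact: mD (ball_open _ _)|exact: mG (ball_open _ _)].
Qed.

Lemma hmeasZ (c : T -> R) k : measurable_fun setT c -> hmeas (fun w => c w *: k).
Proof.
move=> mc A oA; rewrite -[X in measurable X]setTI.
apply: (mc measurableT [set x : R | A (x *: k)]); apply: open_measurable.
rewrite (_ : [set x : R | A (x *: k)] = (fun x : R => x *: k) @^-1` A)//.
by apply: open_comp => // x _; exact: scalel_continuous.
Qed.

Lemma hmeas_scale a D : hmeas D -> hmeas (fun w => a *: D w).
Proof.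
move=> mD A oA; apply: (mD ((fun x => a *: x) @^-1` A)).
by apply: open_comp => // x _; exact: scaler_continuous.
Qed.

Lemma hmeasB D G : hmeas D -> hmeas G -> hmeas (fun w => D w - G w).
Proof.
move=> mD /(hmeas_scale (-1)) mG.
have -> : (fun w => D w - G w) = fun w => D w + -1 *: G w.
  by apply/funext => w; rewrite scaleN1r.
exact: hmeasD.
Qed.

Lemma hmeas_sum (I : Type) (s : seq I) (F : I -> T -> H) :
  (forall i, hmeas (F i)) -> hmeas (fun w => \sum_(i <- s) F i w).
Proof.
move=> mF; elim: s => [|i s ih].
  under eq_fun do rewrite big_nil -(scale0r 0).
  exact: (@hmeasZ (fun=> 0)).
by under eq_fun do rewrite big_cons; exact: hmeasD.
Qed.

(** Polarization reduces the inner product to norms, which are continuous. *)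
Lemma measurable_inner D G : hmeas D -> hmeas G -> measurable_fun setT (fun w => ip (D w) (G w)).
Proof.
move=> mD mG; have -> : (fun w => ip (D w) (G w)) =
    fun w => (`|D w + G w| ^+ 2 - `|D w| ^+ 2 - `|G w| ^+ 2) * 2^-1.
  apply/funext => w; rewrite -!(inner_norm ip) innerDl !innerDr (innerC _ (G w)).
  by field.
apply: measurable_funM => //; apply: measurable_funB; last by apply: measurable_funX; exact: hmeas_norm.
by apply: measurable_funB; apply: measurable_funX; apply: hmeas_norm => //; exact: hmeasD.
Qed.

Definition hL2 D := hmeas D /\ L2 P (fun w => `|D w|).

Lemma hL2_inner D G : hL2 D -> hL2 G -> itg P (fun w => ip (D w) (G w)).
Proof.
move=> [mD D2] [mG G2]; apply: (le_itg _ (L2M D2 G2)) => [|w].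
  exact: measurable_inner.
exact: normr_inner.
Qed.

Lemma hL2_inner_L2 k D : hL2 D -> L2 P (fun w => ip k (D w)).
Proof.
move=> [mD D2]; split; first exact: hmeas_inner.
apply: (le_itg _ (itgZl (`|k| ^+ 2) D2.2)) => [|w].
  by apply: measurable_funX; exact: hmeas_inner.
by rewrite normrX -exprMn lerXn2r ?nnegrE//; exact: normr_inner.
Qed.

Lemma hL2B D G : hL2 D -> hL2 G -> hL2 (fun w => D w - G w).
Proof.
move=> [mD D2] [mG G2]; split; first exact: hmeasB.
have m := hmeas_norm (hmeasB mD mG); split=> //.
apply: (le_itg _ (L2D D2 G2).2) => [|w]; first exact: measurable_funX.
by rewrite normrX lerXn2r ?nnegrE// normr_id ler_normB.
Qed.

Lemma E_inner_le D G : hL2 D -> hL2 G -> E (fun w => `|ip (D w) (G w)|) <=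
  Num.sqrt (E (fun w => `|D w| ^+ 2)) * Num.sqrt (E (fun w => `|G w| ^+ 2)).
Proof.
move=> [mD D2] [mG G2]; apply: le_trans (cauchy_schwarz_sqrt D2 G2).
apply: le_E => [||w]; first by apply: itg_norm; exact: hL2_inner.
  by apply: itg_norm; exact: L2M.
by rewrite normrM !normr_id normr_inner.
Qed.

Lemma LpH_cvg2 (F : nat -> T -> H) D : (forall n, hL2 (F n)) -> hmeas D ->
  LpH_cvg P 2 F D -> hL2 D /\ E (fun w => `|F n w - D w| ^+ 2) @[n --> \oo] --> 0.
Proof.
move=> F2 mD FD; have mFD n : measurable_fun setT (fun w => `|F n w - D w|).
  by apply: hmeas_norm; apply: hmeasB => //; exact: (F2 n).1.
have [[n _ /(_ n (leqnn n)) h] h'] := Lnorm2_cvg mFD FD; split=> //.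
have -> : D = fun w => F n w - (F n w - D w) by apply/funext => w; rewrite subKr.
by apply: hL2B => //; split=> //; apply: hmeasB => //; exact: (F2 n).1.
Qed.

End hilbert_valued.

(** * Divergence and chaos *)

Section nice_functionals.
Context (R : realType) (H : completeNormedModType R) (ip : inner_product H).
Implicit Types (Phi Psi : (H -> R) -> R) (om : H -> R) (h : H).

(** The regularity that [gaussian_ibp] asks of a pair, without any growth bound, so that Hermite
    polynomials of a coordinate qualify. *)
Definition sdir h Phi Psi := [/\ cyl Phi, cyl Psi,
  forall om, der (fun t => Phi (shiftp ip om h t)) 0 (Psi om) &
  forall om, continuous (fun t => Psi (shiftp ip om h t))].

Lemma sdir_continuous h Phi Psi om : sdir h Phi Psi ->
  continuous (fun t => Phi (shiftp ip om h t)).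
Proof.
by move=> [_ _ d _] t; apply: der_continuous; exact: (der_shiftp d).
Qed.

Lemma sdir_cst h k : sdir h (fun=> k) (fun=> 0).
Proof.
split; [exact: cyl_cst|exact: cyl_cst|by move=> om; exact: der_cst|].
by move=> om t; exact: cvg_cst.
Qed.

Lemma sdir_coord h g : sdir h (fun om => om g) (fun=> ip h g).
Proof.
split; [exact: cyl_coord|exact: cyl_cst| |by move=> om t; exact: cvg_cst].
move=> om; apply: der_eq (derD (der_cst _ 0) (derM (der_id 0) (der_cst (ip h g) 0))) _.
by rewrite mul1r mulr0 addr0 add0r.
Qed.

Lemma sdirD h Phi1 Psi1 Phi2 Psi2 : sdir h Phi1 Psi1 -> sdir h Phi2 Psi2 ->
  sdir h (fun om => Phi1 om + Phi2 om) (fun om => Psi1 om + Psi2 om).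
Proof.
move=> [c1 c1' d1 k1] [c2 c2' d2 k2]; split; [exact: cylD|exact: cylD| |].
  by move=> om; exact: derD.
by move=> om t; apply: cvgD; [exact: k1|exact: k2].
Qed.

Lemma sdirM h Phi1 Psi1 Phi2 Psi2 : sdir h Phi1 Psi1 -> sdir h Phi2 Psi2 ->
  sdir h (fun om => Phi1 om * Phi2 om) (fun om => Psi1 om * Phi2 om + Phi1 om * Psi2 om).
Proof.
move=> s1 s2; have k1' om := sdir_continuous (om := om) s1; have k2' om := sdir_continuous (om := om) s2.
case: s1 s2 => [c1 c1' d1 k1] [c2 c2' d2 k2]; split.
- exact: cylM.
- by apply: cylD; exact: cylM.
- by move=> om; have := derM (d1 om) (d2 om); rewrite !shiftp0.
- move=> om t; apply: cvgD; apply: cvgM.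
  + exact: k1. + exact: k2'. + exact: k1'. + exact: k2.
Qed.

Lemma sdirZ h a Phi Psi : sdir h Phi Psi -> sdir h (fun om => a * Phi om) (fun om => a * Psi om).
Proof.
move=> s; have := sdirM (sdir_cst h a) s.
by under [X in sdir _ _ X]eq_fun do rewrite mul0r add0r.
Qed.

(* Functionals with estimates uniform in om; unlike sdir, this class is stable
   under composition with a function of class C^{1,1}. *)
Definition nice0 h Phi Psi := [/\ cyl Phi, cyl Psi,
  exists M, forall om t, `|Phi (shiftp ip om h t) - Phi om| <= M * `|t|,
  exists M, forall om, `|Psi om| <= M &
  (exists K, forall om t, `|Phi (shiftp ip om h t) - Phi om - t * Psi om| <= K * t ^+ 2) /\
  exists M, forall om t, `|Psi (shiftp ip om h t) - Psi om| <= M * `|t| ].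

Definition bounded Phi := exists M : R, forall om, `|Phi om| <= M.

Definition nice h Phi Psi := nice0 h Phi Psi /\ bounded Phi.

Lemma nice_cyl h Phi Psi : nice h Phi Psi -> cyl Phi.
Proof. by case; case. Qed.

Lemma nice_sdir h Phi Psi : nice h Phi Psi -> sdir h Phi Psi.
Proof.
move=> [[c1 c2 _ _ [[K KP] [M MP]]] _]; split=> // om.
  by apply: (@der_quad _ _ _ _ K) => t; rewrite add0r shiftp0.
move=> t; apply/cvgrPdist_le => e e0; near=> s.
have -> : shiftp ip om h s = shiftp ip (shiftp ip om h t) h (s - t) by rewrite shiftpD subrKC.
rewrite distrC; apply: le_trans (MP _ _) _.
apply: (@le_trans _ _ ((`|M| + 1) * (e / (`|M| + 1)))); last first.
  by rewrite mulrC divfK// gt_eqF// ltr_wpDl.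
apply: (@le_trans _ _ ((`|M| + 1) * `|s - t|)).
  by rewrite ler_wpM2r// (le_trans (ler_norm _))// lerDl.
rewrite ler_wpM2l ?addr_ge0// distrC.
near: s; apply: cvgr_dist_le; first exact: cvg_id.
by rewrite divr_gt0// ltr_wpDl.
Unshelve. all: by end_near. Qed.

(** Boundedness of both factors keeps the constants of the product uniform in [om]. *)
Lemma niceM h Phi1 Psi1 Phi2 Psi2 : nice h Phi1 Psi1 -> nice h Phi2 Psi2 ->
  nice h (fun om => Phi1 om * Phi2 om) (fun om => Psi1 om * Phi2 om + Phi1 om * Psi2 om).
Proof.
have lipM (f1 f2 : (H -> R) -> R) B1 B2 L1 L2 : (forall om, `|f1 om| <= B1) ->
    (forall om, `|f2 om| <= B2) ->
    (forall om t, `|f1 (shiftp ip om h t) - f1 om| <= L1 * `|t|) ->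
    (forall om t, `|f2 (shiftp ip om h t) - f2 om| <= L2 * `|t|) ->
    forall om t, `|f1 (shiftp ip om h t) * f2 (shiftp ip om h t) - f1 om * f2 om| <= (L1 * B2 + B1 * L2) * `|t|.
  move=> b1 b2 l1 l2 om t.
  have -> : f1 (shiftp ip om h t) * f2 (shiftp ip om h t) - f1 om * f2 om =
    (f1 (shiftp ip om h t) - f1 om) * f2 (shiftp ip om h t) +
    f1 om * (f2 (shiftp ip om h t) - f2 om) by ring.
  rewrite [leRHS]mulrDl [L1 * _ * _]mulrAC -[B1 * _ * _]mulrA; apply: le_trans (ler_normD _ _) _.
  by rewrite !normrM; apply: lerD; apply: ler_pM.
move=> [[c1 c1' [L1 l1] [B1' b1'] [[K1 k1] [L1' l1']]] [B1 b1]].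
move=> [[c2 c2' [L2 l2] [B2' b2'] [[K2 k2] [L2' l2']]] [B2 b2]]; split; last first.
  by exists (B1 * B2) => om; rewrite normrM ler_pM.
split.
- exact: cylM.
- by apply: cylD; exact: cylM.
- by exists (L1 * B2 + B1 * L2); exact: lipM.
- exists (B1' * B2 + B1 * B2') => om; apply: le_trans (ler_normD _ _) _.
  by rewrite !normrM lerD// ler_pM.
- split; last first.
    have h1 := lipM _ _ _ _ _ _ b1' b2 l1' l2; have h2 := lipM _ _ _ _ _ _ b1 b2' l1 l2'.
    exists (L1' * B2 + B1' * L2 + (L1 * B2' + B1 * L2')) => om t.
    by rewrite opprD addrACA mulrDl; apply: le_trans (ler_normD _ _) _; exact: lerD.
  exists (K1 * B2 + B1 * K2 + L1 * L2) => om t.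
  have -> : Phi1 (shiftp ip om h t) * Phi2 (shiftp ip om h t) - Phi1 om * Phi2 om -
      t * (Psi1 om * Phi2 om + Phi1 om * Psi2 om) =
    (Phi1 (shiftp ip om h t) - Phi1 om - t * Psi1 om) * Phi2 om +
    Phi1 om * (Phi2 (shiftp ip om h t) - Phi2 om - t * Psi2 om) +
    (Phi1 (shiftp ip om h t) - Phi1 om) * (Phi2 (shiftp ip om h t) - Phi2 om) by ring.
  apply: le_trans (ler_normD _ _) _; apply: le_trans (lerD (ler_normD _ _) (lexx _)) _.
  rewrite !normrM 2!mulrDl lerD//; first apply: lerD.
  + by rewrite mulrAC ler_pM.
  + by rewrite -mulrA ler_pM.
  + rewrite -[t ^+ 2]real_normK ?num_real// expr2 mulrACA ler_pM//.
Qed.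

(** Boundedness is asked of [phi' a] along the [Z a] and not of the [Z a] themselves, so that
    coordinates may serve as inner functions in [nice_smooth]. The quadratic error is that of [phi]
    plus those of the [Z a] weighted by [phi' a]. *)
Lemma nice0_comp m (Z Z' : 'I_m -> (H -> R) -> R) h (phi : 'rV[R]_m -> R)
    (phi' : 'I_m -> 'rV[R]_m -> R) :
  (forall a, nice0 h (Z a) (Z' a)) -> (exists L, lipc L phi) ->
  (forall a, qder a phi (phi' a)) -> (forall a, exists L, lipc L (phi' a)) ->
  (forall a, bounded (fun om => phi' a (\row_a Z a om))) ->
  nice0 h (fun om => phi (\row_a Z a om))
         (fun om => \sum_a phi' a (\row_a Z a om) * Z' a om).
Proof.
move=> nZ [L phiL] dphi phi'L bphi'.
have cphi f : (exists L, lipc L f) -> cyl (fun om => f (\row_a Z a om)).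
  have cZ a : cyl (Z a) by case: (nZ a).
  move=> [Lf fL]; have := cyl_comp (measurable_lipc fL) cZ.
  have -> : (fun om => f (\row_a Z a om)) = fun om => f (\row_i tnth [tuple Z i om | i < m] i).
    by apply/funext => om; congr f; apply/rowP => i; rewrite !mxE tnth_mktuple.
  by [].
have /choice[LZ LZP] : forall a, exists B, forall om t,
  `|Z a (shiftp ip om h t) - Z a om| <= B * `|t| by move=> a; have [] := nZ a.
have incr om t : \row_a Z a (shiftp ip om h t) =
    \row_a Z a om + \row_a (Z a (shiftp ip om h t) - Z a om).
  by apply/rowP => a; rewrite !mxE addrC subrK.
have sumZ om t : \sum_a `|(\row_a (Z a (shiftp ip om h t) - Z a om)) 0 a| <= (\sum_a LZ a) * `|t|.
  by rewrite mulr_suml ler_sum// => a _; rewrite mxE.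
have lphi f : (exists L, lipc L f) -> exists M, forall om t,
    `|f (\row_a Z a (shiftp ip om h t)) - f (\row_a Z a om)| <= M * `|t|.
  move=> [Lf fL]; exists (`|Lf| * \sum_a LZ a) => om t; rewrite incr.
  apply: le_trans (lipc_total _ _ fL) _; rewrite -mulrA.
  apply: (@le_trans _ _ (`|Lf| * \sum_i `|(\row_a (Z a (shiftp ip om h t) - Z a om)) 0 i|)).
    by rewrite ler_wpM2r ?ler_norm// sumr_ge0.
  by rewrite ler_wpM2l.
have /choice[BZ BZP] : forall a, exists B, forall om, `|Z' a om| <= B by move=> a; have [] := nZ a.
have /choice[LZ' LZP'] : forall a, exists B, forall om t,
  `|Z' a (shiftp ip om h t) - Z' a om| <= B * `|t| by move=> a; have [_ _ _ _ []] := nZ a.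
have /choice[Bp BpP] : forall a, exists B, forall om, `|phi' a (\row_a Z a om)| <= B.
  exact: bphi'.
have /choice[Lp LpP] : forall a, exists M, forall om t,
    `|phi' a (\row_a Z a (shiftp ip om h t)) - phi' a (\row_a Z a om)| <= M * `|t|.
  by move=> a; exact: lphi.
split.
- by apply: cphi; exists L.
- apply: cyl_sum => a; apply: cylM; first exact: cphi.
  by have [] := nZ a.
- by apply: lphi; exists L.
- exists (\sum_a Bp a * BZ a) => om; apply: le_trans (ler_norm_sum _ _ _) _.
  by apply: ler_sum => a _; rewrite normrM ler_pM.
split; last first.
  exists (\sum_a (Lp a * BZ a + Bp a * LZ' a)) => om t.
  rewrite -sumrB mulr_suml; apply: le_trans (ler_norm_sum _ _ _) _; apply: ler_sum => a _.
  set p := phi' a _; set q := phi' a _.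
  have -> : p * Z' a (shiftp ip om h t) - q * Z' a om =
    (p - q) * Z' a (shiftp ip om h t) + q * (Z' a (shiftp ip om h t) - Z' a om) by ring.
  rewrite [leRHS]mulrDl [Lp a * _ * _]mulrAC -[Bp a * _ * _]mulrA; apply: le_trans (ler_normD _ _) _.
  by rewrite !normrM; apply: lerD; apply: ler_pM => //; [exact: LpP|exact: BpP].
have [K KP] := qder_total dphi phi'L.
have /choice[KZ KZP] : forall a, exists K, forall om t,
    `|Z a (shiftp ip om h t) - Z a om - t * Z' a om| <= K * t ^+ 2.
  by move=> a; have [_ _ _ _ []] := nZ a.
exists (`|K| * (\sum_a LZ a) ^+ 2 + \sum_a Bp a * KZ a) => om t.
rewrite incr; set v := \row_a (_ - _); set x := \row_a Z a om.
have -> : phi (x + v) - phi x - t * (\sum_a phi' a x * Z' a om) =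
   (phi (x + v) - phi x - \sum_a v 0 a * phi' a x) +
   \sum_a phi' a x * (v 0 a - t * Z' a om).
  under [in X in _ = _ + X]eq_bigr do rewrite mulrBr mulrC mulrCA.
  by rewrite sumrB -mulr_sumr; ring.
apply: le_trans (ler_normD _ _) _; rewrite mulrDl lerD//.
  apply: le_trans (KP _ _) _.
  apply: (@le_trans _ _ (`|K| * (\sum_i `|v 0 i|) ^+ 2)).
    by rewrite ler_wpM2r ?ler_norm// sqr_ge0.
  rewrite -mulrA ler_wpM2l// -[t ^+ 2]real_normK ?num_real// -exprMn.
  rewrite lerXn2r ?nnegrE//; [exact: sumr_ge0| |exact: sumZ].
  by apply: le_trans (sumZ om t); rewrite sumr_ge0.
rewrite mulr_suml; apply: le_trans (ler_norm_sum _ _ _) _; apply: ler_sum => a _.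
by rewrite normrM -mulrA ler_pM//; [exact: BpP|rewrite mxE].
Qed.

Lemma nice_comp m (Z Z' : 'I_m -> (H -> R) -> R) h (phi : 'rV[R]_m -> R)
    (phi' : 'I_m -> 'rV[R]_m -> R) :
  (forall a, nice h (Z a) (Z' a)) -> (exists L, lipc L phi) ->
  (forall a, qder a phi (phi' a)) -> (forall a, exists L, lipc L (phi' a)) ->
  nice h (fun om => phi (\row_a Z a om))
         (fun om => \sum_a phi' a (\row_a Z a om) * Z' a om).
Proof.
move=> nZ phiL dphi phi'L.
have bphi f : (exists L, lipc L f) -> exists M, forall om, `|f (\row_a Z a om)| <= M.
  move=> [Lf fL].
  have /choice[B BP] : forall a, exists B, forall om, `|Z a om| <= B.
    by move=> a; have [] := nZ a.
  exists (`|f 0| + `|Lf| * \sum_a B a) => om.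
  rewrite -(subrK (f 0) (f _)); apply: le_trans (ler_normD _ _) _; rewrite addrC lerD2l.
  have := lipc_total 0 (\row_a Z a om) fL; rewrite add0r => /le_trans; apply.
  apply: (@le_trans _ _ (`|Lf| * \sum_a `|(\row_a Z a om) 0 a|)).
    by rewrite ler_wpM2r ?ler_norm// sumr_ge0.
  by rewrite ler_wpM2l// ler_sum// => a _; rewrite mxE.
split; last exact: bphi.
apply: nice0_comp => // a; first by case: (nZ a).
exact: bphi.
Qed.

Lemma nice_smooth r (k : 'I_r -> H) (g : 'rV[R]_r -> R) h : smooth g -> compactly_supported g ->
  nice h (fun om => g (\row_i om (k i))) (fun om => \sum_i partial i g (\row_i om (k i)) * ip h (k i)).
Proof.
move=> sg cg; split; last first.
  by have [M MP] := smooth_bounded sg cg; exists M.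
have := @nice0_comp r (fun i om => om (k i)) (fun i _ => ip h (k i)) h g (fun i => partial i g).
apply => [i||i|i|i].
- split; [exact: cyl_coord|exact: cyl_cst| | |split].
  + by exists `|ip h (k i)| => om t; rewrite /shiftp addrC addKr normrM mulrC.
  + by exists `|ip h (k i)|.
  + by exists 0 => om t; rewrite /shiftp mul0r (_ : _ - _ = 0) ?normr0//; ring.
  + by exists 0 => om t; rewrite subrr normr0 mul0r.
- exact: smooth_lipc.
- exact: smooth_qder.
- exact: smooth_lipc (smooth_partial sg i) (compactly_supported_partial cg (i:=i)).
- by have [M MP] := partial_bounded sg cg i; exists M.
Qed.

End nice_functionals.

Lemma L2_ext d (T : measurableType d) (R : realType) (mu : {finite_measure set T -> \bar R})
  (f g : T -> R) : f =1 g -> L2 mu f -> L2 mu g.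
Proof. by move=> /funext ->. Qed.

Lemma E_cst d (T : measurableType d) (R : realType) (P : probability T R) (k : R) :
  Rintegral P setT (fun=> k) = k.
Proof. by rewrite /Rintegral integral_cst//= probability_setT mule1. Qed.

Lemma cvg_sumR (R : realType) (I : Type) (s : seq I) (F : nat -> I -> R) (l : I -> R) :
  (forall i, F n i @[n --> \oo] --> l i) ->
  \sum_(i <- s) F n i @[n --> \oo] --> \sum_(i <- s) l i.
Proof.
move=> Fl; elim: s => [|i s ih].
  by rewrite big_nil; under eq_fun do rewrite big_nil; exact: cvg_cst.
by rewrite big_cons; under eq_fun do rewrite big_cons; exact: cvgD.
Qed.

Section duality.
Context (R : realType) (H : completeNormedModType R) (ip : inner_product H).
Context d (T : measurableType d) (P : probability T R) (W : H -> {RV P >-> R}).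
Hypothesis isoW : isonormal ip W.
Local Notation E f := (Rintegral P setT f).

Lemma nice_measurable h Phi Psi : nice ip h Phi Psi ->
  measurable_fun setT (fun w => Phi (gpath W w)).
Proof. by move=> /nice_cyl; exact: cyl_measurable. Qed.

Lemma nice_L2 h Phi Psi : nice ip h Phi Psi -> L2 P (fun w => Phi (gpath W w)).
Proof.
move=> n; have [_ [M MP]] := n.
by apply: L2_bounded (nice_measurable n) _ => w; exact: MP.
Qed.

Lemma nice_L2' h Phi Psi : nice ip h Phi Psi -> L2 P (fun w => Psi (gpath W w)).
Proof.
move=> [[_ c _ [M MP] _] _].
by apply: (@L2_bounded _ _ _ P _ M) => [|w]; [exact: cyl_measurable|exact: MP].
Qed.

Lemma nice_L2M h Phi Psi f : nice ip h Phi Psi -> L2 P f ->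
  L2 P (fun w => Phi (gpath W w) * f w).
Proof.
move=> n; have [_ [M MP]] := n.
by apply: L2Mb (nice_measurable n) _ => w; exact: MP.
Qed.

Section divergence.
Variables (J : finType) (a b : J -> (H -> R) -> R) (k : J -> H).
Hypothesis nab : forall j, nice ip (k j) (a j) (b j).

(** The Skorokhod divergence of the field [\sum_j a j *: k j]; [b j] is the derivative of [a j]
    along [k j]. *)
Definition divergence om := \sum_j (a j om * om (k j) - b j om).

Lemma divergence_L2 : L2 P (fun w => divergence (gpath W w)).
Proof.
apply: L2_sum => j; apply: L2B; last exact: nice_L2' (nab j).
exact: nice_L2M (nab j) (W_L2 isoW (k j)).
Qed.

(** Integration by parts along [k j] for the product [a j * gam]; of the two terms of the product
    rule, the one with [b j] moves to the other side. *)
Lemma divergence_dual (gam : (H -> R) -> R) (dgam : H -> (H -> R) -> R) :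
  (forall h, sdir ip h gam (dgam h)) -> L2 P (fun w => gam (gpath W w)) ->
  (forall h, L2 P (fun w => dgam h (gpath W w))) ->
  E (fun w => \sum_j a j (gpath W w) * dgam (k j) (gpath W w)) =
  E (fun w => gam (gpath W w) * divergence (gpath W w)).
Proof.
move=> sg g2 dg2.
have I1 j : itg P (fun w => a j (gpath W w) * dgam (k j) (gpath W w)).
  by apply: L2_itg; exact: nice_L2M (nab j) (dg2 _).
have I2 j : itg P (fun w => gam (gpath W w) * (a j (gpath W w) * W (k j) w)).
  by apply: L2M => //; exact: nice_L2M (nab j) (W_L2 isoW (k j)).
have I3 j : itg P (fun w => gam (gpath W w) * b j (gpath W w)).
  by apply: L2M => //; exact: nice_L2' (nab j).
transitivity (E (fun w => \sum_j (gam (gpath W w) * (a j (gpath W w) * W (k j) w) -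
    gam (gpath W w) * b j (gpath W w)))); last first.
  apply: eq_Rintegral => w _; rewrite /divergence mulr_sumr; apply: eq_bigr => j _.
  by rewrite mulrBr.
rewrite !E_sum => [||//]; last by move=> j; exact: itgB.
apply: eq_bigr => j _; rewrite EB//.
have s := sdirM (nice_sdir (nab j)) (sg (k j)); have [c1 c2 dd cc] := s.
have := @gaussian_ibp _ _ _ _ _ _ _ isoW _ _ (k j) c1 c2 dd cc.
have e1 : E (fun w => W (k j) w * (a j (gpath W w) * gam (gpath W w))) =
    E (fun w => gam (gpath W w) * (a j (gpath W w) * W (k j) w)).
  by apply: eq_Rintegral => w _; ring.
have I3' : itg P (fun w => b j (gpath W w) * gam (gpath W w)).
  by apply: itg_ext (I3 j) => w; rewrite mulrC.
rewrite e1 => ->.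
- rewrite ED// [X in _ = X + _ - _](_ : _ = E (fun w => gam (gpath W w) * b j (gpath W w))).
    by rewrite addrAC subrr add0r.
  by apply: eq_Rintegral => w _; rewrite mulrC.
- exact: nice_L2M (nab j) g2.
- exact: itgD.
Qed.

End divergence.

(** The rule H_n' = n H_{n-1}, proved for two consecutive degrees because the recursion has order
    two. At [n = 0] the default [0.-1 = 0] is silenced by the factor [n]. *)
Lemma sdir_hermite n s g h : sdir ip g (fun om => hermite n s (om h))
  (fun om => ip g h * (n%:R * hermite n.-1 s (om h))).
Proof.
suff : sdir ip g (fun om => hermite n s (om h))
  (fun om => ip g h * (n%:R * hermite n.-1 s (om h))) /\
  sdir ip g (fun om => hermite n.+1 s (om h))
  (fun om => ip g h * (n.+1%:R * hermite n s (om h))) by case.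
elim: n => [|n [ih1 ih2]].
  split.
    have -> : (fun om : H -> R => ip g h * (0%:R * hermite 0.-1 s (om h))) = (fun=> 0).
      by apply/funext => om; rewrite !(mul0r, mulr0).
    exact: sdir_cst.
  by under [X in sdir _ _ _ X]eq_fun do rewrite /= !mulr1; exact: sdir_coord.
split=> //.
have := sdirD (sdirM (sdir_coord ip g h) ih2) (sdirZ (- (n.+1%:R * s)) ih1).
have -> : (fun om : H -> R => ip g h * hermite n.+1 s (om h) +
     om h * (ip g h * (n.+1%:R * hermite n s (om h))) +
     - (n.+1%:R * s) * (ip g h * (n%:R * hermite n.-1 s (om h)))) =
   (fun om => ip g h * (n.+2%:R * hermite n.+1 s (om h))).
  apply/funext => om; case: n {ih1 ih2} => [|n] /=; first by ring.
  by rewrite -[n.+3%:R]natr1; ring.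
by under eq_fun do rewrite mulNr.
Qed.

(** Extra powers of [W h] strengthen the induction, since the recursion multiplies by the
    variable. *)
Lemma hermite_L2 n s h : L2 P (fun w => hermite n s (W h w)).
Proof.
suff : forall m, L2 P (fun w => W h w ^+ m * hermite n s (W h w)) /\
   L2 P (fun w => W h w ^+ m * hermite n.+1 s (W h w)).
  by move=> /(_ 0%N)[+ _]; apply: L2_ext => w; rewrite expr0 mul1r.
elim: n => [|n ih] m.
  split; first by apply: L2_ext (W_pow_L2 isoW h m) => w /=; rewrite mulr1.
  by apply: L2_ext (W_pow_L2 isoW h m.+1) => w /=; rewrite exprSr.
split; first by case: (ih m).
have := L2B (ih m.+1).2 (L2Z (n.+1%:R * s) (ih m).1).
by apply: L2_ext => w /=; rewrite exprS; ring.
Qed.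

(** The factor [W h] in the recursion is integrated by parts: differentiating the Hermite factor
    produces exactly the term that the recursion subtracts. *)
Lemma hermite_ibp n h Phi Psi : nice ip h Phi Psi ->
  E (fun w => hermite n.+1 (ip h h) (W h w) * Phi (gpath W w)) =
  E (fun w => hermite n (ip h h) (W h w) * Psi (gpath W w)).
Proof.
move=> nP; have P2 := nice_L2 nP; have Q2 := nice_L2' nP.
have s := sdirM (nice_sdir nP) (sdir_hermite n (ip h h) h h); have [c1 c2 dd cc] := s.
have := @gaussian_ibp _ _ _ _ _ _ _ isoW _ _ h c1 c2 dd cc.
have h2 m := hermite_L2 m (ip h h) h.
have I1 m : itg P (fun w => Phi (gpath W w) * hermite m (ip h h) (W h w)).
  exact: L2M.
have I2 m : itg P (fun w => Psi (gpath W w) * hermite m (ip h h) (W h w)).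
  exact: L2M.
have I3 : itg P (fun w => Phi (gpath W w) * (ip h h * (n%:R * hermite n.-1 (ip h h) (W h w)))).
  by apply: itg_ext (itgZl (ip h h * n%:R) (I1 n.-1)) => w; ring.
rewrite ED// => /(_ (nice_L2M nP (h2 n)) (itgD (I2 n) I3)) e.
transitivity (E (fun w => W h w * (Phi (gpath W w) * hermite n (ip h h) (gpath W w h))) -
   E (fun w => Phi (gpath W w) * (ip h h * (n%:R * hermite n.-1 (ip h h) (W h w))))).
  rewrite -EB//.
    apply: eq_Rintegral => w _; case: n {e I3 s c1 c2 dd cc} => [|n] /=; rewrite /gpath; ring.
  by apply: L2M; [exact: (W_L2 isoW h)|exact: (nice_L2M nP (h2 n))].
by rewrite e addrK; apply: eq_Rintegral => w _; rewrite mulrC.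
Qed.

Lemma nice_cst h c : nice ip h (fun=> c) (fun=> 0).
Proof.
split; last by exists `|c|.
split; [exact: cyl_cst|exact: cyl_cst|exists 0|exists 0|split; exists 0] => om => [t||t|t].
- by rewrite subrr normr0 mul0r.
- by rewrite normr0.
- by rewrite mulr0 !subrr normr0 mul0r.
- by rewrite subrr normr0 mul0r.
Qed.

Section chaos.
Variables (J : finType) (a b : J -> (H -> R) -> R) (k : J -> H).
Hypothesis nab : forall j, nice ip (k j) (a j) (b j).
Variable Phi : (H -> R) -> R.
Hypothesis nPhi : forall h, nice ip h Phi (fun om => \sum_j a j om * ip h (k j)).
Local Notation delta w := (divergence a b k (gpath W w)).

Let Phi2 : L2 P (fun w => Phi (gpath W w)).
Proof. exact: nice_L2 (nPhi 0). Qed.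

Let delta2 : L2 P (fun w => delta w).
Proof. exact: divergence_L2. Qed.

(** By [nPhi] the field is the gradient of [Phi], so [delta] is -L Phi, and Hermite polynomials of
    degree [n] are eigenvectors of the self-adjoint operator -L with eigenvalue [n]. Duality lowers
    the degree by one and brings out [n]; [hermite_ibp] raises the degree again. *)
Lemma hermite_divergence n h :
  E (fun w => hermite n (ip h h) (W h w) * delta w) =
  n%:R * E (fun w => hermite n (ip h h) (W h w) * Phi (gpath W w)).
Proof.
rewrite -(@divergence_dual _ _ _ _ nab _ _ (sdir_hermite n (ip h h) ^~ h)); last 2 first.
- exact: hermite_L2.
- by move=> g; do 2 apply: L2Z; exact: hermite_L2.
case: n => [|n].
  rewrite mulr0n mul0r -[RHS](@E0 _ _ _ P); apply: eq_Rintegral => w _.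
  by rewrite big1// => j _; rewrite !(mul0r, mulr0).
rewrite (hermite_ibp n (nPhi h)) -EZl; last first.
  by apply: L2M; [exact: hermite_L2|exact: nice_L2' (nPhi h)].
apply: eq_Rintegral => w _; rewrite !mulr_sumr; apply: eq_bigr => j _.
by rewrite (innerC _ (k j)) /gpath /=; ring.
Qed.

Lemma multiple_integral_L2 n (f : sym_tensor ip n) (G : {RV P >-> R}) :
  multiple_integral W f G -> L2 P G /\ forall Y, L2 P Y ->
  E (fun w => (\sum_(c <- f N) c.1 * hermite n (ip c.2 c.2) (W c.2 w)) * Y w) @[N --> \oo] -->
  E (fun w => G w * Y w).
Proof.
move=> fG; have f2 N : L2 P (fun w => \sum_(c <- f N) c.1 * hermite n (ip c.2 c.2) (W c.2 w)).
  by apply: L2_sum => c; apply: L2Z; exact: hermite_L2.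
have [G2 cG] := Lp_cvg2 f2 (measurable_funPT G) fG; split=> // Y Y2.
exact: (L2_cvgM f2 G2 Y2 cG).
Qed.

Lemma multiple_integral_mean n (f : sym_tensor ip n.+1) (G : {RV P >-> R}) :
  multiple_integral W f G -> E G = 0.
Proof.
move=> /multiple_integral_L2[_ /(_ _ (L2_cst P 1)) c].
have -> : E G = E (fun w => G w * 1) by apply: eq_Rintegral => w _; rewrite mulr1.
apply: (cvg_unique _ c) => //; apply: cvg_near_cst; apply: nearW => N.
transitivity (E (fun w => \sum_(c <- f N) c.1 * (hermite n.+1 (ip c.2 c.2) (W c.2 w) * 1))).
  by apply: eq_Rintegral => w _; rewrite mulr1; apply: eq_bigr => e _; rewrite mulr1.
have I e : itg P (fun w => hermite n.+1 (ip e.2 e.2) (W e.2 w) * 1).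
  by apply: L2M; [exact: hermite_L2|exact: L2_cst].
rewrite E_sum => [|e]; last exact: itgZl.
rewrite big1// => e _; rewrite EZl// (hermite_ibp n (nice_cst e.2 1)).
under eq_Rintegral do rewrite mulr0.
by rewrite E0 mulr0.
Qed.

Lemma multiple_integral_divergence n (f : sym_tensor ip n) (G : {RV P >-> R}) :
  multiple_integral W f G ->
  E (fun w => G w * delta w) = n%:R * E (fun w => G w * Phi (gpath W w)).
Proof.
move=> /multiple_integral_L2[G2 cG].
have c1 := cG _ delta2; have c2 := cG _ Phi2.
apply: (cvg_unique _ c1 _) => //.
have : n%:R * E (fun w => (\sum_(c <- f N) c.1 * hermite n (ip c.2 c.2) (W c.2 w)) * Phi (gpath W w))
   @[N --> \oo] --> n%:R * E (fun w => G w * Phi (gpath W w)) by exact: cvgMr.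
apply: cvg_trans; apply: near_eq_cvg; apply: nearW => N /=.
have EM (Y : T -> R) : L2 P Y ->
    E (fun w => (\sum_(c <- f N) c.1 * hermite n (ip c.2 c.2) (W c.2 w)) * Y w) =
    \sum_(c <- f N) c.1 * E (fun w => hermite n (ip c.2 c.2) (W c.2 w) * Y w).
  move=> Y2; have I c : itg P (fun w => hermite n (ip c.2 c.2) (W c.2 w) * Y w).
    by apply: L2M => //; exact: hermite_L2.
  transitivity (E (fun w => \sum_(c <- f N) c.1 * (hermite n (ip c.2 c.2) (W c.2 w) * Y w))).
    apply: eq_Rintegral => w _; rewrite mulr_suml; apply: eq_bigr => c _.
    by rewrite mulrA.
  rewrite E_sum => [|c]; last exact: itgZl.
  by apply: eq_bigr => c _; rewrite EZl.
rewrite !EM// mulr_sumr; apply: eq_bigr => c _.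
by rewrite hermite_divergence mulrCA.
Qed.

(* The zeroth chaos consists of constants. *)
Lemma multiple_integral0 (f : sym_tensor ip 0) (G : {RV P >-> R}) :
  multiple_integral W f G ->
  E (fun w => G w * Phi (gpath W w)) = E G * E (fun w => Phi (gpath W w)).
Proof.
move=> /multiple_integral_L2[G2 cG].
have c1 := cG _ (L2_cst P 1); have c2 := cG _ Phi2.
apply: (cvg_unique _ c2 _) => //.
have -> : E G = E (fun w => G w * 1) by apply: eq_Rintegral => w _; rewrite mulr1.
apply: cvg_trans (cvgMl c1).
apply: near_eq_cvg; apply: nearW => N /=.
rewrite -EZl; last exact: L2_itg.
apply: eq_Rintegral => w _; congr (_ * _).
by rewrite E_cst !mulr1.
Qed.

(** Chaos by chaos the eigenvalue [n] of -L cancels the coefficient [n^-1]. The term [n = 0]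
    vanishes on the left because [0^-1 = 0] and on the right because [X] is centred. *)
Lemma pinv_OU_divergence X LX : pinv_OU ip W X LX -> ('E_P[X] = 0)%E ->
  [/\ L2 P X, L2 P LX &
  E (fun w => LX w * delta w) = E (fun w => X w * Phi (gpath W w))].
Proof.
move=> [f [G [fG GX GL]]] EX.
have G2 n : L2 P (G n) by case: (multiple_integral_L2 (fG n)).
have SL2 N : L2 P (fun w => \sum_(n < N) G n w) by exact: L2_sum.
have SL2' N : L2 P (fun w => \sum_(n < N) n%:R^-1 * G n w).
  by apply: L2_sum => i; exact: L2Z.
have [X2 cX] := Lp_cvg2 SL2 (measurable_funPT X) GX.
have [LX2 cLX] := Lp_cvg2 SL2' (measurable_funPT LX) GL; split=> //.
have EM (c : nat -> R) N (Y : T -> R) : L2 P Y ->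
    E (fun w => (\sum_(n < N) c n * G n w) * Y w) = \sum_(n < N) c n * E (fun w => G n w * Y w).
  move=> Y2; have I n : itg P (fun w => G n w * Y w) by exact: L2M.
  transitivity (E (fun w => \sum_(n < N) c n * (G n w * Y w))).
    by apply: eq_Rintegral => w _; rewrite mulr_suml; apply: eq_bigr => n _; rewrite mulrA.
  rewrite E_sum => [|n]; last exact: itgZl.
  by apply: eq_bigr => n _; rewrite EZl.
have EM1 N (Y : T -> R) : L2 P Y ->
    E (fun w => (\sum_(n < N) G n w) * Y w) = \sum_(n < N) E (fun w => G n w * Y w).
  move=> Y2; rewrite -[RHS](eq_bigr _ (fun i _ => mul1r _)) -(EM (fun=> 1))//.
  by apply: eq_Rintegral => w _; congr (_ * _); apply: eq_bigr => n _; rewrite mul1r.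
(* Testing the chaos expansion against the constant [1] leaves the zeroth component only. *)
have EG0 : E (G 0%N) = 0.
  have c3 := L2_cvgM SL2 X2 (L2_cst P 1) cX.
  have -> : 0 = E (fun w => X w * 1).
    transitivity (E X); last by apply: eq_Rintegral => w _; rewrite mulr1.
    by move: EX; rewrite unlock /Rintegral => ->.
  apply/esym; apply: (cvg_unique _ c3) => //; apply: cvg_near_cst.
  exists 1%N => // -[//|N] _; rewrite EM1 ?big_ord_recl; last exact: L2_cst.
  rewrite big1 ?addr0 => [|i _]; first by apply: eq_Rintegral => w _; rewrite mulr1.
  rewrite -[RHS](multiple_integral_mean (fG i.+1)).
  by apply: eq_Rintegral => w _; rewrite mulr1.
have c1 := L2_cvgM SL2' LX2 delta2 cLX; have c2 := L2_cvgM SL2 X2 Phi2 cX.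
apply: (cvg_unique _ c1) => //; apply: cvg_trans c2; apply: near_eq_cvg.
apply: nearW => N /=; rewrite EM1// (EM (fun n => n%:R^-1))//; apply: eq_bigr => -[[|n] nN] _ /=.
  by rewrite invr0 mul0r (multiple_integral0 (fG 0%N)) EG0 mul0r.
by rewrite (multiple_integral_divergence (fG n.+1)) mulKf// pnatr_eq0.
Qed.

Hypothesis sepH : separable H.

Lemma smooth_derivative_nice (F : {RV P >-> R}) (DF : T -> H) :
  smooth_derivative W F DF ->
  exists (gam : (H -> R) -> R) (dgam : (H -> R) -> H),
   [/\ forall h, nice ip h gam (fun om => ip h (dgam om)),
     forall w, F w = gam (gpath W w), forall w, DF w = dgam (gpath W w) & hL2 P DF].
Proof.
move=> [r [h [g [sg cg FE DE]]]].
exists (fun om => g (\row_i om (h i))), (fun om => \sum_(i < r) partial i g (\row_j om (h j)) *: h i).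
have ng k' := nice_smooth ip h k' sg cg.
split=> // [k'|].
  have := ng k'; congr nice; apply/funext => om; rewrite inner_sumr.
  by apply: eq_bigr => i _; rewrite innerZr.
have mp i : measurable_fun setT (fun w => partial i g (\row_j W (h j) w)).
  have sp := smooth_partial sg i; have cp := compactly_supported_partial cg (i := i).
  exact: (nice_measurable (nice_smooth ip h 0 sp cp)).
have hD : hmeas DF.
  rewrite (_ : DF = fun w => \sum_(i < r) partial i g (\row_j W (h j) w) *: h i); last exact/funext.
  by apply: hmeas_sum => // i; exact: hmeasZ.
split=> //.
have /choice[M MP] := partial_bounded sg cg.
apply: (@L2_bounded _ _ _ P _ (\sum_i M i * `|h i|)); first exact: hmeas_norm.
move=> w; rewrite normr_id DE; apply: le_trans (ler_norm_sum _ _ _) _.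
by apply: ler_sum => i _; rewrite normrZ ler_wpM2r.
Qed.

(** For a smooth [G] this is [divergence_dual]. Both sides are continuous along L^2 convergence of
    the variables together with their derivatives, so the identity survives in the closure. *)
Lemma malliavin_divergence (G : {RV P >-> R}) (DG : T -> H) : malliavin ip W 2 G DG ->
  hL2 P DG /\
  E (fun w => \sum_j a j (gpath W w) * ip (k j) (DG w)) = E (fun w => G w * delta w).
Proof.
move=> [mDG [F [DF [FD [FG _] DFG]]]].
have F2 n : L2 P (F n).
  have [gam [dgam [n0 FE _ _]]] := smooth_derivative_nice (FD n).
  by apply: L2_ext (nice_L2 (n0 0)) => w; rewrite FE.
have DF2 n : hL2 P (DF n) by have [gam [dgam [_ _ _]]] := smooth_derivative_nice (FD n).
have [G2 cG] := Lp_cvg2 F2 (measurable_funPT G) FG.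
have [DG2 cDG] := LpH_cvg2 sepH DF2 mDG DFG; split=> //.
have c1 := L2_cvgM F2 G2 delta2 cG.
apply: (cvg_unique _ _ c1) => //.
have I (D : T -> H) j : hL2 P D -> itg P (fun w => a j (gpath W w) * ip (k j) (D w)).
  by move=> D2; apply: L2_itg; apply: nice_L2M (nab j) _; exact: hL2_inner_L2.
have c3 j : E (fun w => a j (gpath W w) * ip (k j) (DF n w)) @[n --> \oo] -->
    E (fun w => a j (gpath W w) * ip (k j) (DG w)).
  have : E (fun w => ip (k j) (DF n w) * a j (gpath W w)) @[n --> \oo] -->
    E (fun w => ip (k j) (DG w) * a j (gpath W w)).
    apply: (L2_cvgM (fun n => hL2_inner_L2 ip (k j) (DF2 n)) (hL2_inner_L2 ip (k j) DG2) (nice_L2 (nab j))).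
    apply: (@le_dist_cvg _ _ (fun n => `|k j| ^+ 2 * E (fun w => `|DF n w - DG w| ^+ 2))).
      move=> n; rewrite subr0 ger0_norm ?E_ge0//; last by move=> w; exact: sqr_ge0.
      have [D1 D2] := hL2B sepH (DF2 n) DG2.
      rewrite -EZl; last exact: D2.2.
      apply: le_E => [||w]; first by have [_ +] := hL2_inner_L2 ip (k j) (hL2B sepH (DF2 n) DG2);
        apply: itg_ext => w; rewrite innerBr.
        exact: itgZl D2.2.
      rewrite -innerBr -exprMn -[leLHS]real_normK ?num_real// lerXn2r ?nnegrE//.
      exact: normr_inner.
    by rewrite -[X in _ --> X](mulr0 (`|k j| ^+ 2)); exact: cvgMr.
  rewrite (_ : (fun n => _) = fun n => E (fun w => ip (k j) (DF n w) * a j (gpath W w))); last first.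
    by apply/funext => n; apply: eq_Rintegral => w _; rewrite mulrC.
  rewrite [X in _ -> _ --> X](_ : _ = E (fun w => ip (k j) (DG w) * a j (gpath W w)))//.
  by apply: eq_Rintegral => w _; rewrite mulrC.
rewrite E_sum => [|j]; last exact: I.
rewrite (_ : (fun n => _) = fun n => \sum_j E (fun w => a j (gpath W w) * ip (k j) (DF n w))).
  exact: cvg_sumR.
apply/funext => n; rewrite -E_sum => [|j]; last exact: I.
have [gam [dgam [n0 FE DE _]]] := smooth_derivative_nice (FD n).
transitivity (E (fun w => gam (gpath W w) * delta w)).
  by apply: eq_Rintegral => w _; rewrite FE.
rewrite -(divergence_dual nab (fun h => nice_sdir (n0 h)) (nice_L2 (n0 0)) (fun h => nice_L2' (n0 h))).
by apply: eq_Rintegral => w _; apply: eq_bigr => j _; rewrite DE.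
Qed.

End chaos.

End duality.

(** * The chain rule *)

Section chain_rule.
Context (R : realType) (H : completeNormedModType R) (ip : inner_product H).
Context d (T : measurableType d) (P : probability T R) (W : H -> {RV P >-> R}).
Hypotheses (isoW : isonormal ip W) (sepH : separable H).
Local Notation E f := (Rintegral P setT f).

Lemma sum_tagged m (r : 'I_m -> nat) (F : forall a, 'I_(r a) -> R) :
  \sum_(a < m) \sum_(i < r a) F a i = \sum_(j : {a : 'I_m & 'I_(r a)}) F (tag j) (tagged j).
Proof. by rewrite (@sig_big_dep _ _ _ _ (fun a => 'I_(r a)) xpredT (fun _ => xpredT)). Qed.

Lemma cvg_sum0 (I : Type) (s : seq I) (F : nat -> I -> R) :
  (forall i, F n i @[n --> \oo] --> 0) -> \sum_(i <- s) F n i @[n --> \oo] --> 0.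
Proof. by move=> F0; have := @cvg_sumR R I s F (fun=> 0) F0; rewrite big1. Qed.

Lemma L2_L1_le (f : T -> R) : L2 P f -> E (fun w => `|f w|) <= Num.sqrt (E (fun w => f w ^+ 2)).
Proof.
move=> f2; have := cauchy_schwarz_sqrt f2 (L2_cst P 1).
under eq_Rintegral do rewrite mulr1.
by under [X in _ <= _ * Num.sqrt X -> _]eq_Rintegral do rewrite expr1n; rewrite E_cst sqrtr1 mulr1.
Qed.

Lemma sqrt_cvg0 (u : nat -> R) : u n @[n --> \oo] --> 0 -> Num.sqrt (u n) @[n --> \oo] --> 0.
Proof.
by move=> u0; rewrite -(sqrtr0 R); apply: continuous_cvg => //; exact: sqrt_continuous.
Qed.

Lemma smooth_derivative_fields (F : {RV P >-> R}) (DF : T -> H) : smooth_derivative W F DF ->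
  exists (r : nat) (h : 'I_r -> H) (c : 'I_r -> (H -> R) -> R) (gam : (H -> R) -> R),
  [/\ forall k, nice ip k gam (fun om => \sum_i c i om * ip k (h i)),
     forall i k, exists c', nice ip k (c i) c',
     forall w, F w = gam (gpath W w) &
     forall w, DF w = \sum_i c i (gpath W w) *: h i].
Proof.
move=> [r [h [g [sg cg FE DE]]]].
exists r, h, (fun i om => partial i g (\row_j om (h j))), (fun om => g (\row_j om (h j))).
split=> // [k|i k]; first exact: nice_smooth.
have sp := smooth_partial sg i; have cp := compactly_supported_partial cg (i := i).
by eexists; exact: (nice_smooth ip h k sp cp).
Qed.

Lemma row_measurable m (phi : 'rV[R]_m -> R) (Z : 'I_m -> T -> R) L : lipc L phi ->
  (forall a, measurable_fun setT (Z a)) -> measurable_fun setT (fun w => phi (\row_a Z a w)).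
Proof.
move=> pL mZ; have := measurableT_comp (measurable_lipc pL) (measurable_mktuple mZ).
by congr measurable_fun; apply/funext => w /=; congr phi; apply/rowP => i; rewrite !mxE tnth_mktuple.
Qed.

Lemma lipc_row_le m (phi : 'rV[R]_m -> R) L (x y : 'rV[R]_m) : lipc L phi ->
  `|phi x - phi y| <= `|L| * \sum_a `|x 0 a - y 0 a|.
Proof.
move=> pL; have := lipc_total y (x - y) pL; rewrite subrKC => /le_trans; apply.
under eq_bigr do rewrite !mxE.
by rewrite ler_wpM2r ?ler_norm// sumr_ge0.
Qed.

Lemma L2_row m (phi : 'rV[R]_m -> R) (Z : 'I_m -> T -> R) L : lipc L phi ->
  (forall a, L2 P (Z a)) -> L2 P (fun w => phi (\row_a Z a w)).
Proof.
move=> pL Z2; have mp := row_measurable pL (fun a => (Z2 a).1).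
have S2 : L2 P (fun w => `|phi 0| + `|L| * \sum_a `|Z a w|).
  apply: L2D; first exact: L2_cst.
  by apply: L2Z; apply: L2_sum => a; exact: L2_norm.
split=> //; apply: (le_itg _ S2.2) => [|w]; first exact: measurable_funX.
rewrite normrX lerXn2r ?nnegrE ?addr_ge0 ?mulr_ge0 ?sumr_ge0//.
rewrite -[X in `|X|](subrK (phi 0)); apply: le_trans (ler_normD _ _) _.
rewrite addrC lerD2l; apply: le_trans (lipc_row_le _ _ pL) _.
by rewrite ler_wpM2l// ler_sum// => a _; rewrite !mxE subr0.
Qed.

Variables (X LX : {RV P >-> R}) (DLX : T -> H).
Hypotheses (X2 : L2 P X) (EX : ('E_P[X] = 0)%E) (XLX : pinv_OU ip W X LX) (DLXP : malliavin ip W 2 LX DLX).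
Variables (m : nat) (Z : 'I_m -> {RV P >-> R}) (DZ : 'I_m -> T -> H).
Hypothesis DZP : forall a, malliavin ip W 2 (Z a) (DZ a).

Lemma malliavin_approx (G : {RV P >-> R}) (DG : T -> H) : malliavin ip W 2 G DG ->
  [/\ L2 P G, hL2 P DG & exists (F : nat -> {RV P >-> R}) (DF : nat -> T -> H),
  [/\ forall n, smooth_derivative W (F n) (DF n),
   forall n, L2 P (F n), forall n, hL2 P (DF n),
   E (fun w => (F n w - G w) ^+ 2) @[n --> \oo] --> 0 &
   E (fun w => `|DF n w - DG w| ^+ 2) @[n --> \oo] --> 0]].
Proof.
move=> [mDG [F [DF [FD [FG _] DFG]]]].
have F2 n : L2 P (F n).
  have [gam [dgam [n0 FE _ _]]] := smooth_derivative_nice ip sepH (FD n).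
  by apply: L2_ext (nice_L2 W (n0 0)) => w; rewrite FE.
have DF2 n : hL2 P (DF n) by have [gam [dgam [_ _ _]]] := smooth_derivative_nice ip sepH (FD n).
have [G2 cG] := Lp_cvg2 F2 (measurable_funPT G) FG.
have [DG2 cDG] := LpH_cvg2 sepH DF2 mDG DFG; split=> //.
by exists F, DF.
Qed.

Variables (phi : 'rV[R]_m -> R) (phi' : 'I_m -> 'rV[R]_m -> R)
  (phi'' : 'I_m -> 'I_m -> 'rV[R]_m -> R) (B : R).
Hypotheses (phiL : exists L, lipc L phi) (dphi : forall a, qder a phi (phi' a))
  (phi'L : forall a, exists L, lipc L (phi' a))
  (dphi' : forall a b, qder b (phi' a) (phi'' a b))
  (phi''L : forall a b, exists L, lipc L (phi'' a b))
  (phi'B : forall a x, `|phi' a x| <= B).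

(** The field with terms [phi' a] times [DF a] is the gradient of [phi] evaluated at [F]. Pairing it
    with D(-L)^{-1}X gives the expectation of (-L)^{-1}X times its divergence, which
    [pinv_OU_divergence] evaluates; the divergence is where [phi''] enters. *)
Lemma chain_rule_smooth (F : 'I_m -> {RV P >-> R}) (DF : 'I_m -> T -> H) :
  (forall a, smooth_derivative W (F a) (DF a)) ->
  E (fun w => \sum_a phi' a (\row_b F b w) * ip (DF a w) (DLX w)) =
  E (fun w => X w * phi (\row_b F b w)).
Proof.
move=> FD.
pose fields := {r : nat & (('I_r -> H) * ('I_r -> (H -> R) -> R))%type}.
have /choice[D DP] : forall a, exists D : fields * ((H -> R) -> R),
  [/\ forall k, nice ip k D.2 (fun om => \sum_i (tagged D.1).2 i om * ip k ((tagged D.1).1 i)),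
     forall i k, exists c', nice ip k ((tagged D.1).2 i) c',
     forall w, F a w = D.2 (gpath W w) &
     forall w, DF a w = \sum_i (tagged D.1).2 i (gpath W w) *: (tagged D.1).1 i].
  by move=> a; have [r [h [c [gam cP]]]] := smooth_derivative_fields (FD a); exists (existT _ r (h, c), gam).
(* The number of directions in [DF a] depends on [a]; a sigma type indexes them all. *)
pose J := {a : 'I_m & 'I_(tag (D a).1)}.
pose k (j : J) := (tagged (D (tag j)).1).1 (tagged j).
pose c (j : J) := (tagged (D (tag j)).1).2 (tagged j).
have nD a k' : nice ip k' (D a).2
    (fun om => \sum_i (tagged (D a).1).2 i om * ip k' ((tagged (D a).1).1 i)).
  by have [+ _ _ _] := DP a; apply.
pose row om : 'rV[R]_m := \row_b (D b).2 om.
have FE w : \row_b F b w = row (gpath W w).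
  by apply/rowP => b; rewrite !mxE; have [_ _ ->] := DP b.
have nphi h : nice ip h (fun om => phi (row om))
    (fun om => \sum_(j : J) (phi' (tag j) (row om) * c j om) * ip h (k j)).
  have := @nice_comp _ _ ip m (fun a => (D a).2) _ h _ _ (nD^~ h) phiL dphi phi'L.
  congr nice; apply/funext => om.
  rewrite -(@sum_tagged _ (fun a => tag (D a).1) (fun a i => phi' a (row om) *
    (tagged (D a).1).2 i om * ip h ((tagged (D a).1).1 i))).
  by apply: eq_bigr => a _; rewrite mulr_sumr; apply: eq_bigr => i _; rewrite mulrA.
have /choice[b nb] : forall j : J, exists b, nice ip (k j) (fun om => phi' (tag j) (row om) * c j om) b.
  move=> j; have [_ /(_ (tagged j) (k j))[c' nc] _ _] := DP (tag j).
  have n1 := @nice_comp _ _ ip m (fun a => (D a).2) _ (k j) _ _ (nD^~ (k j)) (phi'L (tag j)) (dphi' (tag j)) (phi''L (tag j)).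
  by eexists; exact: niceM n1 nc.
have [DLX2 e1] := malliavin_divergence isoW nb sepH DLXP.
have [_ _ e2] := pinv_OU_divergence isoW nb nphi XLX EX.
transitivity (E (fun w => X w * phi (row (gpath W w)))); last first.
  by apply: eq_Rintegral => w _; rewrite FE.
rewrite -e2 -e1; apply: eq_Rintegral => w _.
rewrite -(@sum_tagged _ (fun a => tag (D a).1) (fun a i => phi' a (row (gpath W w)) *
    (tagged (D a).1).2 i (gpath W w) * ip ((tagged (D a).1).1 i) (DLX w))).
apply: eq_bigr => a _; have [_ _ _ ->] := DP a; rewrite inner_suml mulr_sumr FE.
by apply: eq_bigr => i _; rewrite innerZl mulrA.
Qed.

(** On the right [phi] is Lipschitz and L^2 convergence suffices. On the left the error splits: the
    derivatives converge in L^2 against the bounded [phi' a], while the differences of [phi' a] are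
    bounded, converge in L^1 and multiply a fixed integrable function. *)
Lemma chain_rule :
  E (fun w => \sum_a phi' a (\row_b Z b w) * ip (DZ a w) (DLX w)) =
  E (fun w => X w * phi (\row_b Z b w)).
Proof.
have [_ DLX2 _] := malliavin_approx DLXP.
have /choice[F FP] : forall a, exists FD : nat -> {RV P >-> R} * (T -> H),
  [/\ forall n, smooth_derivative W (FD n).1 (FD n).2,
   forall n, L2 P (FD n).1, forall n, hL2 P (FD n).2,
   E (fun w => ((FD n).1 w - Z a w) ^+ 2) @[n --> \oo] --> 0 &
   E (fun w => `|(FD n).2 w - DZ a w| ^+ 2) @[n --> \oo] --> 0].
  by move=> a; have [_ _ [F [DF FP]]] := malliavin_approx (DZP a); exists (fun n => (F n, DF n)).
have Z2 a : L2 P (Z a) by have [] := malliavin_approx (DZP a).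
have DZ2 a : hL2 P (DZ a) by have [] := malliavin_approx (DZP a).
have FZ2 a n : L2 P (fun w => (F a n).1 w - Z a w).
  by apply: L2B => //; have [_ + _ _ _] := FP a; apply.
have FZc a : Num.sqrt (E (fun w => ((F a n).1 w - Z a w) ^+ 2)) @[n --> \oo] --> 0.
  by apply: sqrt_cvg0; have [] := FP a.
have DFZc a : Num.sqrt (E (fun w => `|(F a n).2 w - DZ a w| ^+ 2)) @[n --> \oo] --> 0.
  by apply: sqrt_cvg0; have [] := FP a.
have F2 n a : L2 P (F a n).1 by have [_ + _ _ _] := FP a; apply.
have DF2 n a : hL2 P (F a n).2 by have [_ _ + _ _] := FP a; apply.
apply: (@cvg_unique _ _ (fmap (fun n => E (fun w => X w * phi (\row_b (F b n).1 w))) \oo)) => //; last first.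
  have [L pL] := phiL.
  apply: (@le_dist_cvg _ _ (fun n => `|L| * \sum_a (Num.sqrt (E (fun w => X w ^+ 2)) *
     Num.sqrt (E (fun w => ((F a n).1 w - Z a w) ^+ 2))))); last first.
    rewrite -[X in _ --> X](mulr0 `|L|); apply: cvgMr.
    apply: cvg_sum0 => a; rewrite -[X in _ --> X](mulr0 (Num.sqrt (E (fun w => X w ^+ 2)))).
    exact: cvgMr.
  move=> n; have I1 := L2M X2 (L2_row pL (F2 n)); have I2 := L2M X2 (L2_row pL Z2).
  have I3 a : itg P (fun w => `|X w * ((F a n).1 w - Z a w)|) by apply: itg_norm; exact: L2M.
  rewrite -EB//; apply: (@le_trans _ _ (E (fun w => `|L| * \sum_a `|X w * ((F a n).1 w - Z a w)|))).
    apply: le_normE_le; [exact: itgB| |move=> w].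
      by apply: itgZl; exact: itg_sum.
    rewrite -mulrBr normrM; apply: le_trans (ler_wpM2l _ (lipc_row_le _ _ pL)) _ => //.
    rewrite mulrCA ler_wpM2l// mulr_sumr ler_sum// => a _.
    by rewrite !mxE normrM.
  rewrite EZl; last exact: itg_sum.
  rewrite ler_wpM2l// E_sum// ler_sum// => a _; exact: cauchy_schwarz_sqrt.
have -> : (fun n => E (fun w => X w * phi (\row_b (F b n).1 w))) =
  (fun n => \sum_a E (fun w => phi' a (\row_b (F b n).1 w) * ip ((F a n).2 w) (DLX w))).
  apply/funext => n; rewrite -(chain_rule_smooth (F := fun a => (F a n).1) (DF := fun a => (F a n).2)).
    rewrite E_sum// => a; have [L pL] := phi'L a.
    apply: (@itgMb _ _ _ P _ _ B) => //.
      by apply: row_measurable pL _ => b; exact: (F2 n b).1.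
    exact: hL2_inner.
  by move=> a; have [+ _ _ _ _] := FP a; apply.
rewrite E_sum => [|a]; last first.
  have [L pL] := phi'L a; apply: (@itgMb _ _ _ P _ _ B) => //.
    by apply: row_measurable pL _ => b; exact: (Z2 b).1.
  exact: hL2_inner.
apply: cvg_sumR => a.
have [L pL] := phi'L a.
pose p n w := phi' a (\row_b (F b n).1 w); pose q w := phi' a (\row_b Z b w).
have mp n : measurable_fun setT (p n).
  by apply: row_measurable pL _ => b; exact: (F2 n b).1.
have mq : measurable_fun setT q by apply: row_measurable pL _ => b; exact: (Z2 b).1.
have I1 n : itg P (fun w => p n w * ip ((F a n).2 w - DZ a w) (DLX w)).
  apply: (@itgMb _ _ _ P _ _ B) => //; first by move=> w; exact: phi'B.
  by apply: hL2_inner => //; exact: hL2B.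
have I2 n : itg P (fun w => (p n w - q w) * ip (DZ a w) (DLX w)).
  apply: (@itgMb _ _ _ P _ _ (B + B)) => //; first exact: measurable_funB.
    by move=> w; apply: le_trans (ler_normB _ _) _; apply: lerD; exact: phi'B.
  exact: hL2_inner.
have I3 : itg P (fun w => q w * ip (DZ a w) (DLX w)).
  apply: (@itgMb _ _ _ P _ _ B) => //; first by move=> w; exact: phi'B.
  exact: hL2_inner.
have -> : (fun n => E (fun w => p n w * ip ((F a n).2 w) (DLX w))) =
   fun n => E (fun w => p n w * ip ((F a n).2 w - DZ a w) (DLX w)) +
     E (fun w => (p n w - q w) * ip (DZ a w) (DLX w)) +
     E (fun w => q w * ip (DZ a w) (DLX w)).
  apply/funext => n; rewrite -!ED//; last exact: itgD.
  by apply: eq_Rintegral => w _; rewrite innerBl; ring.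
rewrite -[X in _ --> X]add0r; apply: cvgD; last exact: cvg_cst.
rewrite -[X in _ --> X]add0r; apply: cvgD.
  apply: (@le_dist_cvg _ _ (fun n => B * (Num.sqrt (E (fun w => `|(F a n).2 w - DZ a w| ^+ 2)) *
     Num.sqrt (E (fun w => `|DLX w| ^+ 2))))); last first.
    rewrite -[X in _ --> X](mulr0 B); apply: cvgMr.
    rewrite -[X in _ --> X](mul0r (Num.sqrt (E (fun w => `|DLX w| ^+ 2)))).
    exact: cvgMl.
  move=> n; rewrite subr0; have D2 := hL2B sepH (DF2 n a) (DZ2 a).
  have B0 : 0 <= B by exact: le_trans (phi'B a 0).
  apply: le_trans (ler_wpM2l B0 (E_inner_le ip sepH D2 DLX2)).
  have I4 := itg_norm (hL2_inner ip sepH D2 DLX2).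
  rewrite -EZl//; apply: le_normE_le => //; first exact: itgZl.
  by move=> w; rewrite normrM; apply: ler_wpM2r => //; exact: phi'B.
apply: (@bounded_L1_cvg _ _ _ P _ _ (B + B)) => [n|n w||].
- exact: measurable_funB.
- by apply: le_trans (ler_normB _ _) _; apply: lerD; exact: phi'B.
- apply: (@le_dist_cvg _ _ (fun n => `|L| * \sum_b
     Num.sqrt (E (fun w => ((F b n).1 w - Z b w) ^+ 2)))); last first.
    rewrite -[X in _ --> X](mulr0 `|L|); apply: cvgMr.
    exact: cvg_sum0.
  move=> n; rewrite subr0 ger0_norm ?E_ge0//.
  have I5 b : itg P (fun w => `|(F b n).1 w - Z b w|) by apply: itg_norm; exact: L2_itg.
  apply: (@le_trans _ _ (E (fun w => `|L| * \sum_b `|(F b n).1 w - Z b w|))).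
    apply: le_E => [||w].
    + apply: itg_norm; apply: (@itg_bounded _ _ _ P _ (B + B)); first exact: measurable_funB.
      by move=> w; apply: le_trans (ler_normB _ _) _; apply: lerD; exact: phi'B.
    + by apply: itgZl; exact: itg_sum.
    apply: le_trans (lipc_row_le _ _ pL) _.
    by rewrite ler_wpM2l// ler_sum// => b _; rewrite !mxE.
  rewrite EZl; last exact: itg_sum.
  by rewrite ler_wpM2l// E_sum// ler_sum// => b _; exact: L2_L1_le.
- exact: hL2_inner.
Qed.

End chain_rule.

(** * Mollification *)

Section primitive.
Context (R : realType).
Local Notation leb := (@lebesgue_measure R).

Lemma der_near (f g : R -> R) x l : (\forall y \near x, f y = g y) -> der g x l -> der f x l.
Proof.
move=> fg [dg <-]; have d1 : (1 : R) != 0 by [].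
split; first by apply: near_eq_derivable dg => //; apply: filterS fg => y.
by apply: near_eq_derive.
Qed.

(** Integrals from [- N] are glued, with [N] growing with the point; after subtracting the value at
    [0] they agree on the common range. *)
Lemma primitive_ex (u : R -> R) : continuous u -> exists U : R -> R, forall x, der U x (u x).
Proof.
move=> cu; pose F (N : nat) x := Rintegral leb `[- N%:R, x] u.
have chasles (N M : nat) t : (N <= M)%N -> `|t| <= N%:R ->
    F M t = Rintegral leb `[- M%:R, - N%:R] u + F N t.
  move=> NM tN; have tN' : - N%:R <= t by move: tN; rewrite ler_norml => /andP[].
  have MN : - M%:R <= - N%:R :> R by rewrite lerN2 ler_nat.
  have := @Rintegral_itvB _ u (BLeft (- M%:R)) (BRight t) (- N%:R) (itg_itv _ _ cu).
  rewrite !bnd_simp => /(_ MN tN').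
  rewrite Rintegral_itv_obnd_cbnd; last first.
    by apply: integrableS (itg_itv (- N%:R) t cu) => //; exact: subset_itv_oc_cc.
  by rewrite /F => <-; rewrite addrC subrK.
pose N (t : R) := (Num.truncn `|t|).+1.
have NP t : `|t| <= (N t)%:R by rewrite ltW// truncnS_gt.
exists (fun t => F (N t) t - F (N t) 0) => x.
pose M := (N x).+1.
apply: (@der_near _ (fun t => F M t - F M 0)).
  have eqF (K K' : nat) t : `|t| <= K%:R -> `|t| <= K'%:R -> F K t - F K 0 = F K' t - F K' 0.
    suff h (k k' : nat) : (k <= k')%N -> `|t| <= k%:R -> F k' t - F k' 0 = F k t - F k 0.
      by move=> tK tK'; rewrite -(h K (K + K')%N (leq_addr _ _) tK) -(h K' (K + K')%N (leq_addl _ _) tK').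
    move=> kk' tk; rewrite (chasles _ _ t kk')// (chasles _ _ 0 kk') ?normr0//.
    by rewrite opprD addrACA subrr add0r.
  near=> t; apply: eqF => //; near: t.
  have xM : 0 < M%:R - `|x| by rewrite subr_gt0 (le_lt_trans (NP x))// ltr_nat.
  have := nbhsx_ballx x _ xM; apply: filterS => t; rewrite /ball/= => /ltW h; rewrite -(subrKC x t) (le_trans (ler_normD _ _))//.
  by rewrite addrC -lerBrDr distrC.
rewrite -[u x]subr0; apply: derB; last exact: der_cst.
have Mx : - M%:R < x.
  by rewrite ltrNl (le_lt_trans (ler_norm _))// normrN (le_lt_trans (NP x))// ltr_nat.
have xx : x < x + 1 by rewrite ltrDl.
have [dF Fx] := @continuous_FTC1_closed _ u _ _ _ xx (itg_itv _ _ cu) Mx (cu x).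
by split; [exact: dF|rewrite -Fx derive1E].
Unshelve. all: by end_near. Qed.

End primitive.

Section mollifier.
Context (R : realType) (m : nat) (eps : R).
Hypothesis eps_gt0 : 0 < eps.
Implicit Types (f g z : 'rV[R]_m -> R) (i j : 'I_m) (x : 'rV[R]_m).
Local Notation e i := (delta_mx 0 i : 'rV[R]_m).

Definition lipx g := exists L, lipc L g.

(* The mean of g over the segment from x to x + eps e_i. *)
Definition avg i g x : R :=
  let U := xget (fun=> 0) [set U : R -> R | forall s, der U s (g (x + s *: e i))] in
  (U eps - U 0) / eps.

Definition dq i g x : R := (g (x + eps *: e i) - g x) / eps.

Lemma line_continuous i g x : lipx g -> continuous (fun s : R => g (x + s *: e i)).
Proof.
move=> [L gL] s; apply: (@continuous_comp _ _ _ (fun s : R => x + s *: e i) g); last exact: lipc_continuous gL _.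
by apply: cvgD; [exact: cvg_cst|exact: scalel_continuous].
Qed.

Lemma avg_primitive i g x : lipx g -> exists U : R -> R,
  (forall s, der U s (g (x + s *: e i))) /\ avg i g x = (U eps - U 0) / eps.
Proof.
move=> /(line_continuous (i := i) (x := x))/primitive_ex/(xgetPex (fun=> 0)) h.
by eexists; split; first exact: h.
Qed.

Lemma avgE i g x (U : R -> R) : lipx g -> (forall s, der U s (g (x + s *: e i))) ->
  avg i g x = (U eps - U 0) / eps.
Proof.
move=> /(avg_primitive i x)[V [dV ->]] dU; congr (_ / _).
have d s : der (fun s => V s - U s) s 0.
  by apply: der_eq (derB (dV s) (dU s)) _; rewrite subrr.
have := der_lip (L := 0) 0 eps d; rewrite mul0r => h.
have {h} : V eps - U eps - (V 0 - U 0) = 0.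
  by apply/eqP; rewrite -normr_le0 h// => z; rewrite normr0.
lra.
Qed.

Lemma lineD g x i s t : g (x + s *: e i + t *: e i) = g (x + (s + t) *: e i).
Proof. by rewrite -addrA -scalerDl. Qed.

(** The mean value theorem for a combination of three primitives. A single statement serves the
    Lipschitz estimates, with [c = 0], and the Taylor estimates, with [c] the increment. *)
Lemma avg_bound i g1 g2 g3 x y w c K : lipx g1 -> lipx g2 -> lipx g3 ->
  (forall s, `|g1 (x + s *: e i) - g2 (y + s *: e i) - c * g3 (w + s *: e i)| <= K) ->
  `|avg i g1 x - avg i g2 y - c * avg i g3 w| <= K.
Proof.
move=> /(avg_primitive i x)[U1 [d1 ->]] /(avg_primitive i y)[U2 [d2 ->]].
move=> /(avg_primitive i w)[U3 [d3 ->]] gK.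
have d s := derB (derB (d1 s) (d2 s)) (derZ c (d3 s)).
have := der_lip 0 eps d gK; rewrite subr0 (gtr0_norm eps_gt0) -ler_pdivrMr//.
apply: le_trans; rewrite -[X in _ <= _ / X](gtr0_norm eps_gt0) -normf_div.
by rewrite le_eqVlt; apply/orP; left; apply/eqP; congr `|_|; field; rewrite gt_eqF.
Qed.

Lemma avg_point i g x : lipx g -> exists s, `|s| <= eps /\ avg i g x = g (x + s *: e i).
Proof.
move=> /(avg_primitive i x)[U [dU ->]].
have [s [+ ->]] := MVTR 0 eps dU; rewrite !subr0 (gtr0_norm eps_gt0) => h.
by exists s; split=> //; rewrite mulfK// gt_eqF.
Qed.

Lemma lipx_cst c : lipx (fun=> c).
Proof. by exists 0 => x i t; rewrite subrr normr0 mul0r. Qed.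

Lemma avg_lipc i g L : lipc L g -> lipc L (avg i g).
Proof.
move=> gL x j t; have lg : lipx g by exists L.
have := @avg_bound i g g (fun=> 0) (x + t *: e j) x x 0 (L * `|t|) lg lg (lipx_cst 0).
rewrite [0 * avg _ _ _]mul0r subr0; apply => s.
by rewrite mul0r subr0 [x + t *: _ + _]addrAC; exact: gL.
Qed.

Lemma avg_qder i j g z : lipx g -> lipx z -> qder j g z -> qder j (avg i g) (avg i z).
Proof.
move=> lg lz [K gz]; exists K => x t; apply: avg_bound => // s.
by rewrite [x + t *: _ + _]addrAC; exact: gz.
Qed.

Lemma dq_lipx i g : lipx g -> lipx (dq i g).
Proof.
move=> [L gL]; exists ((L + L) / eps) => x j t; rewrite /dq -mulrBl normrM.
rewrite [X in _ * X]gtr0_norm ?invr_gt0// mulrAC ler_wpM2r ?invr_ge0 ?(ltW eps_gt0)// mulrDl.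
rewrite -addrA -opprD.
have -> : g (x + t *: e j + eps *: e i) - (g (x + t *: e j) + (g (x + eps *: e i) - g x)) =
   (g (x + eps *: e i + t *: e j) - g (x + eps *: e i)) - (g (x + t *: e j) - g x).
  by rewrite [x + t *: _ + _]addrAC; ring.
by apply: le_trans (ler_normB _ _) _; apply: lerD; exact: gL.
Qed.

Lemma dq_le i g L x : lipc L g -> `|dq i g x| <= L.
Proof.
move=> gL; rewrite /dq normrM [X in _ * X]gtr0_norm ?invr_gt0// ler_pdivrMr//.
by rewrite -[X in _ * X](gtr0_norm eps_gt0); exact: gL.
Qed.

(** By the fundamental theorem of calculus, moving a segment in its own direction changes the
    integral at a rate equal to the difference of the end values. *)
Lemma avg_qder_same i g : lipx g -> qder i (avg i g) (dq i g).
Proof.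
move=> lg; have [L' L'P] := dq_lipx i lg; exists L' => x t.
have [U [dU _]] := avg_primitive i x lg.
have aE s : avg i g (x + s *: e i) = (U (s + eps) - U s) / eps.
  rewrite (@avgE _ _ _ (fun r => U (s + r)) lg) ?addr0// => r.
  by rewrite lineD; exact: der_shift.
have dA s : der (fun s => avg i g (x + s *: e i)) s (dq i g (x + s *: e i)).
  apply: (@der_ext _ (fun s => eps^-1 * (U (s + eps) - U s))).
    by move=> r; rewrite aE mulrC.
  rewrite /dq mulrC lineD; apply: derZ; apply: derB => //.
  apply: (@der_ext _ (fun s => U (eps + s))); first by move=> r; rewrite addrC.
  by apply: der_shift; rewrite addrC.
have := @der_taylor _ _ _ L' 0 t dA; rewrite scale0r addr0 add0r; apply => y r.
by rewrite -(subrK r y) (addrC _ r) -lineD (addrC r) addrK; exact: L'P.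
Qed.

Lemma avg_dq i j g : lipx g -> avg i (dq j g) = dq j (avg i g).
Proof.
move=> lg; apply/funext => x.
have [U [dU UE]] := avg_primitive i x lg.
have [V [dV VE]] := avg_primitive i (x + eps *: e j) lg.
rewrite /dq UE VE (@avgE _ _ _ (fun s => eps^-1 * (V s - U s)) (dq_lipx j lg)).
  by field; rewrite gt_eqF.
move=> s; rewrite /dq mulrC; apply: derZ; apply: derB => //.
by rewrite addrAC; exact: dV.
Qed.

Definition mollify (s : seq 'I_m) g := foldr avg g s.

Lemma mollify_lipc s g L : lipc L g -> lipc L (mollify s g).
Proof. by move=> gL; elim: s => //= i s; exact: avg_lipc. Qed.

Lemma mollify_lipx s g : lipx g -> lipx (mollify s g).
Proof. by move=> [L gL]; exists L; exact: mollify_lipc. Qed.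

Lemma mollify_dq s i g : lipx g -> mollify s (dq i g) = dq i (mollify s g).
Proof.
by move=> lg; elim: s => //= j s ->; rewrite avg_dq//; exact: mollify_lipx.
Qed.

(** Differentiation in the direction [i] consumes one average in that direction; the remaining
    averages commute with difference quotients. *)
Lemma mollify_qder s i g : lipx g -> i \in s ->
  qder i (mollify s g) (mollify (rem i s) (dq i g)).
Proof.
move=> lg; elim: s => //= j s ih; rewrite inE => /orP[/eqP ->|si].
  rewrite eqxx mollify_dq//; apply: avg_qder_same; exact: mollify_lipx.
case: eqP => [->|_].
  rewrite mollify_dq//; apply: avg_qder_same; exact: mollify_lipx.
apply: avg_qder; last exact: ih.
  exact: mollify_lipx.
by apply: mollify_lipx; exact: dq_lipx.
Qed.

(** Each mean over a segment is attained at one of its points, so bounds and limits of [g] carry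
    over. *)
Lemma mollify_point s g x : lipx g ->
  exists v : 'rV[R]_m, (forall a, `|v 0 a| <= (size s)%:R * eps) /\ mollify s g x = g (x + v).
Proof.
move=> lg; elim: s x => [|i s ih] x /=.
  by exists 0; split=> [a|]; rewrite ?mxE ?normr0 ?mul0r// addr0.
have [t [te ->]] := avg_point i x (mollify_lipx s lg).
have [v [vs ->]] := ih (x + t *: e i); exists (t *: e i + v); split; last by rewrite addrA.
move=> a; rewrite mxE -natr1 mulrDl mul1r addrC.
apply: le_trans (ler_normD _ _) (lerD (vs a) _).
rewrite !mxE eqxx/= normrM; case: (a == i); rewrite ?normr1 ?mulr1// normr0 mulr0.
exact: ltW.
Qed.

Lemma mollify_le s g M x : lipx g -> (forall y, `|g y| <= M) -> `|mollify s g x| <= M.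
Proof. by move=> lg gM; have [v [_ ->]] := mollify_point s x lg. Qed.

End mollifier.

(** * Abstract Stein bound *)

Section stein_bound.
Context (R : realType) (H : completeNormedModType R) (ip : inner_product H).
Context d (T : measurableType d) (P : probability T R) (W : H -> {RV P >-> R}).
Hypotheses (isoW : isonormal ip W) (sepH : separable H).
Local Notation E f := (Rintegral P setT f).
Variables (X LX : {RV P >-> R}) (DLX : T -> H) (n : nat).
Variables (Z : 'I_n.+1 -> {RV P >-> R}) (DZ : 'I_n.+1 -> T -> H).
Hypotheses (X2 : L2 P X) (EX : ('E_P[X] = 0)%E) (XLX : pinv_OU ip W X LX)
  (DLXP : malliavin ip W 2 LX DLX) (DZP : forall a, malliavin ip W 2 (Z a) (DZ a))
  (XZ : forall w, X w = Z ord0 w).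
Local Notation e i := (delta_mx 0 i : 'rV[R]_n.+1).

Variables (nu L : R) (f f0 ht : 'rV[R]_n.+1 -> R).
Hypotheses (fL : lipc L f)
  (df : forall (x : 'rV[R]_n.+1) s, der (fun s => f (x + s *: e ord0)) s (f0 (x + s *: e ord0)))
  (cf0 : forall x : 'rV[R]_n.+1, x 0 ord0 + nu != 0 -> {for x, continuous f0})
  (stein : forall x : 'rV[R]_n.+1, 2 * (x 0 ord0 + nu) * f0 x - x 0 ord0 * f x = ht x).

(* Averaging twice in every direction makes the partial derivatives Lipschitz. *)
Let s : seq 'I_n.+1 := enum 'I_n.+1 ++ enum 'I_n.+1.
Let eps (k : nat) : R := k.+1%:R^-1.
Let phi k := mollify (eps k) s f.
Let phi' k a := mollify (eps k) (rem a s) (dq (eps k) a f).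

Let eps_gt0 k : 0 < eps k. Proof. by rewrite invr_gt0. Qed.
Let lf : lipx f. Proof. by exists L. Qed.
Let L0 : 0 <= L. Proof. exact: lipc_ge0 ord0 fL. Qed.

Let phi'_le k a x : `|phi' k a x| <= L.
Proof.
apply: mollify_le => //; first exact: dq_lipx.
by move=> y; exact: dq_le.
Qed.

Let Z2 a : L2 P (Z a).
Proof. by have [] := malliavin_approx sepH (DZP a). Qed.
Let DLX2 : hL2 P DLX.
Proof. by have [] := malliavin_approx sepH DLXP. Qed.
Let DZ2 a : hL2 P (DZ a).
Proof. by have [] := malliavin_approx sepH (DZP a). Qed.

Local Notation row w := (\row_b Z b w).
Local Notation G a w := (ip (DLX w) (DZ a w)).

Let IG a : itg P (fun w => G a w).
Proof. exact: hL2_inner. Qed.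

Let mphi' k a : measurable_fun setT (fun w => phi' k a (row w)).
Proof.
have [L' pL] := mollify_lipx (eps_gt0 k) (rem a s) (dq_lipx (eps_gt0 k) a lf).
by apply: row_measurable pL _ => b; exact: (Z2 b).1.
Qed.

Let phiL k : lipc L (phi k).
Proof. exact: mollify_lipc. Qed.

(** The chain rule rewrites the expectation of [X * phi k], and the term of the head coordinate
    joins the factor [2 * (X + nu)]. *)
Lemma stein_mollified k :
  E (fun w => 2 * (X w + nu) * phi' k ord0 (row w) - X w * phi k (row w)) =
  E (fun w => (2 * (X w + nu) - G ord0 w) * phi' k ord0 (row w)) -
  \sum_(j < n) E (fun w => phi' k (lift ord0 j) (row w) * G (lift ord0 j) w).
Proof.
have ems a : a \in s by rewrite mem_cat mem_enum.
(* Each direction occurs twice in [s], so it survives the removal of one entry and [phi' k a] can be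
   differentiated again. *)
have ems2 a b : b \in rem a s.
  rewrite -has_pred1 has_count count_rem count_cat !count_uniq_mem ?enum_uniq// !mem_enum.
  by case: (_ && _).
have I1 a : itg P (fun w => phi' k a (row w) * G a w).
  by apply: (@itgMb _ _ _ P _ _ L) => // w; exact: phi'_le.
have I2 : itg P (fun w => X w * phi k (row w)) by apply: L2M => //; exact: L2_row (phiL k) Z2.
have I3 : itg P (fun w => 2 * (X w + nu) * phi' k ord0 (row w)).
  apply: itg_ext (itgMb (mphi' k ord0) (fun w => phi'_le k ord0 (row w))
    (itgZl 2 (itgD (L2_itg X2) (itg_cst P nu)))) => w; exact: mulrC.
rewrite EB//.
have <- : E (fun w => \sum_a phi' k a (row w) * ip (DZ a w) (DLX w)) =
    E (fun w => X w * phi k (row w)).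
  apply: (@chain_rule _ _ _ _ _ _ _ isoW sepH _ _ _ X2 EX XLX DLXP _ _ _ DZP (phi k) (phi' k)
    (fun a b => mollify (eps k) (rem b (rem a s)) (dq (eps k) b (dq (eps k) a f))) L).
  - by exists L.
  - by move=> a; exact: mollify_qder.
  - by move=> a; apply: mollify_lipx => //; exact: dq_lipx.
  - by move=> a b; apply: mollify_qder => //; exact: dq_lipx.
  - by move=> a b; apply: mollify_lipx => //; do 2 apply: dq_lipx => //.
  - by move=> a x; exact: phi'_le.
rewrite [E (fun w => \sum_a _)](_ : _ = E (fun w => \sum_a phi' k a (row w) * G a w)); last first.
  by apply: eq_Rintegral => w _; apply: eq_bigr => a _; rewrite innerC.
rewrite E_sum// big_ord_recl opprD addrA; congr (_ - _).
rewrite -EB//; apply: eq_Rintegral => w _; ring.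
Qed.

Lemma stein_mollified_le k :
  `|E (fun w => 2 * (X w + nu) * phi' k ord0 (row w) - X w * phi k (row w))| <=
  L * E (fun w => `|2 * (X w + nu) - G ord0 w|) +
  L * \sum_(j < n) E (fun w => `|G (lift ord0 j) w|).
Proof.
rewrite stein_mollified; apply: le_trans (ler_normB _ _) _; apply: lerD.
  have I : itg P (fun w => 2 * (X w + nu) - G ord0 w).
    by apply: itgB => //; apply: itgZl; apply: itgD; [exact: L2_itg|exact: itg_cst].
  rewrite -EZl; last exact: itg_norm.
  apply: le_normE_le => [||w].
  - apply: itg_ext (itgMb (mphi' k ord0) (fun w => phi'_le k ord0 (row w)) I) => w; exact: mulrC.
  - by apply: itgZl; exact: itg_norm.
  - by rewrite normrM mulrC ler_wpM2r.
apply: le_trans (ler_norm_sum _ _ _) _; rewrite mulr_sumr; apply: ler_sum => j _.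
rewrite -EZl; last exact: itg_norm.
apply: le_normE_le => [||w].
- exact: (itgMb (mphi' k _) (fun w => phi'_le k _ (row w))).
- by apply: itgZl; exact: itg_norm.
- by rewrite normrM ler_wpM2r.
Qed.

Let eps_cvg0 c : c * eps k @[k --> \oo] --> 0.
Proof. by rewrite -[X in _ --> X](mulr0 c); apply: cvgMr; exact: cvg_harmonic. Qed.

Let phi_dist k x : `|phi k x - f x| <= `|L| * (n.+1%:R * (size s)%:R * eps k).
Proof.
rewrite /phi; have [v [vs ->]] := mollify_point (eps_gt0 k) s x lf.
apply: le_trans (lipc_row_le _ _ fL) _; rewrite ler_wpM2l//.
apply: (@le_trans _ _ (\sum_(a < n.+1) ((size s)%:R * eps k))).
  by apply: ler_sum => a _; rewrite [(x + v) 0 a]mxE addrAC subrr add0r.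
by rewrite sumr_const card_ord -mulrA [leRHS]mulr_natl.
Qed.

Let phi_cvg x : phi k x @[k --> \oo] --> f x.
Proof.
apply: (le_dist_cvg (fun k => phi_dist k x)).
by rewrite -[X in _ --> X](mulr0 `|L|); apply: cvgMr.
Qed.

(** Means and difference quotients are both attained at nearby points, so [phi' k ord0 x] is a value
    of [f0] within a distance of order [eps k] of [x]. *)
Let phi'_cvg (x : 'rV[R]_n.+1) : x 0 ord0 + nu != 0 -> phi' k ord0 x @[k --> \oo] --> f0 x.
Proof.
move=> x0.
have /choice[v vP] : forall k, exists v : 'rV[R]_n.+1,
    (forall a, `|v 0 a| <= ((size s)%:R + 1) * eps k) /\ phi' k ord0 x = f0 (x + v).
  move=> k; have [v [vs vE]] := mollify_point (eps_gt0 k) (rem ord0 s) x (dq_lipx (eps_gt0 k) ord0 lf).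
  have [t [+ ft]] := MVTR 0 (eps k) (df (x + v)).
  rewrite !subr0 (gtr0_norm (eps_gt0 k)) => te.
  exists (v + t *: e ord0); split=> [a|].
    rewrite mxE mulrDl mul1r; apply: le_trans (ler_normD _ _) (lerD _ _).
      apply: le_trans (vs a) _; rewrite ler_wpM2r ?(ltW (eps_gt0 k))// ler_nat size_rem ?leq_pred//.
      by rewrite mem_cat mem_enum.
    rewrite !mxE eqxx /= normrM; case: (a == ord0); rewrite /= ?mulr1n ?mulr0n ?normr1 ?mulr1// normr0 mulr0.
    exact: ltW.
  rewrite /phi' vE /dq addrA -{}[LHS]/((f (x + v + eps k *: e ord0) - f (x + v)) / eps k).
  have -> : f (x + v) = f (x + v + 0 *: e ord0) by rewrite scale0r addr0.
  by rewrite ft subr0 mulfK// gt_eqF.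
have := cf0 x0; rewrite /continuous_at => cf.
have -> : (fun k => phi' k ord0 x) = (fun k => f0 (x + v k)).
  by apply/funext => k; case: (vP k).
apply: (cvg_comp (fun k => x + v k) f0 _ cf).
apply/cvg_ballP => r r0.
have := eps_cvg0 ((size s)%:R + 1) => /cvgrPdist_lt/(_ r r0); apply: filterS => k.
rewrite sub0r normrN => hk; split=> // i j; rewrite /ball/= mxE opprD addrA subrr sub0r normrN ord1.
by apply: le_lt_trans hk; apply: le_trans (ler_norm _); case: (vP k).
Qed.

(** The bound of [stein_mollified_le] is the same for every [k], and dominated convergence removes
    the mollification. *)
Lemma stein_bound : itg P (fun w => ht (row w)) /\
  `|E (fun w => ht (row w))| <=
  L * E (fun w => `|2 * (X w + nu) - G ord0 w|) +
  L * \sum_(j < n) E (fun w => `|G (lift ord0 j) w|).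
Proof.
pose S : R := (n.+1%:R * (size s)%:R).
have dom : itg P (fun w => L * `|2 * (X w + nu)| + (`|X w * f (row w)| + `|L| * S * `|X w|)).
  apply: itgD; first by apply: itgZl; apply: itg_norm; apply: itgZl; apply: itgD;
    [exact: L2_itg|exact: itg_cst].
  apply: itgD; first by apply: itg_norm; apply: L2M => //; exact: L2_row fL Z2.
  by apply: itgZl; apply: itg_norm; exact: L2_itg.
have mrow g L' : lipc L' g -> measurable_fun setT (fun w => g (row w)).
  by move=> gL; apply: row_measurable gL _ => b; exact: (Z2 b).1.
have Xm := measurable_funPT X.
have [k|w|k w|I c] := @E_dominated _ _ _ P
  (fun k w => 2 * (X w + nu) * phi' k ord0 (row w) - X w * phi k (row w))
  (fun w => ht (row w)) _ _ dom.
- apply: measurable_funB; last by apply: measurable_funM => //; exact: mrow (phiL k).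
  by apply: measurable_funM => //; apply: measurable_funM => //; exact: measurable_funD.
- rewrite -stein mxE -XZ; apply: cvgB; last by apply: cvgMr; exact: phi_cvg.
  (* At [x = - nu] the coefficient of [phi' k] vanishes for every [k], so the product converges
     whatever [phi' k] does. *)
  have [->|u0] := eqVneq (X w + nu) 0.
    rewrite mulr0 mul0r; under eq_fun do rewrite mul0r; exact: cvg_cst.
  by apply: cvgMr; apply: phi'_cvg; rewrite mxE -XZ.
- apply: le_trans (ler_normB _ _) _; rewrite normrM mulrC; apply: lerD; first by rewrite ler_wpM2r.
  rewrite !normrM [X in _ + X]mulrC -mulrDr ler_wpM2l//.
  rewrite -[X in `|X|](subrK (f (row w))) addrC; apply: le_trans (ler_normD _ _) _.
  rewrite lerD2l; apply: le_trans (phi_dist _ _) _; rewrite ler_wpM2l//.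
  by rewrite /S ler_piMr ?mulr_ge0// invf_le1 ?ler1n.
split=> //.
pose B := L * E (fun w => `|2 * (X w + nu) - G ord0 w|) +
  L * \sum_(j < n) E (fun w => `|G (lift ord0 j) w|).
have cB : B @[k --> \oo] --> B by exact: cvg_cst.
apply: (ler_cvg_to (cvg_norm c) cB); apply: nearW => k; exact: stein_mollified_le.
Qed.

End stein_bound.

(** * The Gamma law *)

Section local_calculus.
Context (R : realType).
Local Notation leb := (@lebesgue_measure R).
Implicit Types f g : R -> R.

Lemma FTC_on f (f' : R -> R) a b : a <= b ->
  (forall z, a <= z <= b -> der f z (f' z)) ->
  (forall z, a <= z <= b -> {for z, continuous f'}) ->
  leb.-integrable `[a, b] (EFin \o f') /\ Rintegral leb `[a, b] f' = f b - f a.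
Proof.
move=> ab ff' cf'.
have c' : {within `[a, b], continuous f'}.
  by apply: continuous_in_subspaceT => x; rewrite inE/= in_itv/= => /cf'.
split; first by apply: continuous_compact_integrable => //; exact: segment_compact.
move: ab; rewrite le_eqVlt => /predU1P[ab|ab]; first by rewrite ab set_itv1 Rintegral_set1 subrr.
have cf x : a <= x <= b -> {for x, continuous f} by move=> /ff'; exact: der_continuous.
rewrite /Rintegral (@continuous_FTC2 _ f' f)//.
- split.
  + by move=> x; rewrite in_itv/= => /andP[ax xb]; case: (ff' x); rewrite ?(ltW ax) ?(ltW xb).
  + by apply: cvg_at_right_filter; apply: cf; rewrite lexx ltW.
  + by apply: cvg_at_left_filter; apply: cf; rewrite lexx ltW.
- move=> x; rewrite in_itv/= => /andP[ax xb]; rewrite derive1E.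
  by case: (ff' x); rewrite ?(ltW ax) ?(ltW xb).
Qed.

Variables (D : nat -> set R) (U : set R).
Hypotheses (mD : forall n, measurable (D n)) (mU : measurable U)
  (DU : forall n, D n `<=` U) (UD : forall x, U x -> \forall n \near \oo, D n x)
  (ndD : forall n m, (n <= m)%N -> D n `<=` D m).

Lemma indic_cvg f x : \1_(D n) x * f x @[n --> \oo] --> \1_U x * f x.
Proof.
apply: cvg_near_cst; have [Ux|nUx] := pselect (U x).
  by apply: filterS (UD Ux) => n Dx; rewrite !indicE !mem_set.
by apply: nearW => n; rewrite !indicE !memNset// => /DU.
Qed.

Lemma measurable_indicM (V : set R) f : measurable V -> measurable_fun setT f ->
  measurable_fun setT (fun x => \1_V x * f x).
Proof. by move=> mV mf; apply: measurable_funM => //; exact: measurable_indic. Qed.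

Lemma itg_indic (V : set R) f : measurable V -> measurable_fun setT f ->
  itg leb (fun x => \1_V x * f x) <-> leb.-integrable V (EFin \o f).
Proof.
move=> mV mf; rewrite /itg.
rewrite (_ : EFin \o (fun x => \1_V x * f x) = (EFin \o f) \_ V); last first.
  by apply/funext => x /=; rewrite patchE indicE; case: ifPn; rewrite ?mul1r ?mul0r.
by rewrite -integrable_mkcond.
Qed.

Lemma cover_cvg f : measurable_fun setT f -> itg leb (fun x => \1_U x * f x) ->
  Rintegral leb (D n) f @[n --> \oo] --> Rintegral leb setT (fun x => \1_U x * f x).
Proof.
move=> mf If; under eq_fun do rewrite (Rintegral_itv_indic _ (mD _)).
have := @E_dominated _ _ _ leb (fun n x => \1_(D n) x * f x) (fun x => \1_U x * f x)
  (fun x => `|\1_U x * f x|) (fun n => measurable_indicM (mD n) mf) (itg_norm If)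
  (fun x => indic_cvg (f := f) (x := x)) _.
case=> // n x; rewrite !normrM ler_wpM2r// !indicE.
case: (boolP (x \in D n)) => [|_]; last by rewrite normr0.
by rewrite inE => /DU Ux; rewrite mem_set.
Qed.

(** Improper integrability by monotone convergence along the exhaustion [D]. *)
Lemma cover_itg f M : measurable_fun setT f -> (forall x, U x -> 0 <= f x) ->
  (forall n, leb.-integrable (D n) (EFin \o f)) ->
  (forall n, Rintegral leb (D n) f <= M) -> itg leb (fun x => \1_U x * f x).
Proof.
move=> mf f0 ID DM; have mDf n := measurable_indicM (mD n) mf.
have Uf0 x : 0 <= \1_U x * f x.
  rewrite indicE; case: (boolP (x \in U)); rewrite ?mul0r// inE mul1r; exact: f0.
have Df0 n x : 0 <= \1_(D n) x * f x.
  rewrite indicE; case: (boolP (x \in D n)); rewrite ?mul0r// inE mul1r => /DU; exact: f0.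
have mono x n m : (n <= m)%N -> \1_(D n) x * f x <= \1_(D m) x * f x.
  move=> nm; have [Dx|nDx] := pselect (D n x); last first.
    by rewrite indicE memNset// mul0r.
  by rewrite !indicE !mem_set//; exact: ndD nm _ Dx.
apply: itg_ge0 => //; first exact: measurable_indicM.
have -> : (\int[leb]_x (\1_U x * f x)%:E = \int[leb]_x limn (fun n => (\1_(D n) x * f x)%:E))%E.
  apply: eq_integral => x _; apply/esym/cvg_lim => //.
  by apply: cvg_EFin; [exact: nearW|exact: indic_cvg].
rewrite monotone_convergence//.
- apply: (@le_lt_trans _ _ M%:E); last exact: ltry.
  apply: lime_le.
    apply: ereal_nondecreasing_is_cvgn => n m nm; apply: ge0_le_integral => //.
    + by move=> x _; rewrite lee_fin.
    + by apply/measurable_EFinP; exact: mDf.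
    + by apply/measurable_EFinP; exact: mDf.
    + by move=> x _; rewrite lee_fin mono.
  apply: nearW => n.
  have I : itg leb (fun x => \1_(D n) x * f x) by exact/itg_indic.
  rewrite [X in (X <= _)%E](_ : _ = (Rintegral leb setT (fun x => \1_(D n) x * f x))%:E).
    by rewrite lee_fin -Rintegral_itv_indic.
  exact: E_EFin I.
- by move=> n; apply/measurable_EFinP; exact: mDf.
- by move=> n x _; rewrite lee_fin.
- by move=> x _ n m nm; rewrite lee_fin mono.
Qed.

End local_calculus.

Lemma indic_itvE (R : realType) (i : interval R) (x : R) : \1_[set` i] x = (x \in i)%:R :> R.
Proof. by rewrite indicE; congr (_%:R); congr nat_of_bool; apply/idP/idP; rewrite inE. Qed.

Section gamma_weight.
Context (R : realType) (a c s : R).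
Hypotheses (a_gt0 : 0 < a) (c_gt0 : 0 < c).
Local Notation leb := (@lebesgue_measure R).

Definition wt x : R := (x + s) `^ (a - 1) * expR (- (c * (x + s))).
(** On [x > - s] this is [(x + s) * wt x], and its derivative is [wt x] times an affine function
    that changes sign at [a / c - s]. Integrability and positivity of the weight are read off from
    it. *)
Definition pt x : R := (x + s) `^ a * expR (- (c * (x + s))).

Lemma wt_ge0 x : 0 <= wt x. Proof. by rewrite mulr_ge0 ?powR_ge0 ?expR_ge0. Qed.
Lemma pt_ge0 x : 0 <= pt x. Proof. by rewrite mulr_ge0 ?powR_ge0 ?expR_ge0. Qed.

Lemma ptE x : 0 < x + s -> pt x = (x + s) * wt x.
Proof. by move=> x0; rewrite /wt mulrA mulr_powRB1// ltW. Qed.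

Lemma der_exp_shift x : der (fun y => expR (- (c * (y + s)))) x (- c * expR (- (c * (x + s)))).
Proof.
have h : der (fun y => - (c * (y + s))) x (- c).
  by apply: der_eq (derN (derZ c (derD (der_id x) (der_cst s x)))) _; rewrite addr0 mulr1.
by apply: der_eq (der_comp (is_derive_expR _) h) _; rewrite mulrC.
Qed.

Lemma der_powR_shift b x : 0 < x + s -> der (fun y => (y + s) `^ b) x (b * (x + s) `^ (b - 1)).
Proof.
move=> x0; have h : der (fun y => y + s) x 1.
  by apply: der_eq (derD (der_id x) (der_cst s x)) _; rewrite addr0.
by apply: der_eq (@der_comp _ (fun y => y `^ b) (fun y => y + s) x _ _ (is_derive1_powR b x0) h) _; rewrite mulr1.
Qed.

Lemma der_pt x : 0 < x + s -> der pt x (wt x * (a - c * (x + s))).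
Proof.
move=> x0; apply: der_eq (derM (der_powR_shift a x0) (der_exp_shift x)) _.
by rewrite -(mulr_powRB1 (ltW x0) a_gt0) /wt; ring.
Qed.

Lemma continuous_wt x : 0 < x + s -> {for x, continuous wt}.
Proof.
by move=> x0; exact: der_continuous (derM (der_powR_shift (a - 1) x0) (der_exp_shift x)).
Qed.

Lemma measurable_wt : measurable_fun setT wt.
Proof.
apply: measurable_funM.
  by apply: (measurableT_comp (measurable_powR _)); exact: measurable_funD.
apply: measurableT_comp => //; apply: measurableT_comp => //.
by apply: measurable_funM => //; exact: measurable_funD.
Qed.

Let U : set R := `]- s, +oo[%classic.
Let mU : measurable U. Proof. exact: measurable_itv. Qed.
Let z0 := a / c - s.

Let z0s : z0 + s = a / c. Proof. by rewrite subrK. Qed.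
Let ac0 : 0 < a / c. Proof. exact: divr_gt0. Qed.

Let v x := wt x * (a - c * (x + s)).

Let mv : measurable_fun setT v.
Proof.
apply: measurable_funM; first exact: measurable_wt.
by apply: measurable_funB => //; apply: measurable_funM => //; exact: measurable_funD.
Qed.

Lemma pt_FTC x y : x <= y -> 0 < x + s ->
  leb.-integrable `[x, y] (EFin \o (fun z => wt z * (a - c * (z + s)))) /\
  Rintegral leb `[x, y] (fun z => wt z * (a - c * (z + s))) = pt y - pt x.
Proof.
move=> xy x0; have pos z : x <= z -> 0 < z + s.
  by move=> xz; rewrite (lt_le_trans x0)// lerD2r.
apply: FTC_on => // z /andP[/pos zs _]; first exact: der_pt.
apply: cvgM; first exact: continuous_wt.
apply: cvgB; first exact: cvg_cst.
by apply: cvgMr; apply: cvgD; [exact: cvg_id|exact: cvg_cst].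
Qed.

Let d n : R := (a / c) / n.+1%:R - s.
Let d_s n : 0 < d n + s. Proof. by rewrite subrK divr_gt0. Qed.
Let d_z n : d n <= z0.
Proof. by rewrite lerD2r ler_pdivrMr// ler_peMr ?(ltW ac0)// ler1n. Qed.

(** Left of [z0] the function [v] is nonnegative, and its integrals over compact pieces are
    increments of [pt], bounded by [pt z0]. On the right the same holds for [- v]. *)
Let itg_left : itg leb (fun x => \1_(`]- s, z0]%classic) x * v x).
Proof.
apply: (@cover_itg _ (fun n => `[d n, z0]%classic) _ _ _ _ _ _ v (pt z0)) => //.
- move=> n x /=; rewrite !in_itv/= => /andP[dx ->]; rewrite andbT.
  by rewrite (lt_le_trans _ dx)// -subr_gt0 opprK.
- move=> x /=; rewrite in_itv/= => /andP[sx xz].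
  have xs : 0 < x + s by rewrite -subr_gt0 opprK in sx.
  near=> n; rewrite /= in_itv/= xz andbT lerBlDr ler_pdivrMr// -ler_pdivrMl//.
  apply: (@le_trans _ _ n%:R); last by rewrite ler_nat.
  near: n; exact: nbhs_infty_ger.
- move=> n m nm x /=; rewrite !in_itv/= => /andP[dx ->]; rewrite andbT (le_trans _ dx)//.
  by rewrite lerD2r ler_wpM2l ?(ltW ac0)// lef_pV2 ?posrE// ler_nat ltnS.
- move=> x /=; rewrite in_itv/= => /andP[sx xz]; rewrite mulr_ge0 ?wt_ge0// subr_ge0.
  by rewrite mulrC -ler_pdivlMr// -lerBrDr.
- by move=> n; have [] := pt_FTC (d_z n) (d_s n).
- by move=> n; have [_ ->] := pt_FTC (d_z n) (d_s n); rewrite lerBlDr lerDl pt_ge0.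
Unshelve. all: by end_near. Qed.

Let itg_right : itg leb (fun x => \1_(`[z0, +oo[%classic) x * (- v x)).
Proof.
have zn n : z0 <= z0 + n%:R by rewrite lerDl.
have zp : 0 < z0 + s by rewrite z0s.
have mNv : measurable_fun setT (fun x => - v x) by exact: measurable_funN.
have FTCn n := pt_FTC (zn n) zp.
apply: (@cover_itg _ (fun n => `[z0, z0 + n%:R]%classic) _ _ _ _ _ _ (fun x => - v x) (pt z0)) => //.
- by move=> n x /=; rewrite !in_itv/= andbT => /andP[].
- move=> x /=; rewrite in_itv/= andbT => zx.
  near=> n; rewrite /= in_itv/= zx/= addrC -lerBlDr.
  near: n; exact: nbhs_infty_ger.
- move=> n m nm x /=; rewrite !in_itv/= => /andP[->] /= xz; rewrite (le_trans xz)//.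
  by rewrite lerD2l ler_nat.
- move=> x /=; rewrite in_itv/= andbT => zx; rewrite -mulrN mulr_ge0 ?wt_ge0// opprB subr_ge0.
  by rewrite mulrC -ler_pdivrMr// -lerBlDr.
- by move=> n; have [I _] := FTCn n; have := integrableN I.
- move=> n; have [I e] := FTCn n.
  rewrite (_ : Rintegral leb _ _ = - Rintegral leb `[z0, z0 + n%:R] v); last first.
    have -> : Rintegral leb `[z0, z0 + n%:R] (fun x => - v x) =
        Rintegral leb `[z0, z0 + n%:R] (fun x => -1 * v x).
      by apply: eq_Rintegral => x _; rewrite mulN1r.
    by rewrite RintegralZl// mulN1r.
  by rewrite e opprB lerBlDr lerDl pt_ge0.
Unshelve. all: by end_near. Qed.

Lemma itg_wt_abs : itg leb (fun x => \1_U x * (wt x * `|a - c * (x + s)|)).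
Proof.
have := itgD itg_left itg_right; apply: itg_ext => x.
rewrite !indic_itvE !in_itv/= !andbT.
have ux : (0 <= a - c * (x + s)) = (x <= z0).
  by rewrite subr_ge0 mulrC -ler_pdivlMr// -lerBrDr.
have [xz|zx|zx] := ltrgtP x z0.
- rewrite mul0r addr0 andbT ger0_norm// ux; exact: ltW.
- rewrite andbF mul0r add0r mul1r ltr0_norm ?ltNge ?ux -?ltNge// mulrN.
  by rewrite (lt_trans _ zx) ?mul1r// -subr_gt0 opprK z0s.
- have e0 : a - c * (x + s) = 0 by rewrite zx z0s; field; rewrite gt_eqF.
  by rewrite /v e0 normr0 !mulr0 oppr0 !mulr0 addr0.
Qed.

(** Outside [z1 <= x <= z2] the factor [|a - c * (x + s)|] is at least [a / 2] and [itg_wt_abs]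
    dominates; inside, the weight is continuous on a compact interval. *)
Lemma itg_wt : itg leb (fun x => \1_U x * wt x).
Proof.
pose z1 := a / (2 * c) - s; pose z2 := 3 * a / (2 * c) - s.
have c2 : 0 < 2 * c by rewrite mulr_gt0.
have z1s : 0 < z1 + s by rewrite subrK divr_gt0.
have I : itg leb (fun x => \1_(`[z1, z2]%classic) x * wt x).
  apply/itg_indic => //; first exact: measurable_wt.
  apply: continuous_compact_integrable; first exact: segment_compact.
  apply: continuous_in_subspaceT => x; rewrite inE/= in_itv/= => /andP[z1x _].
  by apply: continuous_wt; rewrite (lt_le_trans z1s)// lerD2r.
have mw : measurable_fun setT wt := measurable_wt.
apply: (le_itg _ (itgD (itgZl (2 / a) itg_wt_abs) I)) => [|x].
  exact: (measurable_indicM mU mw).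
have w0 := wt_ge0 x.
rewrite !indic_itvE !in_itv/= andbT ger0_norm; last by rewrite mulr_ge0 ?ler0n.
case: ltP => sx; rewrite ?mul1r ?mul0r; last first.
  by rewrite mulr0 add0r mulr_ge0 ?ler0n.
have [h|h] := leP (a / 2) `|a - c * (x + s)|.
  apply: (@le_trans _ _ (2 / a * (wt x * `|a - c * (x + s)|))); last first.
    by rewrite lerDl mulr_ge0 ?ler0n.
  rewrite mulrCA ler_peMr// mulrC -ler_pdivrMr; last by rewrite divr_gt0.
  by rewrite mul1r invf_div.
rewrite (_ : z1 <= x <= z2) ?mul1r.
  by rewrite lerDr mulr_ge0// ?divr_ge0 ?(ltW a_gt0)// mulr_ge0.
move: h; rewrite ltr_norml => /andP[h1 h2].
rewrite /z1 /z2 lerBlDr lerBrDr ler_pdivrMr// ler_pdivlMr// !(mulrCA (x + s)) (mulrC (x + s)).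
by move: (c * (x + s)) h1 h2 => q h1 h2; apply/andP; split; lra.
Qed.

Lemma itg_wt1 : itg leb (fun x => \1_U x * (wt x * (x + s))).
Proof.
have mw : measurable_fun setT wt := measurable_wt.
apply: (le_itg _ (itgZl c^-1 (itgD itg_wt_abs (itgZl a itg_wt)))) => [|x].
  apply: (measurable_indicM mU); apply: (measurable_funM mw); exact: measurable_funD.
have w0 := wt_ge0 x; rewrite indic_itvE in_itv/= andbT.
case: ltP => sx; rewrite ?mul1r ?mul0r ?normr0; last by rewrite mulr0 addr0 mulr0.
have xs : 0 < x + s by rewrite -subr_gt0 opprK in sx.
rewrite ger0_norm; last by rewrite mulr_ge0 ?(ltW xs).
rewrite ler_pdivlMl// (mulrC a) -mulrDr mulrCA ler_wpM2l//.
by rewrite -lerBlDr -normrN opprB ler_norm.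
Qed.

Lemma pt_cvg0 : pt (n.+1%:R^-1 - s) @[n --> \oo] --> 0.
Proof.
rewrite /pt; under eq_fun do rewrite subrK.
apply: (@le_dist_cvg _ _ (fun n => (n.+1%:R^-1 : R) `^ a)) => [n|].
  rewrite subr0 ger0_norm ?mulr_ge0 ?powR_ge0 ?expR_ge0// ler_piMr ?powR_ge0//.
  by rewrite expR_le1 oppr_le0 mulr_ge0 ?(ltW c_gt0)// invr_ge0.
have /cvg_at_rightP h := powR_cvg0 a_gt0.
by apply: (h (fun n => n.+1%:R^-1)); split=> [n|]; [rewrite invr_gt0|exact: cvg_harmonic].
Qed.

(** [pt z0] is positive and is the limit of integrals of [v] up to [z0], where [v <= a * wt]. *)
Lemma wt_mass_gt0 : 0 < Rintegral leb setT (fun x => \1_U x * wt x).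
Proof.
have pz : 0 < pt z0 by rewrite /pt z0s mulr_gt0 ?expR_gt0// powR_gt0.
suff : pt z0 <= a * Rintegral leb setT (fun x => \1_U x * wt x).
  by move=> /(lt_le_trans pz); rewrite pmulr_rgt0.
pose dn n : R := n.+1%:R^-1 - s.
have cc : pt z0 - pt (dn n) @[n --> \oo] --> pt z0.
  rewrite -[X in _ --> X]subr0; apply: cvgB; [exact: cvg_cst|exact: pt_cvg0].
have ca : a * Rintegral leb setT (fun x => \1_U x * wt x) @[n --> \oo] -->
   a * Rintegral leb setT (fun x => \1_U x * wt x) by exact: cvg_cst.
apply: (ler_cvg_to cc ca); near=> n.
have dz : dn n <= z0.
  rewrite lerBlDr z0s -[leRHS]invrK lef_pV2 ?posrE ?invr_gt0//.
  apply: (@le_trans _ _ n%:R); last by rewrite ler_nat.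
  near: n; exact: nbhs_infty_ger.
have ds : 0 < dn n + s by rewrite subrK invr_gt0.
have [I <-] := pt_FTC dz ds; rewrite (Rintegral_itv_indic _ (measurable_itv _)).
rewrite -EZl; last exact: itg_wt.
apply: le_E => [||x].
- apply/itg_indic => //; exact: mv.
- by apply: itgZl; exact: itg_wt.
rewrite !indic_itvE !in_itv/= andbT; have w0 := wt_ge0 x.
case: (boolP (dn n <= x <= z0)) => [/andP[dx _]|_]; last first.
  by rewrite mul0r mulr_ge0 ?(ltW a_gt0)// mulr_ge0.
have xs : 0 < x + s by rewrite (lt_le_trans ds)// lerD2r.
rewrite (_ : - s < x); last by rewrite -subr_gt0 opprK.
rewrite !mul1r mulrC ler_wpM2r// lerBlDr lerDl mulr_ge0// ltW//.
Unshelve. all: by end_near. Qed.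

End gamma_weight.

Section gamma_law.
Context (R : realType) (nu : R).
Hypothesis nu_gt0 : 0 < nu.
Local Notation leb := (@lebesgue_measure R).
Let a := nu / 2.
Let a_gt0 : 0 < a. Proof. by rewrite divr_gt0. Qed.
Let half_gt0 : 0 < 2^-1 :> R. Proof. by rewrite invr_gt0. Qed.

Local Notation U := (`]- nu, +oo[%classic : set R).
Local Notation w := (wt a 2^-1 nu).

Lemma affine_substitution (f : R -> R) x y : x <= y -> {within `[2 * x - nu, 2 * y - nu], continuous f} ->
  Rintegral leb `[2 * x - nu, 2 * y - nu] f = Rintegral leb `[x, y] (fun t => f (2 * t - nu) * 2).
Proof.
move=> xy cf; pose F (t : R) := 2 * t - nu.
have dF t : der F t 2.
  by apply: der_eq (derB (derZ 2 (der_id t)) (der_cst nu t)) _; rewrite mulr1 subr0.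
have F'E : derive1 F = fun=> 2 by apply/funext => t; rewrite derive1E; case: (dF t).
have cF t : {for t, continuous F} by exact: der_continuous (dF t).
rewrite /Rintegral -[2 * x - nu]/(F x) -[2 * y - nu]/(F y).
rewrite (@integration_by_substitution_increasing _ F f x y xy).
- by congr fine; apply: eq_integral => t _; rewrite /= F'E.
- by move=> u v _ _ uv; rewrite /F ltrD2r ltr_pM2l.
- by rewrite F'E => t _; exact: cvg_cst.
- by rewrite F'E; exact: is_cvg_cst.
- by rewrite F'E; exact: is_cvg_cst.
- split.
  + by move=> t _; case: (dF t).
  + by apply: cvg_at_right_filter; exact: cF.
  + by apply: cvg_at_left_filter; exact: cF.
- exact: cf.
Qed.

Lemma cover_half_line (s : R) (m : R) : 0 < m -> let D (n : nat) := `[m / n.+1%:R - s, m * n.+1%:R - s]%classic : set R in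
  [/\ forall n, measurable (D n), forall n, D n `<=` `]- s, +oo[%classic,
   forall x, `]- s, +oo[%classic x -> \forall n \near \oo, D n x &
   forall n k, (n <= k)%N -> D n `<=` D k].
Proof.
move=> m0 D; split=> [n|n x|x|n k nk x].
- exact: measurable_itv.
- rewrite /D /= !in_itv/= andbT => /andP[h _]; rewrite (lt_le_trans _ h)//.
  by rewrite ltrBrDr addNr divr_gt0.
- rewrite /= in_itv/= andbT => sx; have xs : 0 < x + s by rewrite -subr_gt0 opprK in sx.
  near=> n; rewrite /D /= in_itv/= lerBlDr lerBrDr; apply/andP; split.
    rewrite ler_pdivrMr// -ler_pdivrMl//; apply: (@le_trans _ _ n%:R); last by rewrite ler_nat.
    near: n; exact: nbhs_infty_ger.
  rewrite -ler_pdivrMl//; apply: (@le_trans _ _ n%:R); last by rewrite ler_nat.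
  near: n; exact: nbhs_infty_ger.
- rewrite /D /= !in_itv/= => /andP[h1 h2]; apply/andP; split.
    apply: le_trans h1; rewrite lerD2r ler_wpM2l ?(ltW m0)// lef_pV2 ?posrE// ler_nat ltnS//.
  by apply: le_trans h2 _; rewrite lerD2r ler_wpM2l ?(ltW m0)// ler_nat ltnS.
Unshelve. all: by end_near. Qed.

(** The substitution [x = 2 * t - nu], made on compact intervals that exhaust both half-lines. *)
Lemma gamma_norm : Rintegral leb setT (fun x => \1_U x * w x) = 2 `^ a * Gamma a.
Proof.
have [mD DU UD ndD] := @cover_half_line nu 2 (ltr0n R 2).
have [mD' DU' UD' ndD'] := @cover_half_line 0 1 ltr01.
have c1 := cover_cvg mD DU UD (measurable_wt a 2^-1 nu) (itg_wt nu a_gt0 half_gt0).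
have c2 := cover_cvg mD' DU' UD' (measurable_wt a 1 0) (itg_wt 0 a_gt0 ltr01).
have -> : 2 `^ a * Gamma a = 2 `^ a * Rintegral leb setT (fun x => \1_(`]- 0, +oo[%classic) x * wt a 1 0 x).
  congr (_ * _); rewrite -(Rintegral_itv_indic _ (measurable_itv _)) oppr0 /Gamma.
  by apply: eq_Rintegral => t _; rewrite /wt !addr0 mul1r.
apply: (cvg_unique _ c1) => //.
have : 2 `^ a * Rintegral leb `[1 / n.+1%:R - 0, 1 * n.+1%:R - 0] (wt a 1 0) @[n --> \oo] -->
   2 `^ a * Rintegral leb setT (fun x => \1_(`]- 0, +oo[%classic) x * wt a 1 0 x) by exact: cvgMr.
apply: cvg_trans; apply: near_eq_cvg; apply: nearW => n /=.
rewrite !subr0 !mul1r.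
have n1 : n.+1%:R^-1 <= n.+1%:R :> R by rewrite (@le_trans _ _ 1)// ?invf_le1// ler1n.
have n0 : 0 < n.+1%:R^-1 :> R by rewrite invr_gt0.
have I : leb.-integrable `[n.+1%:R^-1, n.+1%:R] (EFin \o wt a 1 0).
  apply: continuous_compact_integrable; first exact: segment_compact.
  apply: continuous_in_subspaceT => x; rewrite inE/= in_itv/= => /andP[h _].
  by apply: continuous_wt; rewrite addr0 (lt_le_trans n0).
rewrite [RHS]affine_substitution//; last first.
  apply: continuous_in_subspaceT => x; rewrite inE/= in_itv/= => /andP[h _].
  by apply: continuous_wt; rewrite (@lt_le_trans _ _ (2 / n.+1%:R)) ?divr_gt0// -lerBlDr.
rewrite -RintegralZl//; apply: eq_Rintegral => t; rewrite inE/= in_itv/= => /andP[h _].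
have t0 : 0 < t by rewrite (lt_le_trans n0).
rewrite /wt !subrK !addr0 !mul1r powRM ?(ltW t0)// mulKf//.
rewrite -(mulr_powRB1 _ a_gt0)//; ring.
Qed.

Lemma centered_gamma_pdfE x : centered_gamma_pdf nu x = \1_U x * w x / (2 `^ a * Gamma a).
Proof. by rewrite /centered_gamma_pdf /wt /a (mulrC 2^-1) (mulrC (\1_U x)) mulrAC. Qed.

Lemma gamma_norm_gt0 : 0 < 2 `^ a * Gamma a.
Proof. by rewrite -gamma_norm; exact: wt_mass_gt0. Qed.

Lemma itg_centered_gamma_pdf : itg leb (centered_gamma_pdf nu).
Proof.
by apply: itg_ext (itgZr (2 `^ a * Gamma a)^-1 (itg_wt nu a_gt0 half_gt0)) => x; rewrite centered_gamma_pdfE.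
Qed.

Lemma centered_gamma_mass : centered_gamma nu setT = 1%E.
Proof.
rewrite /centered_gamma.
have -> : (\int[leb]_x (centered_gamma_pdf nu x)%:E = (Rintegral leb setT (centered_gamma_pdf nu))%:E)%E.
  exact: E_EFin itg_centered_gamma_pdf.
congr EFin; transitivity (Rintegral leb setT (fun x => \1_U x * w x * (2 `^ a * Gamma a)^-1)).
  by apply: eq_Rintegral => x _; exact: centered_gamma_pdfE.
rewrite EZr; last exact: itg_wt.
by rewrite gamma_norm mulfV// gt_eqF// gamma_norm_gt0.
Qed.

Definition gamma_prob := centered_gamma nu.
HB.instance Definition _ := Measure.on gamma_prob.
HB.instance Definition _ := Measure_isProbability.Build _ _ _ gamma_prob centered_gamma_mass.

Lemma gamma_probE (f : R -> R) : measurable_fun setT f ->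
  (itg gamma_prob f <-> itg leb (fun x => f x * centered_gamma_pdf nu x)) /\
  (itg gamma_prob f ->
   Rintegral gamma_prob setT f = Rintegral leb setT (fun x => f x * centered_gamma_pdf nu x)).
Proof.
move=> mf.
(* The density lemma is applied on another copy of the measurable real line; pushing forward along
   the identity moves the law there. *)
pose g_ : {measure set (measurableTypeR R) -> \bar R} :=
  pushforward gamma_prob (id : R -> measurableTypeR R).
pose g := g_ (@measurable_id _ R setT).
have gE A : measurable A -> g A = (\int[leb]_(x in A) (centered_gamma_pdf nu x)%:E)%E by [].
have p0 := @centered_gamma_pdf_ge0 R nu; have mp := measurable_centered_gamma_pdf nu.
have [I e] := @law_transfer _ _ _ (measurableTypeR R) _ gamma_prob g
  (id : R -> measurableTypeR R) f (@measurable_id _ R setT) (fun _ _ => erefl) mf.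
have J := @itg_density _ (measurableTypeR R) _ leb g _ p0 mp gE f mf.
split; first by rewrite -J; exact: I.
by move=> /I If; rewrite -(@E_density _ (measurableTypeR R) _ leb g _ p0 mp gE f mf); exact: e.
Qed.

Lemma gamma_probE_itg (f : R -> R) : measurable_fun setT f ->
  itg leb (fun x => f x * centered_gamma_pdf nu x) -> itg gamma_prob f.
Proof. by move=> mf; have [[_ +] _] := gamma_probE mf. Qed.

Lemma gamma_moment : itg gamma_prob (fun x => x + nu).
Proof.
apply: gamma_probE_itg; first exact: measurable_funD.
apply: itg_ext (itgZr (2 `^ a * Gamma a)^-1 (itg_wt1 nu a_gt0 half_gt0)) => x.
by rewrite centered_gamma_pdfE; ring.
Qed.

End gamma_law.

(** * The Stein equation *)

Section stein_kernel.
Context (R : realType) (nu : R).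
Hypothesis nu_gt0 : 0 < nu.
Local Notation leb := (@lebesgue_measure R).
Local Notation Q := (uniform_prob (@ltr01 R)).
Local Notation E f := (Rintegral Q setT f).
Let b := 2 / nu.
Let b_gt0 : 0 < b. Proof. by rewrite divr_gt0. Qed.

(* The image of the uniform law under tpow has density proportional to
   t^(nu/2 - 1) on [0, 1]. *)
Definition tpow (s : R) : R := Num.min 1 (Num.max 0 s) `^ b.

Lemma tpow_ge0 s : 0 <= tpow s. Proof. exact: powR_ge0. Qed.

Lemma tpow_le1 s : tpow s <= 1.
Proof.
rewrite (_ : 1 = 1 `^ b); last by rewrite powR1.
rewrite ge0_ler_powR ?(ltW b_gt0)// ?nnegrE ?ler01//.
  by rewrite le_min ler01 le_max lexx.
by rewrite ge_min lexx.
Qed.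

Lemma measurable_tpow : measurable_fun setT tpow.
Proof.
apply: (measurableT_comp (measurable_powR _)); apply: measurable_minr => //.
by apply: measurable_maxr.
Qed.

Lemma tpowE s : 0 <= s <= 1 -> tpow s = s `^ b.
Proof. by move=> /andP[s0 s1]; rewrite /tpow max_r// min_r. Qed.

Lemma unifE (f : R -> R) : measurable_fun setT f -> E f = Rintegral leb `[0, 1] f.
Proof.
move=> mf.
rewrite (Rintegral_itv_indic _ (measurable_itv _)).
rewrite (@E_density _ (measurableTypeR R) _ leb Q (uniform_pdf 0 1) _ _ _ f mf)//.
- apply: eq_Rintegral => x _; rewrite indic_itvE in_itv/= /uniform_pdf mulrC.
  by case: ifP => h; rewrite ?subr0 ?invr1.
- move=> x; exact: uniform_pdf_ge0.
- exact: measurable_uniform_pdf.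
Qed.

(* In the variable u = x + nu the variation of constants formula for
   2 u f' - (u - nu) f = k gives
   f(u) = u^(-nu/2) e^(u/2) / 2 * int_0^u k(v - nu) v^(nu/2 - 1) e^(-v/2) dv;
   rescaling v = u t yields a formula that also makes sense for u <= 0. *)
Definition ker (k : R -> R) x s := k ((x + nu) * tpow s - nu) * expR ((x + nu) * (1 - tpow s) / 2).
Definition dker (k k' : R -> R) x s :=
  (tpow s * k' ((x + nu) * tpow s - nu) + (1 - tpow s) / 2 * k ((x + nu) * tpow s - nu)) *
  expR ((x + nu) * (1 - tpow s) / 2).
Definition sol k x := nu^-1 * E (ker k x).
Definition dsol k k' x := nu^-1 * E (dker k k' x).

Section kernel_estimates.
Variables (k k' : R -> R) (C : R).
Hypotheses (dk : forall z, der k z (k' z)) (ck' : continuous k').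
Hypotheses (kC : forall z, `|k z| <= C * (nu + `|z + nu|)) (k'1 : forall z, `|k' z| <= 1).

Let ck : continuous k. Proof. by move=> z; exact: der_continuous (dk z). Qed.

Let C0 : 0 <= C.
Proof.
have := le_trans (normr_ge0 _) (kC (- nu)); rewrite addNr normr0 addr0.
by rewrite pmulr_lge0.
Qed.

Let mt : measurable_fun setT tpow := measurable_tpow.

Lemma measurable_ker x : measurable_fun setT (ker k x).
Proof.
apply: measurable_funM.
  apply: (measurableT_comp (continuous_measurable ck)).
  by apply: measurable_funB => //; exact: measurable_funM.
apply: measurableT_comp => //; apply: measurable_funM => //; apply: measurable_funM => //.
exact: measurable_funB.
Qed.

Lemma measurable_dker x : measurable_fun setT (dker k k' x).
Proof.
have m1 : measurable_fun setT (fun s => (x + nu) * tpow s - nu).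
  by apply: measurable_funB => //; exact: measurable_funM.
have m2 : measurable_fun setT (fun s => 1 - tpow s) by exact: measurable_funB.
apply: measurable_funM.
  apply: measurable_funD; apply: measurable_funM => //.
  - exact: (measurableT_comp (continuous_measurable ck')).
  - exact: measurable_funM.
  - exact: (measurableT_comp (continuous_measurable ck)).
by apply: measurableT_comp => //; apply: measurable_funM => //; apply: measurable_funM.
Qed.

Let arg_le x s : `|k ((x + nu) * tpow s - nu)| <= C * (nu + `|x + nu| * tpow s).
Proof. by apply: le_trans (kC _) _; rewrite subrK normrM (ger0_norm (tpow_ge0 s)). Qed.

Let arg_le' x s : `|k ((x + nu) * tpow s - nu)| <= C * (nu + `|x + nu|).
Proof. by apply: le_trans (arg_le x s) _; rewrite ler_wpM2l// lerD2l ler_piMr// tpow_le1. Qed.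

Let exp_le x s : expR ((x + nu) * (1 - tpow s) / 2) <= expR (`|x + nu| / 2).
Proof.
rewrite ler_expR ler_wpM2r// (le_trans (ler_norm _))// normrM ler_piMr//.
by rewrite ger0_norm ?subr_ge0 ?tpow_le1// gerBl tpow_ge0.
Qed.

Lemma ker_le x s : `|ker k x s| <= C * (nu + `|x + nu|) * expR (`|x + nu| / 2).
Proof. by rewrite normrM (ger0_norm (expR_ge0 _)) ler_pM ?expR_ge0. Qed.

Lemma dker_le x s : `|dker k k' x s| <= (1 + C * (nu + `|x + nu|)) * expR (`|x + nu| / 2).
Proof.
rewrite normrM (ger0_norm (expR_ge0 _)) ler_pM ?expR_ge0//.
apply: le_trans (ler_normD _ _) _; apply: lerD; rewrite normrM.
  by rewrite -[leRHS]mulr1 ler_pM// ger0_norm ?tpow_ge0// tpow_le1.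
rewrite -[leRHS]mul1r ler_pM// ger0_norm ?divr_ge0 ?subr_ge0 ?tpow_le1//.
rewrite ler_pdivrMr// mul1r; have := tpow_ge0 s; lra.
Qed.

Lemma ker_der x s : der (ker k ^~ s) x (dker k k' x s).
Proof.
have d1 : der (fun x => (x + nu) * tpow s - nu) x (tpow s).
  apply: der_eq (derB (derM (derD (der_id x) (der_cst nu x)) (der_cst (tpow s) x)) (der_cst nu x)) _.
  by rewrite mulr0 !addr0 subr0 mul1r.
have d2 : der (fun x => (x + nu) * (1 - tpow s) / 2) x ((1 - tpow s) / 2).
  apply: der_eq (derM (derM (derD (der_id x) (der_cst nu x)) (der_cst (1 - tpow s) x)) (der_cst 2^-1 x)) _.
  by rewrite !mulr0 !addr0 mul1r.
apply: der_eq (derM (der_comp (dk _) d1) (der_comp (is_derive_expR _) d2)) _.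
by rewrite /dker; ring.
Qed.

Lemma itg_ker x : itg Q (ker k x).
Proof. by apply: (@itg_bounded _ _ _ Q _ _ (measurable_ker x)) => s; exact: ker_le. Qed.

Lemma itg_dker x : itg Q (dker k k' x).
Proof. by apply: (@itg_bounded _ _ _ Q _ _ (measurable_dker x)) => s; exact: dker_le. Qed.

(** Differentiation under the uniform law; the derivative of the kernel is bounded by one constant
    [M] for all points within distance [1] of [x]. *)
Lemma sol_der x : der (sol k) x (dsol k k' x).
Proof.
apply: derZ.
pose M := (1 + C * (nu + (`|x + nu| + 1))) * expR ((`|x + nu| + 1) / 2).
have d1E z s : partial1of2 (ker k) z s = dker k k' z s.
  by rewrite partial1of2E; case: (ker_der z s).
have I1 : x \in `]x - 1, x + 1[ by rewrite in_itv/= ltrBlDr ltrDl ltr01.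
have hG z s : `]x - 1, x + 1[%classic z -> [set: R] s -> `|partial1of2 (ker k) z s| <= M.
  rewrite /= in_itv/= => /andP[z1 z2] _; rewrite d1E; apply: le_trans (dker_le z s) _.
  have zx : `|z + nu| <= `|x + nu| + 1.
    have -> : z + nu = (x + nu) + (z - x) by ring.
    by apply: le_trans (ler_normD _ _) _; rewrite lerD2l ler_norml; apply/andP; split; lra.
  rewrite ler_pM ?expR_ge0 ?addr_ge0 ?mulr_ge0 ?addr_ge0 ?(ltW nu_gt0)//.
    by rewrite lerD2l ler_wpM2l// lerD2l.
  by rewrite ler_expR ler_wpM2r.
have M0 : 0 <= M by apply: le_trans (hG x 0 I1 I).
have iker z : `]x - 1, x + 1[%classic z -> Q.-integrable setT (EFin \o ker k z) by move=> _; exact: itg_ker.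
have iG : Q.-integrable setT (EFin \o (fun _ : R => M)) by exact: (itg_cst Q M).
have dker' z s : `]x - 1, x + 1[%classic z -> [set: R] s -> derivable (ker k ^~ s) z 1.
  by move=> _ _; case: (ker_der z s).
have := @derivable_under_integral R _ _ Q (ker k) setT measurableT x _ _ I1 iker dker' (fun=> M) (fun=> M0) iG hG.
have := @differentiation_under_integral R _ _ Q (ker k) setT measurableT x _ _ I1 iker dker' (fun=> M) (fun=> M0) iG hG.
rewrite derive1E => e dF; split; first exact: dF.
by rewrite e; apply: eq_Rintegral => s _; exact: d1E.
Qed.

(** The derivative in [s] of [s * ker k x s], written with t = s^b: the second summand arises from s
    (s^b)' = b s^b. *)
Let tker t (x : R) := (k ((x + nu) * t - nu) +
   b * (t * ((x + nu) * k' ((x + nu) * t - nu) - (x + nu) / 2 * k ((x + nu) * t - nu)))) *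
  expR ((x + nu) * (1 - t) / 2).

Let der_tker x z : 0 < z ->
  der (fun s => s * (k ((x + nu) * s `^ b - nu) * expR ((x + nu) * (1 - s `^ b) / 2))) z (tker (z `^ b) x).
Proof.
move=> z0; have dp : der (fun s => s `^ b) z (b * z `^ (b - 1)) := is_derive1_powR b z0.
have d1 : der (fun s => (x + nu) * s `^ b - nu) z ((x + nu) * (b * z `^ (b - 1))).
  by apply: der_eq (derB (derZ (x + nu) dp) (der_cst nu z)) _; rewrite subr0.
have d2 : der (fun s => (x + nu) * (1 - s `^ b) / 2) z (- ((x + nu) * (b * z `^ (b - 1)) / 2)).
  apply: der_eq (derM (derZ (x + nu) (derB (der_cst 1 z) dp)) (der_cst 2^-1 z)) _.
  by rewrite sub0r mulr0 addr0; ring.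
apply: der_eq (derM (der_id z) (derM (der_comp (dk _) d1) (der_comp (is_derive_expR _) d2))) _.
by rewrite /tker -(mulr_powRB1 (ltW z0) b_gt0); ring.
Qed.

Let tker_continuous x z : 0 < z -> {for z, continuous (fun s => tker (s `^ b) x)}.
Proof.
move=> z0; have dp : der (fun s => s `^ b) z (b * z `^ (b - 1)) := is_derive1_powR b z0.
have cp : {for z, continuous (fun s => s `^ b)} by exact: der_continuous dp.
apply: (@continuous_comp _ _ _ (fun s => s `^ b) (tker ^~ x)); first exact: cp.
have c1 : {for z `^ b, continuous (fun t => (x + nu) * t - nu)}.
  by apply: cvgB; [apply: cvgMr; exact: cvg_id|exact: cvg_cst].
have c2 : {for z `^ b, continuous (fun t => k ((x + nu) * t - nu))}.
  by apply: (@continuous_comp _ _ _ (fun t => (x + nu) * t - nu) k); [exact: c1|exact: ck].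
have c3 : {for z `^ b, continuous (fun t => k' ((x + nu) * t - nu))}.
  by apply: (@continuous_comp _ _ _ (fun t => (x + nu) * t - nu) k'); [exact: c1|exact: ck'].
apply: cvgM.
  apply: cvgD; first exact: c2.
  apply: cvgMr; apply: cvgM; first exact: cvg_id.
  by apply: cvgB; apply: cvgMr.
have d2 t : der (fun t => (x + nu) * (1 - t) / 2) t (- (x + nu) / 2).
  apply: der_eq (derM (derZ (x + nu) (derB (der_cst 1 t) (der_id t))) (der_cst 2^-1 t)) _.
  by rewrite mulr0 addr0 sub0r mulrN1.
exact: der_continuous (der_comp (is_derive_expR _) (d2 _)).
Qed.

Let measurable_tker x : measurable_fun setT (fun s => tker (tpow s) x).
Proof.
have m1 : measurable_fun setT (fun s => (x + nu) * tpow s - nu).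
  by apply: measurable_funB => //; exact: measurable_funM.
have m2 := measurableT_comp (continuous_measurable ck) m1.
have m3 := measurableT_comp (continuous_measurable ck') m1.
apply: measurable_funM.
  apply: measurable_funD; first exact: m2.
  apply: measurable_funM => //; apply: measurable_funM => //.
  by apply: measurable_funB; apply: measurable_funM.
apply: measurableT_comp => //; apply: measurable_funM => //; apply: measurable_funM => //.
exact: measurable_funB.
Qed.

Let tker_itg x : itg Q (fun s => tker (tpow s) x).
Proof.
pose M := (C * (nu + `|x + nu|) + b * (`|x + nu| + `|x + nu| / 2 * (C * (nu + `|x + nu|)))) * expR (`|x + nu| / 2).
apply: (@itg_bounded _ _ _ Q _ M (measurable_tker x)) => s.
rewrite normrM (ger0_norm (expR_ge0 _)) ler_pM ?expR_ge0//.
apply: le_trans (ler_normD _ _) _; apply: lerD => //.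
rewrite normrM (gtr0_norm b_gt0) ler_wpM2l ?(ltW b_gt0)// normrM -[leRHS]mul1r.
rewrite ler_pM//; first by rewrite ger0_norm ?tpow_ge0// tpow_le1.
apply: le_trans (ler_normB _ _) _; rewrite lerD// normrM; first by rewrite -[leRHS]mulr1 ler_pM.
by rewrite normrM (ger0_norm (_ : 0 <= 2^-1))// ler_pM.
Qed.

(** At [s = 1] the primitive [s * ker k x s] equals [k x], since the exponent vanishes there; near
    [s = 0] the factor [s] beats the bounded kernel. The derivative is taken for [s > 0], hence the
    exhaustion of []0, 1]]. *)
Lemma sol_ibp x : E (fun s => tker (tpow s) x) = k x.
Proof.
rewrite unifE//.
pose h s := tker (tpow s) x; pose D (n : nat) := `[n.+1%:R^-1 : R, 1]%classic : set R.
pose U := `]0, 1]%classic : set R.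
have i01 : leb.-integrable `[0, 1] (EFin \o h).
  apply/(itg_indic (measurable_itv _) (measurable_tker x)).
  have := (@itg_density _ (measurableTypeR R) _ leb Q (uniform_pdf 0 1)
    (fun x => uniform_pdf_ge0 x ltr01) (measurable_uniform_pdf _ _) (fun _ _ => erefl) h (measurable_tker x)).1 (tker_itg x).
  apply: itg_ext => s; rewrite indic_itvE in_itv/= /uniform_pdf mulrC.
  by case: ifP => _; rewrite ?subr0 ?invr1.
have iU : leb.-integrable U (EFin \o h).
  apply: (integrableS _ _ _ i01); [exact: measurable_itv|exact: measurable_itv|].
  by move=> s; rewrite /U /= !in_itv/= => /andP[/ltW -> ->].
rewrite -Rintegral_itv_obnd_cbnd; last exact: iU.
have mU : measurable U by exact: measurable_itv.
rewrite (Rintegral_itv_indic _ mU).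
have mD n : measurable (D n) by exact: measurable_itv.
have DU n : D n `<=` U.
  by move=> s; rewrite /D /U /= !in_itv/= => /andP[h1 ->]; rewrite andbT (lt_le_trans _ h1)// invr_gt0.
have UD s : U s -> \forall n \near \oo, D n s.
  rewrite /U /= in_itv/= => /andP[s0 s1]; near=> n; rewrite /D /= in_itv/= s1 andbT.
  rewrite -[leRHS]invrK lef_pV2 ?posrE ?invr_gt0//.
  apply: (@le_trans _ _ n%:R); last by rewrite ler_nat.
  near: n; exact: nbhs_infty_ger.
have c1 := cover_cvg mD DU UD (measurable_tker x) ((itg_indic mU (measurable_tker x)).2 iU).
apply: (cvg_unique _ c1) => //.
pose G s := s * (k ((x + nu) * s `^ b - nu) * expR ((x + nu) * (1 - s `^ b) / 2)).
have n0 n : 0 < n.+1%:R^-1 :> R by rewrite invr_gt0.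
have n1 n : n.+1%:R^-1 <= 1 :> R by rewrite invf_le1 ?ler1n.
have e n : Rintegral leb (D n) h = k x - G n.+1%:R^-1.
  have [|z /andP[nz _]|_ ee] := @FTC_on _ G (fun s => tker (s `^ b) x) _ _ (n1 n).
  - by move=> z /andP[nz _]; apply: der_tker; exact: lt_le_trans nz.
  - by apply: tker_continuous; exact: lt_le_trans nz.
  transitivity (G 1 - G n.+1%:R^-1).
    rewrite -ee; apply: eq_Rintegral => s; rewrite inE /D /= in_itv/= => /andP[s0 s1].
    by rewrite /h tpowE// s1 (le_trans _ s0)// ltW.
  by rewrite /G powR1 !mulr1 subrr mulr0 mul0r expR0 mulr1 mul1r addrK.
rewrite (_ : (fun n => _) = fun n => k x - G n.+1%:R^-1); last by apply/funext.
suff G0 : G n.+1%:R^-1 @[n --> \oo] --> 0.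
  by have := cvgB (cvg_cst (k x)) G0; rewrite subr0; apply.
apply: (@le_dist_cvg _ _ (fun n => n.+1%:R^-1 * (C * (nu + `|x + nu|) * expR (`|x + nu| / 2)))) => [n|].
  rewrite subr0 /G normrM gtr0_norm// ler_wpM2l ?(ltW (n0 n))//.
  by rewrite -tpowE ?(ltW (n0 n)) ?n1//; exact: ker_le.
by rewrite -[X in _ --> X](mul0r (C * (nu + `|x + nu|) * expR (`|x + nu| / 2))); apply: cvgMl; exact: cvg_harmonic.
Unshelve. all: by end_near. Qed.

(** The choice [b = 2 / nu] makes the integrands on the left combine to [tker] pointwise in [s]. *)
Lemma sol_ode x : 2 * (x + nu) * dsol k k' x - x * sol k x = k x.
Proof.
rewrite -[RHS]sol_ibp.
have I1 := itg_dker x; have I2 := itg_ker x.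
transitivity (E (fun s => 2 * (x + nu) / nu * dker k k' x s - x / nu * ker k x s)).
  rewrite EB; [|exact: itgZl..]; rewrite !EZl// /dsol /sol; ring.
by apply: eq_Rintegral => s _; rewrite /dker /ker /tker /b; field; rewrite gt_eqF.
Qed.

End kernel_estimates.
(* For k z = z the Stein equation has the constant solution -1. *)
Lemma ker_one x : E (fun s => (nu - (x + nu) * tpow s) * expR ((x + nu) * (1 - tpow s) / 2)) = nu.
Proof.
have nu0 : nu != 0 by rewrite gt_eqF.
have d1 z : der (fun _ : R => 1 : R) z 0 by exact: der_cst.
have c0 : continuous (fun _ : R => 0 : R) by move=> z; exact: cvg_cst.
have b1 z : `|1 : R| <= nu^-1 * (nu + `|z + nu|).
  by rewrite normr1 mulrDr mulVf// lerDl mulr_ge0// invr_ge0 ltW.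
have b2 (z : R) : `|0 : R| <= 1 by rewrite normr0.
(* For [k = 1] the integrand [tker], multiplied by [nu], is the present one because [b * nu = 2]. *)
have := sol_ibp d1 c0 b1 b2 x => e.
transitivity (E (fun s => nu * ((1 + b * (tpow s * ((x + nu) * 0 - (x + nu) / 2 * 1))) *
    expR ((x + nu) * (1 - tpow s) / 2)))).
  by apply: eq_Rintegral => s _; rewrite /b; field.
rewrite EZl ?e ?mulr1//.
apply: (@itg_bounded _ _ _ Q _ ((1 + b * (`|x + nu| / 2)) * expR (`|x + nu| / 2))) => [|s].
  apply: measurable_funM.
    apply: measurable_funD => //; apply: measurable_funM => //; apply: measurable_funM => //.
    exact: measurable_tpow.
  apply: measurableT_comp => //; apply: measurable_funM => //; apply: measurable_funM => //.
  by apply: measurable_funB => //; exact: measurable_tpow.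
have t0 := tpow_ge0 s; have t1 := tpow_le1 s.
rewrite normrM (ger0_norm (expR_ge0 _)) ler_pM ?expR_ge0//.
  apply: le_trans (ler_normD _ _) _; rewrite normr1 lerD2l normrM (gtr0_norm b_gt0).
  rewrite ler_wpM2l ?(ltW b_gt0)// mulr0 sub0r ?mulr1 mulrN normrN !normrM (ger0_norm t0).
  by rewrite (ger0_norm (_ : 0 <= 2^-1))// ler_piMl.
rewrite ler_expR ler_wpM2r// (le_trans (ler_norm _))// normrM ler_piMr//.
by rewrite ger0_norm ?subr_ge0// gerBl.
Qed.

Section bounds.
Variables (k k' : R -> R) (C : R).
Hypotheses (dk : forall z, der k z (k' z)) (ck' : continuous k').
Hypotheses (kC : forall z, `|k z| <= C * (nu + `|z + nu|)) (k'1 : forall z, `|k' z| <= 1).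
Hypothesis k_mean0 : Rintegral leb setT (fun x => k x * centered_gamma_pdf nu x) = 0.
Hypothesis k_itg : itg leb (fun x => k x * centered_gamma_pdf nu x).

Let ck : continuous k. Proof. by move=> z; exact: der_continuous (dk z). Qed.

Let C0 : 0 <= C.
Proof.
have := le_trans (normr_ge0 _) (kC (- nu)); rewrite addNr normr0 addr0.
by rewrite pmulr_lge0.
Qed.

Let iker x := itg_ker dk kC x.
Let solD x := sol_der dk kC k'1 x.
Let solO x := sol_ode dk ck' kC k'1 x.

Lemma sol_le_norm x B : E (fun s => `|ker k x s|) <= nu * B -> `|sol k x| <= B.
Proof.
move=> h; rewrite /sol normrM ger0_norm ?invr_ge0 ?(ltW nu_gt0)// ler_pdivrMl//.
exact: le_trans (le_normE (iker x)) h.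
Qed.

(** For [x + nu <= 0] the growth bound on [k] is [C] times the positive integrand of [ker_one],
    whose integral is exactly [nu]. *)
Lemma sol_neg x : x + nu <= 0 -> `|sol k x| <= C.
Proof.
move=> u0; apply: sol_le_norm.
have I : itg Q (fun s => (nu - (x + nu) * tpow s) * expR ((x + nu) * (1 - tpow s) / 2)).
  apply: (@itg_bounded _ _ _ Q _ ((nu + `|x + nu|) * expR (`|x + nu| / 2))) => [|s].
    have mt := measurable_tpow; apply: measurable_funM.
      by apply: measurable_funB => //; exact: measurable_funM.
    apply: measurableT_comp => //; apply: measurable_funM => //; apply: measurable_funM => //.
    exact: measurable_funB.
  have t0 := tpow_ge0 s; have t1 := tpow_le1 s.
  rewrite normrM (ger0_norm (expR_ge0 _)) ler_pM ?expR_ge0//.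
    apply: le_trans (ler_normB _ _) _; rewrite (gtr0_norm nu_gt0) lerD2l normrM (ger0_norm t0).
    by rewrite ler_piMr.
  rewrite ler_expR ler_wpM2r// (le_trans (ler_norm _))// normrM ler_piMr//.
  by rewrite ger0_norm ?subr_ge0// gerBl.
rewrite mulrC -[X in C * X](ker_one x) -EZl//.
apply: le_E => [||s]; [exact: itg_norm|exact: itgZl|].
rewrite normrM (ger0_norm (expR_ge0 _)) mulrA ler_wpM2r ?expR_ge0//.
apply: le_trans (kC _) _; rewrite subrK ler_wpM2l// lerD2l normrM (ger0_norm (tpow_ge0 s)).
by rewrite ler0_norm// mulNr.
Qed.

Lemma sol_mid x : `|sol k x| <= nu^-1 * (C * (nu + `|x + nu|) * expR (`|x + nu| / 2)).
Proof.
apply: sol_le_norm; rewrite mulVKf ?gt_eqF//.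
rewrite -[leRHS](E_cst Q); apply: le_E => [||s].
- exact: itg_norm.
- exact: itg_cst.
- exact: ker_le.
Qed.

Let a := nu / 2.
Let a_gt0 : 0 < a. Proof. exact: divr_gt0. Qed.
Local Notation w := (wt a 2^-1 nu).
Local Notation p := (pt a 2^-1 nu).

Let der_p x : 0 < x + nu -> der p x (- (x / 2 * w x)).
Proof.
by move=> x0; apply: der_eq (der_pt 2^-1 a_gt0 x0) _; rewrite /a; field.
Qed.

(** [p] is the integrating factor of the Stein equation and [e] a sign. Subtracting the constant [K]
    from the solution adds [K * x] to the datum, which makes its sign known for [x >= 1]. *)
Let der_psol e K x : 0 < x + nu ->
  der (fun x => p x * (e * sol k x - K)) x (w x * (e * k x + K * x) / 2).
Proof.
move=> x0; apply: der_eq (derM (der_p x0) (derB (derZ e (solD x)) (der_cst K x))) _.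
by have e1 := solO x; rewrite subr0 (ptE 2^-1 a_gt0 x0) -[k x]e1; field.
Qed.

Let psol_FTC e K x y : x <= y -> 0 < x + nu ->
  leb.-integrable `[x, y] (EFin \o (fun x => w x * (e * k x + K * x) / 2)) /\
  Rintegral leb `[x, y] (fun x => w x * (e * k x + K * x) / 2) =
  p y * (e * sol k y - K) - p x * (e * sol k x - K).
Proof.
move=> xy x0; have pos z : x <= z -> 0 < z + nu by move=> xz; rewrite (lt_le_trans x0)// lerD2r.
apply: (FTC_on (f := fun x => p x * (e * sol k x - K)) xy) => z /andP[/pos zs _]; first exact: der_psol.
apply: cvgMl; apply: cvgM; first exact: continuous_wt.
by apply: cvgD; apply: cvgMr; [exact: ck|exact: cvg_id].
Qed.

Let p_cvg0 : p (n.+1%:R - nu) @[n --> \oo] --> 0.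
Proof.
pose m := Num.truncn a.
have am : a <= m.+1%:R by rewrite ltW// truncnS_gt.
apply: (@le_dist_cvg _ _ (fun n => 2 ^+ m.+2 * m.+2%:R ^+ m.+2 * n.+1%:R^-1)) => [n|]; last first.
  by rewrite -[X in _ --> X](mulr0 (2 ^+ m.+2 * m.+2%:R ^+ m.+2)); apply: cvgMr; exact: cvg_harmonic.
rewrite subr0 ger0_norm ?pt_ge0// /pt subrK; set y : R := n.+1%:R.
have y1 : 1 <= y by rewrite ler1n.
have y0 : 0 < y by rewrite (lt_le_trans ltr01).
apply: (@le_trans _ _ (y ^+ m.+1 * expR (- (2^-1 * y)))).
  by rewrite ler_wpM2r ?expR_ge0// -powR_mulrn ?(ltW y0)// ler_powR.
rewrite expRN ler_pdivrMr ?expR_gt0// mulrAC ler_pdivlMr// -exprSr.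
have -> : y ^+ m.+2 = 2 ^+ m.+2 * (2^-1 * y) ^+ m.+2.
  by rewrite -exprMn mulVKf.
rewrite -[leRHS]mulrA ler_wpM2l ?exprn_ge0// exp_ge_pow//.
by rewrite mulr_ge0// ltW.
Qed.

(** The mean zero condition enters here. Since [p] vanishes at [- nu] and the solution stays bounded
    there, [p * sol k] is the integral of [w * k / 2] from [- nu]; its limit at infinity is half the
    total integral of [w * k], that is zero. *)
Let psol_cvg0 : p (n.+1%:R - nu) * sol k (n.+1%:R - nu) @[n --> \oo] --> 0.
Proof.
have [mD DU UD ndD] := @cover_half_line _ nu 1 ltr01.
set U := `]- nu, +oo[%classic in DU UD.
have mU : measurable U by exact: measurable_itv.
have mwk : measurable_fun setT (fun x => w x * k x / 2).
  by do 2 apply: measurable_funM => //; [exact: measurable_wt|exact: continuous_measurable].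
have wkE x : \1_U x * (w x * k x / 2) = (2 `^ a * Gamma a / 2) * (k x * centered_gamma_pdf nu x).
  rewrite centered_gamma_pdfE -/a; move: (2 `^ a * Gamma a) (gamma_norm_gt0 nu_gt0) => g g0.
  by field; rewrite gt_eqF.
have IU : itg leb (fun x => \1_U x * (w x * k x / 2)).
  by apply: itg_ext (itgZl (2 `^ a * Gamma a / 2) k_itg) => x; rewrite wkE.
have := cover_cvg mD DU UD mwk IU.
rewrite (_ : Rintegral leb setT _ = 0); last first.
  under eq_Rintegral do rewrite wkE.
  by rewrite EZl// k_mean0 mulr0.
move=> c1.
have e n : p (n.+1%:R - nu) * sol k (n.+1%:R - nu) =
  Rintegral leb `[1 / n.+1%:R - nu, 1 * n.+1%:R - nu] (fun x => w x * k x / 2) +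
   p (n.+1%:R^-1 - nu) * sol k (n.+1%:R^-1 - nu).
  rewrite div1r mul1r.
  have n1 : n.+1%:R^-1 - nu <= n.+1%:R - nu.
    by rewrite lerD2r (@le_trans _ _ 1)// ?invf_le1// ler1n.
  have n0 : 0 < n.+1%:R^-1 - nu + nu by rewrite subrK invr_gt0.
  have [_] := psol_FTC 1 0 n1 n0.
  rewrite !mul1r !subr0 => e1; apply/eqP; rewrite -subr_eq; apply/eqP; rewrite -e1.
  by apply: eq_Rintegral => x _; rewrite mul1r mul0r addr0.
rewrite (_ : (fun n => _) = fun n =>
   Rintegral leb `[1 / n.+1%:R - nu, 1 * n.+1%:R - nu] (fun x => w x * k x / 2) +
   p (n.+1%:R^-1 - nu) * sol k (n.+1%:R^-1 - nu)); last exact/funext.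
suff c2 : p (n.+1%:R^-1 - nu) * sol k (n.+1%:R^-1 - nu) @[n --> \oo] --> 0.
  by have := cvgD c1 c2; rewrite addr0; apply.
pose B := nu^-1 * (C * (nu + 1) * expR (1 / 2)).
have B0 : 0 <= B by rewrite mulr_ge0 ?invr_ge0 ?(ltW nu_gt0)// mulr_ge0 ?expR_ge0// mulr_ge0// addr_ge0// ltW.
apply: (@le_dist_cvg _ _ (fun n => B * p (n.+1%:R^-1 - nu))) => [n|]; last first.
  by rewrite -[X in _ --> X](mulr0 B); apply: cvgMr; exact: pt_cvg0.
rewrite subr0 normrM ger0_norm ?pt_ge0// mulrC ler_wpM2r ?pt_ge0//.
have n1 : n.+1%:R^-1 <= 1 :> R by rewrite invf_le1 ?ler1n.
apply: le_trans (sol_mid _) _; rewrite subrK ger0_norm// ler_wpM2l ?invr_ge0 ?(ltW nu_gt0)//.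
rewrite ler_pM ?expR_ge0 ?mulr_ge0 ?addr_ge0 ?(ltW nu_gt0)//.
  by rewrite ler_wpM2l// lerD2l.
by rewrite ler_expR ler_wpM2r.
Qed.

(** [K] is chosen so that [|k z| <= K * z] for [z >= 1]. Then [p * (e * sol k - K)] is nondecreasing
    from [1] on and tends to zero, so it is nonpositive. *)
Lemma sol_pos e x : `|e| = 1 -> 1 <= x -> e * sol k x <= C * (2 * nu + 1).
Proof.
move=> e1 x1; set K := C * (2 * nu + 1).
have x0 : 0 < x + nu by rewrite addr_gt0// (lt_le_trans ltr01).
have px : 0 < p x by rewrite mulr_gt0 ?expR_gt0// powR_gt0.
rewrite -subr_le0 -(pmulr_rle0 _ px).
pose G x := p x * (e * sol k x - K).
have cG : G (n.+1%:R - nu) @[n --> \oo] --> 0.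
  have c1 : e * (p (n.+1%:R - nu) * sol k (n.+1%:R - nu)) @[n --> \oo] --> e * 0 by exact: cvgMr.
  have c2 : p (n.+1%:R - nu) * K @[n --> \oo] --> 0 * K by exact: cvgMl.
  have c3 : e * (p (n.+1%:R - nu) * sol k (n.+1%:R - nu)) - p (n.+1%:R - nu) * K @[n --> \oo] -->
    e * 0 - 0 * K by exact: cvgB.
  rewrite mulr0 mul0r subrr in c3; apply: cvg_trans c3.
  by apply: near_eq_cvg; apply: nearW => n; rewrite /G /=; ring.
have c0 : G x @[n --> \oo] --> G x by exact: cvg_cst.
apply: (ler_cvg_to c0 cG); near=> n.
have xn : x <= n.+1%:R - nu.
  rewrite lerBrDr; apply: (@le_trans _ _ n%:R); last by rewrite ler_nat.
  near: n; exact: nbhs_infty_ger.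
have [_] := psol_FTC e K xn x0; rewrite -/(G x) -/(G (n.+1%:R - nu)) => ee.
rewrite -subr_ge0 -ee; apply: Rintegral_ge0 => z; rewrite /= in_itv/= => /andP[xz _].
have z1 : 1 <= z by rewrite (le_trans x1).
rewrite divr_ge0// mulr_ge0 ?wt_ge0//.
have h : `|e * k z| <= K * z.
  rewrite normrM e1 mul1r; apply: le_trans (kC z) _; rewrite /K -mulrA ler_wpM2l//.
  rewrite ger0_norm; last by rewrite addr_ge0 ?(ltW nu_gt0)// (le_trans ler01).
  have : nu * 1 <= nu * z by rewrite ler_wpM2l// ltW.
  lra.
have := le_trans (ler_norm (- (e * k z))) (_ : _ <= K * z).
rewrite normrN => /(_ h); lra.
Unshelve. all: by end_near. Qed.

(** The summands belong to the ranges [- nu < x < 1], [x >= 1] and [x <= - nu], in this order. *)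
Definition sol_bound := C * (2 * nu + 1) * expR ((nu + 1) / 2) / nu + C * (2 * nu + 1) + C.

Lemma sol_le x : `|sol k x| <= sol_bound.
Proof.
have n1 : 0 <= 2 * nu + 1 by rewrite addr_ge0// mulr_ge0// ltW.
have p1 : 0 <= C * (2 * nu + 1) * expR ((nu + 1) / 2) / nu.
  by rewrite divr_ge0 ?mulr_ge0 ?expR_ge0// ltW.
have p2 : 0 <= C * (2 * nu + 1) by rewrite mulr_ge0.
rewrite /sol_bound; have [u0|u0] := leP (x + nu) 0.
  by apply: le_trans (sol_neg u0) _; rewrite lerDr addr_ge0.
have [x1|x1] := leP 1 x.
  apply: (@le_trans _ _ (C * (2 * nu + 1))); last by rewrite -addrA addrCA lerDl addr_ge0.
  rewrite ler_norml lerNl -mulN1r -[X in _ && (X <= _)]mul1r.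
  by rewrite !sol_pos ?normrN ?normr1.
apply: le_trans (sol_mid x) _; rewrite -addrA.
apply: (@le_trans _ _ (C * (2 * nu + 1) * expR ((nu + 1) / 2) / nu)); last first.
  by rewrite lerDl addr_ge0.
have q0 : 0 <= C * (nu + (x + nu)) by apply: mulr_ge0 => //; apply: addr_ge0; exact: ltW.
have q1 : C * (nu + (x + nu)) <= C * (2 * nu + 1) by rewrite ler_wpM2l//; lra.
have q2 : expR ((x + nu) / 2) <= expR ((nu + 1) / 2) by rewrite ler_expR ler_wpM2r//; lra.
by rewrite gtr0_norm// mulrC ler_wpM2r ?invr_ge0 ?(ltW nu_gt0)// ler_pM ?expR_ge0.
Qed.

(** The first summand bounds the integral formula for [|x + nu| <= 1]; the second comes from
    dividing the equation by [2 * (x + nu)] elsewhere. *)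
Definition dsol_bound := (1 + C * (nu + 1)) * expR (2^-1) / nu + (nu + 1) * (sol_bound + C) / 2.

Lemma dsol_le x : `|dsol k k' x| <= dsol_bound.
Proof.
have M0 : 0 <= sol_bound by exact: le_trans (sol_le x).
have q1 : 0 <= (1 + C * (nu + 1)) * expR (2^-1) / nu.
  by rewrite divr_ge0 ?(ltW nu_gt0)// mulr_ge0 ?expR_ge0// addr_ge0// mulr_ge0// addr_ge0// ltW.
have q2 : 0 <= (nu + 1) * (sol_bound + C) / 2.
  by rewrite divr_ge0// mulr_ge0// addr_ge0// ltW.
have [u1|u1] := leP `|x + nu| 1.
  rewrite /dsol_bound; apply: (@le_trans _ _ ((1 + C * (nu + 1)) * expR (2^-1) / nu)); last by rewrite lerDl.
  rewrite /dsol normrM ger0_norm ?invr_ge0 ?(ltW nu_gt0)// mulrC ler_wpM2r ?invr_ge0 ?(ltW nu_gt0)//.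
  have I := itg_dker dk ck' kC k'1 x.
  apply: le_trans (le_normE I) _; rewrite -[leRHS](E_cst Q); apply: le_E => [||s].
  - exact: itg_norm.
  - exact: itg_cst.
  - apply: le_trans (dker_le kC k'1 x s) _.
    rewrite ler_pM ?expR_ge0 ?addr_ge0 ?mulr_ge0 ?addr_ge0 ?(ltW nu_gt0)//.
      by rewrite lerD2l ler_wpM2l// lerD2l.
    by rewrite ler_expR ler_pdivrMr// mulVf.
apply: (@le_trans _ _ ((nu + 1) * (sol_bound + C) / 2)); last by rewrite /dsol_bound lerDr.
have u0 : 0 < `|x + nu| by rewrite (lt_trans ltr01).
rewrite ler_pdivlMr// -(ler_pM2r u0).
have -> : `|dsol k k' x| * 2 * `|x + nu| = `|k x + x * sol k x|.
  by rewrite -(solO x) subrK !normrM (ger0_norm (_ : 0 <= 2))//; ring.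
apply: le_trans (ler_normD _ _) _; rewrite normrM.
have xu : `|x| <= nu + `|x + nu|.
  by rewrite -{1}(addrK nu x) (le_trans (ler_normB _ _))// (gtr0_norm nu_gt0) addrC.
have h1 := kC x; have h2 := sol_le x.
have h3 : `|x| * `|sol k x| <= (nu + `|x + nu|) * sol_bound by rewrite ler_pM.
have h4 : nu + `|x + nu| <= (nu + 1) * `|x + nu|.
  by rewrite mulrDl mul1r lerD2r ler_peMr ?(ltW nu_gt0)// ltW.
apply: le_trans (lerD h1 h3) _; rewrite mulrC -mulrDr [X in _ <= X]mulrAC [C + _]addrC.
by apply: ler_wpM2r => //; exact: addr_ge0.
Qed.

End bounds.
End stein_kernel.

Lemma lip_continuous (R : realType) (f : R -> R) :
  (forall x t, `|f (x + t) - f x| <= `|t|) -> continuous f.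
Proof.
move=> fL x; apply/cvgrPdist_le => e e0; near=> y.
have := fL x (y - x); rewrite addrCA subrr addr0 distrC => h.
apply: le_trans h _; rewrite distrC; near: y; exact: cvgr_dist_le.
Unshelve. all: by end_near. Qed.

Lemma lip_der_le (R : realType) (f : R -> R) x l :
  (forall t, `|f (x + t) - f x| <= `|t|) -> der f x l -> `|l| <= 1.
Proof.
move=> fL [df <-]; rewrite ['D_1 f x]/derive.
pose q t : R := t^-1 *: ((f \o shift x) (t *: 1) - f x).
have c : `|q t| @[t --> 0^'] --> `|lim (q t @[t --> 0^'])| by exact: (cvg_norm df).
apply: (cvgr_to_le c); near=> t; rewrite /q /=.
have t0 : t != 0 by near: t; exact: nbhs_dnbhs_neq.
have := fL t; rewrite normrM normfV ler_pdivrMl ?normr_gt0// mulr1.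
have -> : t *: 1 = t :> R by exact: mulr1.
by rewrite [t + x]addrC.
Unshelve. all: by end_near. Qed.

Section centered_stein.
Context (R : realType) (nu : R).
Hypothesis nu_gt0 : 0 < nu.
Local Notation leb := (@lebesgue_measure R).
Local Notation pdf := (centered_gamma_pdf nu).

Definition gamma_mean (f : R -> R) := Rintegral leb setT (fun z => f z * pdf z).

Let itg_pdf : itg leb pdf := itg_centered_gamma_pdf nu_gt0.

Let pdf0 z : 0 <= pdf z. Proof. exact: centered_gamma_pdf_ge0. Qed.

Lemma pdf_mass : Rintegral leb setT pdf = 1.
Proof.
have := centered_gamma_mass nu_gt0; rewrite /centered_gamma (E_EFin itg_pdf).
by move=> [].
Qed.

Definition gamma_abs_moment := gamma_mean (fun z => `|z + nu|).
Definition growth_const := 1 + gamma_abs_moment / nu.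

Lemma itg_gamma_abs_moment : itg leb (fun z => `|z + nu| * pdf z).
Proof.
have m : measurable_fun setT (fun z : R => `|z + nu|).
  by apply: measurableT_comp => //; exact: measurable_funD.
by have [[+ _] _] := gamma_probE nu_gt0 m; apply; apply: itg_norm; exact: gamma_moment.
Qed.

Lemma gamma_abs_moment_ge0 : 0 <= gamma_abs_moment.
Proof. by apply: E_ge0 => z; rewrite mulr_ge0. Qed.

Definition C1_lip1 (f f' : R -> R) :=
  [/\ forall z, der f z (f' z), continuous f' & forall z, `|f' z| <= 1].

Section lipschitz_mean.
Variable f : R -> R.
Hypothesis fL : forall x t, `|f (x + t) - f x| <= `|t|.

Let fnu (z : R) : `|f z - f (- nu)| <= `|z + nu|.
Proof. by have := fL (- nu) (z + nu); rewrite addrCA addNr addr0. Qed.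

Lemma lip_itg : itg leb (fun z => f z * pdf z).
Proof.
apply: (@le_itg _ _ _ leb _ (fun z => `|f (- nu)| * pdf z + `|z + nu| * pdf z)).
- apply: measurable_funM; last exact: measurable_centered_gamma_pdf.
  by apply: continuous_measurable; exact: lip_continuous.
- by apply: itgD; [exact: itgZl|exact: itg_gamma_abs_moment].
- move=> z; rewrite normrM (ger0_norm (pdf0 z)) -mulrDl ler_wpM2r//.
  rewrite -(subrK (f (- nu)) (f z)) addrC; apply: le_trans (ler_normD _ _) _.
  by rewrite lerD2l; exact: fnu.
Qed.

Lemma gamma_mean_dist x : `|f x - gamma_mean f| <= growth_const * (nu + `|x + nu|).
Proof.
have h : `|f (- nu) - gamma_mean f| <= gamma_abs_moment.
  have -> : f (- nu) - gamma_mean f = Rintegral leb setT (fun z => f (- nu) * pdf z - f z * pdf z).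
    by rewrite EB ?EZl ?pdf_mass ?mulr1//; [exact: itgZl|exact: lip_itg].
  apply: le_normE_le; [by apply: itgB; [exact: itgZl|exact: lip_itg]|exact: itg_gamma_abs_moment|move=> z].
  rewrite -mulrBl normrM (ger0_norm (pdf0 z)) ler_wpM2r// distrC.
  exact: fnu.
have h2 := fnu x.
rewrite -(subrK (f (- nu)) (f x)) -addrA; apply: le_trans (ler_normD _ _) _.
apply: le_trans (lerD h2 h) _; rewrite /growth_const mulrDl mul1r mulrDr mulfVK ?gt_eqF//.
have q1 : 0 <= gamma_abs_moment / nu * `|x + nu| by rewrite mulr_ge0// divr_ge0 ?gamma_abs_moment_ge0// ltW.
by have q2 := ltW nu_gt0; lra.
Qed.
End lipschitz_mean.

Section solution.
Variables (f f' : R -> R).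
Hypothesis ff' : C1_lip1 f f'.

Lemma C1_lip1_lip x t : `|f (x + t) - f x| <= `|t|.
Proof.
case: ff' => df _ f'1; apply: le_trans (der_lip x (x + t) df f'1) _.
by rewrite mul1r addrAC subrr add0r.
Qed.

Let k z := f z - gamma_mean f.
Let dk z : der k z (f' z).
Proof. by case: ff' => df _ _; apply: der_eq (derB (df z) (der_cst _ z)) _; rewrite subr0. Qed.
Let kC z : `|k z| <= growth_const * (nu + `|z + nu|).
Proof. by apply: gamma_mean_dist; exact: C1_lip1_lip. Qed.
Let ck' : continuous f'. Proof. by case: ff'. Qed.
Let k'1 z : `|f' z| <= 1. Proof. by case: ff'. Qed.

Let k_itg : itg leb (fun x => k x * pdf x).
Proof.
apply: itg_ext (itgB (lip_itg C1_lip1_lip) (itgZl (gamma_mean f) itg_pdf)) => x.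
by rewrite mulrBl.
Qed.

Let k_mean0 : Rintegral leb setT (fun x => k x * pdf x) = 0.
Proof.
transitivity (Rintegral leb setT (fun x => f x * pdf x - gamma_mean f * pdf x)).
  by apply: eq_Rintegral => x _; rewrite mulrBl.
rewrite EB ?EZl ?pdf_mass ?mulr1 ?subrr//; [exact: (lip_itg C1_lip1_lip)|exact: itgZl].
Qed.

Definition stein_sol := sol nu (fun z => f z - gamma_mean f).
Definition dstein_sol := dsol nu (fun z => f z - gamma_mean f) f'.

Lemma stein_sol_der x : der stein_sol x (dstein_sol x).
Proof. exact: sol_der dk kC k'1 x. Qed.

Lemma stein_sol_ode x : 2 * (x + nu) * dstein_sol x - x * stein_sol x = f x - gamma_mean f.
Proof. exact: sol_ode dk ck' kC k'1 x. Qed.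

Lemma stein_sol_le x : `|stein_sol x| <= sol_bound nu growth_const.
Proof. exact: sol_le dk ck' kC k'1 k_mean0 k_itg x. Qed.

Lemma dstein_sol_le x : `|dstein_sol x| <= dsol_bound nu growth_const.
Proof. exact: dsol_le dk ck' kC k'1 k_mean0 k_itg x. Qed.

Lemma itg_centered_ker x : itg (uniform_prob (@ltr01 R)) (ker nu k x).
Proof. exact: itg_ker dk kC x. Qed.

End solution.

(** Linearity in the datum, in the form that serves difference quotients in the parameters. *)
Lemma stein_solZB a f f' g g' x : C1_lip1 f f' -> C1_lip1 g g' ->
  stein_sol (fun z => a * (f z - g z)) x = a * (stein_sol f x - stein_sol g x).
Proof.
move=> nf ng; have If := itg_centered_ker nf x; have Ig := itg_centered_ker ng x.
have If' := lip_itg (C1_lip1_lip nf); have Ig' := lip_itg (C1_lip1_lip ng).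
have e : gamma_mean (fun z => a * (f z - g z)) = a * (gamma_mean f - gamma_mean g).
  rewrite /gamma_mean -EB// -EZl; last exact: itgB.
  by apply: eq_Rintegral => z _; ring.
have -> : stein_sol (fun z => a * (f z - g z)) x =
    sol nu (fun z => a * (f z - g z) - a * (gamma_mean f - gamma_mean g)) x.
  by rewrite /stein_sol e.
move: If Ig; rewrite /stein_sol; move: (gamma_mean f) (gamma_mean g) => mf mg If Ig; clear If' Ig' e; rewrite /sol -mulrBr mulrCA -EB// -[in RHS]EZl; last exact: itgB.
congr (_ * _); apply: eq_Rintegral => z _; rewrite /ker; ring.
Qed.

End centered_stein.

Section stein_function.
Context (R : realType) (nu : R).
Hypothesis nu_gt0 : 0 < nu.
Variables (n : nat) (h : 'rV[R]_n.+1 -> R) (g : 'I_n.+1 -> 'rV[R]_n.+1 -> R).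
Local Notation e i := (delta_mx 0 i : 'rV[R]_n.+1).
Hypothesis h1 : lipc 1 h.
Hypothesis dh : forall i x t, der (fun s => h (x + s *: e i)) t (g i (x + t *: e i)).
Hypothesis g1 : forall i, lipc 1 (g i).

Definition set_head (x : 'rV[R]_n.+1) z := x + (z - x 0 ord0) *: e ord0.

Lemma set_head_id (x : 'rV[R]_n.+1) : set_head x (x 0 ord0) = x.
Proof. by rewrite /set_head subrr scale0r addr0. Qed.

Lemma set_headD (x : 'rV[R]_n.+1) z t : set_head x (z + t) = set_head x z + t *: e ord0.
Proof. by rewrite /set_head -[RHS]addrA -scalerDl addrAC. Qed.

Lemma delta_entry i (t : R) : (t *: e i) 0 ord0 = t * (ord0 == i)%:R.
Proof. by rewrite mxE mxE eqxx. Qed.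

Lemma set_head_shift0 (x : 'rV[R]_n.+1) t : set_head (x + t *: e ord0) = set_head x.
Proof.
apply/funext => z; rewrite /set_head mxE delta_entry eqxx mulr1 -addrA -scalerDl; congr (_ + _ *: _).
by ring.
Qed.

Lemma set_head_shift (x : 'rV[R]_n.+1) t z i : i != ord0 -> set_head (x + t *: e i) z = set_head x z + t *: e i.
Proof.
by move=> i0; rewrite /set_head mxE delta_entry eq_sym (negbTE i0) mulr0 addr0 addrAC.
Qed.

Definition centre (x : 'rV[R]_n.+1) := gamma_mean nu (fun z => h (set_head x z)).
Definition stein_fun (x : 'rV[R]_n.+1) := stein_sol nu (fun z => h (set_head x z)) (x 0 ord0).
Definition dstein_fun (x : 'rV[R]_n.+1) := dstein_sol nu (fun z => h (set_head x z)) (fun z => g ord0 (set_head x z)) (x 0 ord0).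

Let g_le i x : `|g i x| <= 1.
Proof.
have := dh i x 0; rewrite scale0r addr0; apply: lip_der_le => t.
by rewrite add0r scale0r addr0; have := h1 x i t; rewrite mul1r.
Qed.

Lemma C1_lip1_set_head (x : 'rV[R]_n.+1) : C1_lip1 (fun z => h (set_head x z)) (fun z => g ord0 (set_head x z)).
Proof.
split=> z; last exact: g_le.
- have := dh ord0 x (z - x 0 ord0).
  have := derB (der_id z) (der_cst (x 0 ord0) z); rewrite subr0 => d1 d2.
  by apply: der_eq (@der_comp _ _ (fun t => t - x 0 ord0) _ _ _ d2 d1) _; rewrite mulr1.
- move: z; apply: (@lip_continuous R (fun z => g ord0 (set_head x z))) => z t; rewrite set_headD.
  by have := g1 ord0 (set_head x z) ord0 t; rewrite mul1r.
Qed.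

Lemma centre_lipc : lipc 1 centre.
Proof.
move=> x i t; rewrite mul1r; have [->|i0] := eqVneq i ord0.
  by rewrite /centre set_head_shift0 subrr normr0.
have I1 := lip_itg nu_gt0 (C1_lip1_lip (C1_lip1_set_head (x + t *: e i))).
have I2 := lip_itg nu_gt0 (C1_lip1_lip (C1_lip1_set_head x)).
have I3 := itg_centered_gamma_pdf nu_gt0.
rewrite /centre /gamma_mean -EB// -[leRHS]mulr1 -(pdf_mass nu_gt0) -EZl//.
apply: le_normE_le; [exact: itgB|exact: itgZl|move=> z].
rewrite -mulrBl normrM (ger0_norm (centered_gamma_pdf_ge0 nu z)).
rewrite ler_wpM2r ?centered_gamma_pdf_ge0// set_head_shift//.
by have := h1 (set_head x z) i t; rewrite mul1r.
Qed.

Lemma stein_fun_der (x : 'rV[R]_n.+1) s : der (fun s => stein_fun (x + s *: e ord0)) s (dstein_fun (x + s *: e ord0)).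
Proof.
have := stein_sol_der nu_gt0 (C1_lip1_set_head x) (x 0 ord0 + s) => d.
have e1 t : (x + t *: e ord0) 0 ord0 = x 0 ord0 + t by rewrite mxE delta_entry eqxx mulr1.
by apply: der_ext (der_eq (der_shift d) _) => [t|]; rewrite /stein_fun /dstein_fun set_head_shift0 e1.
Qed.

Lemma stein_fun_ode (x : 'rV[R]_n.+1) : 2 * (x 0 ord0 + nu) * dstein_fun x - x 0 ord0 * stein_fun x = h x - centre x.
Proof. by rewrite (stein_sol_ode nu_gt0 (C1_lip1_set_head x)) set_head_id. Qed.

Definition stein_const := sol_bound nu (growth_const nu) + dsol_bound nu (growth_const nu).

(** Along the head coordinate this is the bound on the derivative of the solution. Along another
    axis the difference quotient of [stein_fun] is the solution for the difference quotient of [h];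
    that datum is 1-Lipschitz in the head because [g ord0] is 1-Lipschitz, and [stein_sol_le]
    applies to it. *)
Lemma stein_fun_lipc : lipc stein_const stein_fun.
Proof.
have s0 : 0 <= sol_bound nu (growth_const nu) by exact: le_trans (stein_sol_le nu_gt0 (C1_lip1_set_head 0) 0).
have s1 : 0 <= dsol_bound nu (growth_const nu) by exact: le_trans (dstein_sol_le nu_gt0 (C1_lip1_set_head 0) 0).
move=> x i t; have [->|i0] := eqVneq i ord0.
  have := der_lip 0 t (stein_fun_der x) (L := dsol_bound nu (growth_const nu)).
  rewrite scale0r addr0 subr0 => H; apply: le_trans (H _) _ => [s|].
    by apply: dstein_sol_le => //; exact: C1_lip1_set_head.
  by rewrite ler_wpM2r// lerDr.
have [->|t0] := eqVneq t 0; first by rewrite scale0r addr0 subrr normr0 mulr0.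
have n1 := C1_lip1_set_head x; have n2 := C1_lip1_set_head (x + t *: e i).
have n3 : C1_lip1 (fun z => t^-1 * (h (set_head (x + t *: e i) z) - h (set_head x z)))
  (fun z => t^-1 * (g ord0 (set_head (x + t *: e i) z) - g ord0 (set_head x z))).
  case: n1 n2 => d1 c1 _ [d2 c2 _]; split=> z.
  - exact: derZ (derB (d2 z) (d1 z)).
  - by apply: cvgMr; apply: cvgB; [exact: c2|exact: c1].
  - rewrite normrM normfV ler_pdivrMl ?normr_gt0// mulr1 set_head_shift//.
    by have := g1 ord0 (set_head x z) i t; rewrite mul1r.
have e1 : (x + t *: e i) 0 ord0 = x 0 ord0.
  by rewrite mxE delta_entry eq_sym (negbTE i0) mulr0 addr0.
have := stein_sol_le nu_gt0 n3 (x 0 ord0); rewrite (stein_solZB nu_gt0 _ _ n2 n1) normrM normfV.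
rewrite ler_pdivrMl ?normr_gt0// mulrC => H; rewrite /stein_fun e1; apply: le_trans H _.
by rewrite ler_wpM2r// lerDl.
Qed.

(** Where the coefficient [2 * (x 0 ord0 + nu)] is nonzero, the equation expresses [dstein_fun] by
    continuous functions. *)
Lemma dstein_fun_continuous (x : 'rV[R]_n.+1) : x 0 ord0 + nu != 0 -> {for x, continuous dstein_fun}.
Proof.
move=> u0.
pose u (y : 'rV[R]_n.+1) : R := y 0 ord0.
have cu : {for x, continuous u} by exact: coord_continuous.
have ch : {for x, continuous h} by exact: (lipc_continuous h1).
have cc : {for x, continuous centre} by exact: (lipc_continuous centre_lipc).
have cs : {for x, continuous stein_fun} by exact: (lipc_continuous stein_fun_lipc).
have cv : {for x, continuous (fun y => 2 * (u y + nu))}.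
  have c2 : 2 * (u y + nu) @[y --> x] --> 2 * (u x + nu).
    have c0 : u y + nu @[y --> x] --> u x + nu by exact: (cvgD cu (cvg_cst nu)).
    exact: (cvgM (cvg_cst (2 : R)) c0).
  exact: c2.
have v0 : 2 * (u x + nu) != 0 by rewrite mulf_neq0// pnatr_eq0.
have E y : 2 * (u y + nu) != 0 -> (h y - centre y + u y * stein_fun y) / (2 * (u y + nu)) = dstein_fun y.
  by move=> y0; rewrite -(stein_fun_ode y) subrK mulrC mulKf.
rewrite /prop_for /continuous_at -(E x v0).
have c1 : (h y - centre y + u y * stein_fun y) / (2 * (u y + nu)) @[y --> x] -->
   (h x - centre x + u x * stein_fun x) / (2 * (u x + nu)).
  exact: (cvgM (cvgD (cvgB ch cc) (cvgM cu cs)) (cvgV v0 cv)).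
have nv : \forall y \near x, 2 * (u y + nu) != 0 by exact: (@cvgr_neq0 R R^o _ (nbhs x) _ (fun y => 2 * (u y + nu)) _ cv v0).
apply: cvg_trans c1; apply: (@near_eq_cvg _ _ (nbhs x)); apply: (@filterS _ (nbhs x) _ _ _ _ nv) => y; exact: E.
Qed.

End stein_function.

(** * The distance d_2 *)

Section test_functions.
Context (R : realType) (n : nat).
Implicit Types (f h : 'rV[R]_n.+1 -> R) (x : 'rV[R]_n.+1).

Lemma euclidean_norm_delta i (t : R) : euclidean_norm (t *: delta_mx 0 i : 'rV[R]_n.+1) = `|t|.
Proof.
rewrite /euclidean_norm (bigD1 i)//= big1 ?addr0 => [|j ji].
  by rewrite !mxE !eqxx mulr1 sqrtr_sqr.
by rewrite !mxE (negbTE ji) mulr0 expr0n.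
Qed.

Lemma lip_le1 f : (lip f <= 1)%E -> lipc 1 f.
Proof.
move=> f1 x i t; have [->|t0] := eqVneq t 0.
  by rewrite scale0r addr0 subrr normr0 mulr0.
have xt : x + t *: delta_mx 0 i - x = t *: delta_mx 0 i by rewrite addrAC subrr add0r.
have : ((`|f (x + t *: delta_mx 0 i) - f x| / euclidean_norm (x + t *: delta_mx 0 i - x))%:E <= 1)%E.
  apply: le_trans f1; apply: ereal_sup_ubound.
  exists (x + t *: delta_mx 0 i, x) => //= e.
  have := congr1 (fun z : 'rV[R]_n.+1 => euclidean_norm (z - x)) e.
  rewrite xt subrr -(scale0r (delta_mx 0 i)) !euclidean_norm_delta normr0 => /eqP.
  by rewrite normr_eq0 (negbTE t0).
by rewrite lee_fin xt euclidean_norm_delta ler_pdivrMr ?normr_gt0.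
Qed.

(** In positive dimension the supremum runs over a nonempty set; over the empty set it would be
    [-oo]. *)
Lemma lip_ge0 f : (0 <= lip f)%E.
Proof.
apply: (@le_trans _ _ (`|f (1 *: delta_mx 0 ord0) - f 0| / euclidean_norm (1 *: delta_mx 0 ord0 - 0 : 'rV[R]_n.+1))%:E).
  by rewrite lee_fin divr_ge0// sqrtr_ge0.
apply: ereal_sup_ubound; exists (1 *: delta_mx 0 ord0, 0) => //= e.
have := congr1 (fun z : 'rV[R]_n.+1 => z 0 ord0) e.
by rewrite !mxE eqxx mulr1 => /eqP; rewrite oner_eq0.
Qed.

Lemma d2_testP h : d2_test h ->
  [/\ lipc 1 h, forall i x t, der (fun s => h (x + s *: (delta_mx 0 i : 'rV[R]_n.+1))) t
        (partial i h (x + t *: (delta_mx 0 i : 'rV[R]_n.+1)))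
    & forall i, lipc 1 (partial i h)].
Proof.
move=> [[dh _] h1].
have l'0 : (0 <= lip' h)%E.
  by rewrite /lip'; elim/big_rec : _ => // j y _ y0; rewrite le_max y0 orbT.
split=> [|i x t|i].
- by apply: lip_le1; apply: le_trans h1; rewrite leeDl.
- by apply: der_line; apply: DeriveDef.
- apply: lip_le1; apply: (@le_trans _ _ (lip' h)); last first.
    by apply: le_trans h1; rewrite leeDr// lip_ge0.
  by rewrite /lip'; exact: (le_bigmax _ (fun j => lip (partial j h))).
Qed.

End test_functions.

Section assembly.
Context (R : realType) (nu : R).
Hypothesis nu_gt0 : 0 < nu.
Context d (T : measurableType d) (P : probability T R) (n : nat).
Variables (X : {RV P >-> R}) (Y : 'I_n -> {RV P >-> R}).
Variable (h : 'rV[R]_n.+1 -> R).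
Local Notation E f := (Rintegral P setT f).
Hypothesis h_test : d2_test h.
Hypotheses (X2 : L2 P X) (Y2 : forall j, L2 P (Y j)).

Let h1 : lipc 1 h. Proof. by case: (d2_testP h_test). Qed.

Definition jointrow w : 'rV[R]_n.+1 := \row_i tnth (joint X Y w) i.

Lemma tnth_concat0 (z : R) (t : n.-tuple R) : tnth (concat (z, t)) ord0 = z.
Proof. by rewrite (tnth_nth 0). Qed.

Lemma tnth_concatS (z : R) (t : n.-tuple R) j : tnth (concat (z, t)) (lift ord0 j) = tnth t j.
Proof. by rewrite !(tnth_nth 0). Qed.

Lemma set_head_concat (t : n.-tuple R) z z' :
  set_head (\row_i tnth (concat (z, t)) i) z' = \row_i tnth (concat (z', t)) i.
Proof.
apply/rowP => i; rewrite /set_head !mxE eqxx andTb; case: (unliftP ord0 i) => [j ->|->].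
  by rewrite !tnth_concatS mulr0 addr0.
by rewrite !tnth_concat0 eqxx mulr1 addrC subrK.
Qed.

Lemma centre_set_head x z : centre nu h (set_head x z) = centre nu h x.
Proof.
rewrite /centre (_ : set_head (set_head x z) = set_head x)//; apply/funext => z'.
have -> : set_head (set_head x z) z' = set_head x z + (z' - z) *: delta_mx 0 ord0.
  by rewrite {1}/set_head; congr (_ + (_ - _) *: _); rewrite !mxE !eqxx mulr1 addrC subrK.
by rewrite -set_headD addrCA subrr addr0.
Qed.

Let hh (t : n.+1.-tuple R) := h (\row_i tnth t i).

Let mhh : measurable_fun setT hh.
Proof. exact: measurable_lipc h1. Qed.

Let centre1 : lipc 1 (centre nu h).
Proof. by have [a b c] := d2_testP h_test; exact: (centre_lipc nu_gt0 a b c). Qed.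

Let jointrow_L2 a : L2 P (fun w => tnth (joint X Y w) a).
Proof.
case: (unliftP ord0 a) => [j ->|->].
  by apply: L2_ext (Y2 j) => w; rewrite tnth_concatS tnth_mktuple.
by apply: L2_ext X2 => w; rewrite tnth_concat0.
Qed.

Lemma joint_itg phi : lipc 1 phi -> itg P (fun w => phi (jointrow w)).
Proof. by move=> p1; apply: L2_itg; exact: L2_row p1 jointrow_L2. Qed.

Lemma joint_law : (\int[distribution P (joint X Y)]_t (hh t)%:E = (E (fun w => h (jointrow w)))%:E)%E.
Proof.
rewrite -E_EFin; last exact: joint_itg.
rewrite (@integral_distribution _ _ _ _ _ P (joint X Y) (EFin \o hh))//.
  by apply/measurable_EFinP.
exact: joint_itg.
Qed.

Local Notation Q := (distribution P (random_vector Y)).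
Local Notation Gam := (gamma_prob nu).

Let F (z : R * n.-tuple R) := hh (concat z).

Let mF : measurable_fun setT F.
Proof. exact: (measurableT_comp mhh (@measurable_concat R n)). Qed.

Let mF2 z : measurable_fun setT (fun t => F (z, t)).
Proof. by apply: (measurableT_comp mF); exact: measurable_pair1. Qed.

Let mF1 t : measurable_fun setT (fun z => F (z, t)).
Proof. by apply: (measurableT_comp mF); exact: measurable_pair2. Qed.

Let Yrow_L2 z a : L2 P (fun w => tnth (concat (z, random_vector Y w)) a).
Proof.
case: (unliftP ord0 a) => [j ->|->].
  by apply: L2_ext (Y2 j) => w; rewrite tnth_concatS tnth_mktuple.
by apply: L2_ext (L2_cst P z) => w; rewrite tnth_concat0.
Qed.

Let lawY (f : n.-tuple R -> R) : measurable_fun setT f ->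
  (itg P (fun w => f (random_vector Y w)) <-> itg Q f) /\
  (itg Q f -> E (fun w => f (random_vector Y w)) = Rintegral Q setT f).
Proof.
move=> mf; apply: (@law_transfer _ _ _ _ _ P Q) => //.
Qed.

Let FQ z : itg Q (fun t => F (z, t)).
Proof. 
apply/(lawY (mF2 z)).1; apply: L2_itg.
exact: (L2_row h1 (Yrow_L2 z)).
Qed.

Let F_dist z z' t : `|F (z, t) - F (z', t)| <= `|z - z'|.
Proof.
rewrite /F /hh -(set_head_concat t z' z) /set_head.
by have := h1 (\row_i tnth (concat (z', t)) i) ord0 (z - z'); rewrite mul1r mxE tnth_concat0.
Qed.

Let gam_lip (f : R -> R) : (forall x t, `|f (x + t) - f x| <= `|t|) -> itg Gam f.
Proof.
move=> fL; apply: gamma_probE_itg => //; last exact: lip_itg.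
by apply: continuous_measurable; exact: lip_continuous.
Qed.

Let FG t : itg Gam (fun z => F (z, t)).
Proof. 
apply: gam_lip => x s; apply: le_trans (F_dist _ _ _) _.
by rewrite addrAC subrr add0r.
Qed.

Let K (z : R) := Rintegral Q setT (fun t => `|F (- nu, t)|) + `|z + nu|.

Let IK : itg Gam K.
Proof. by apply: itgD; [exact: itg_cst|apply: itg_norm; exact: gamma_moment]. Qed.

Let FK z : Rintegral Q setT (fun t => `|F (z, t)|) <= K z.
Proof.
have I1 := itg_norm (FQ (- nu)).
rewrite /K -[X in _ + X](E_cst Q) -ED//; last exact: itg_cst.
apply: le_E => [||t]; [exact: itg_norm|by apply: itgD => //; exact: itg_cst|].
rewrite -[F (z, t)](subrK (F (- nu, t))) addrC; apply: le_trans (ler_normD _ _) _.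
by rewrite lerD2l -[X in z + X]opprK.
Qed.

Let F_mean t : Rintegral Gam setT (fun z => F (z, t)) = centre nu h (\row_i tnth (concat (0, t)) i).
Proof.
have [_ ->] := gamma_probE nu_gt0 (mF1 t); last exact: FG.
rewrite /centre /gamma_mean; apply: eq_Rintegral => z _.
by rewrite set_head_concat.
Qed.

(** By Fubini, integrating the head against the Gamma law gives [centre], which depends on the other
    coordinates only, so any head may be put in, in particular [X]. *)
Lemma tensor_law_integral :
  (\int[tensor_law (centered_gamma nu) Q]_t (hh t)%:E = (E (fun w => centre nu h (jointrow w)))%:E)%E.
Proof.
have IF : itg (Gam \x Q)%E F by exact: (itg_prod IK mF FQ FK).
have mc := @measurable_concat R n.
have mhhE : measurable_fun setT (EFin \o hh) by exact/measurable_EFinP.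
have -> : (\int[tensor_law (centered_gamma nu) Q]_t (hh t)%:E =
    \int[pushforward (Gam \x Q) (@concat R n)]_t (hh t)%:E)%E.
  exact: eq_measure_integral.
rewrite (@integral_pushforward _ _ _ _ _ _ mc _ setT (EFin \o hh) mhhE)//.
rewrite preimage_setT.
transitivity (\int[Gam \x Q]_z (F z)%:E)%E; first by [].
rewrite -integral21_prod_meas1//.
have mcen : measurable_fun setT (fun t : n.-tuple R => centre nu h (\row_i tnth (concat (0, t)) i)).
  have := measurable_lipc centre1 => m; apply: (measurableT_comp m).
  apply: (measurableT_comp mc); exact: measurable_pair1.
have [Ic Ec] := lawY mcen.
have Ip : itg P (fun w => centre nu h (\row_i tnth (concat (0, random_vector Y w)) i)).
  by apply: L2_itg; exact: (L2_row centre1 (Yrow_L2 0)).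
transitivity (Rintegral Q setT (fun t => centre nu h (\row_i tnth (concat (0, t)) i)))%:E.
  rewrite -E_EFin; last exact/Ic.
  by apply: eq_integral => t _; have := E_EFin (FG t); rewrite F_mean.
rewrite -Ec; last exact/Ic.
suff -> : (fun w => centre nu h (jointrow w)) =
  (fun w => centre nu h (\row_i tnth (concat (0, random_vector Y w)) i)) by [].
by apply/funext => w; rewrite /jointrow /joint -(set_head_concat _ 0) centre_set_head.
Qed.

(** By the formulas for the two integrals the difference is the expectation of [h - centre nu h],
    the right-hand side of the Stein equation. *)
Lemma test_dist (H : completeNormedModType R) (ip : inner_product H) (W : H -> {RV P >-> R})
  (LX : {RV P >-> R}) (DLX DX : T -> H) (DY : 'I_n -> T -> H) :
  isonormal ip W -> separable H -> ('E_P[X] = 0)%E ->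
  pinv_OU ip W X LX -> malliavin ip W 2 LX DLX ->
  malliavin ip W 2 X DX -> (forall j, malliavin ip W 2 (Y j) (DY j)) ->
  (`| \int[distribution P (joint X Y)]_t (hh t)%:E -
      \int[tensor_law (centered_gamma nu) Q]_t (hh t)%:E | <=
   (stein_const nu * E (fun w => `|2 * (X w + nu) - ip (DLX w) (DX w)|) +
    stein_const nu * \sum_(j < n) E (fun w => `|ip (DLX w) (DY j w)|))%:E)%E.
Proof.
move=> isoW sepH EX XLX DLXP DXP DYP.
have [_ b c] := d2_testP h_test.
rewrite joint_law tensor_law_integral -EFinB abse_EFin lee_fin -EB; [|exact: joint_itg..].
pose Z (a : 'I_n.+1) := if unlift ord0 a is Some j then Y j else X.
pose DZ (a : 'I_n.+1) := if unlift ord0 a is Some j then DY j else DX.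
have DZP a : malliavin ip W 2 (Z a) (DZ a) by rewrite /Z /DZ; case: unlift.
have XZ w : X w = Z ord0 w by rewrite /Z unlift_none.
have [_] := stein_bound isoW sepH X2 EX XLX DLXP DZP XZ (stein_fun_lipc nu_gt0 h1 b c)
  (stein_fun_der nu_gt0 h1 b c) (dstein_fun_continuous nu_gt0 h1 b c) (stein_fun_ode nu_gt0 h1 b c).
have -> : jointrow = fun w => \row_b Z b w.
  apply/funext => w; apply/rowP => a; rewrite !mxE /Z; case: (unliftP ord0 a) => [j ->|->].
    by rewrite tnth_concatS tnth_mktuple.
  by rewrite tnth_concat0.
rewrite /DZ unlift_none; congr (_ <= _ + _ * _).
by apply: eq_bigr => j _; rewrite liftK.
Qed.

End assembly.

(** Cauchy-Schwarz when the second moment is finite; otherwise the right-hand side is infinite. *)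
Lemma L1_le_poweR d (T : measurableType d) (R : realType) (P : probability T R) (f : T -> R) :
  measurable_fun setT f ->
  ((Rintegral P setT (fun w => `|f w|))%:E <= (\int[P]_w (f w ^+ 2)%:E) `^ 2^-1)%E.
Proof.
move=> mf; have m2 : measurable_fun setT (fun w => f w ^+ 2) by exact: measurable_funX.
have [oo|foo] := leP +oo%E (\int[P]_w (f w ^+ 2)%:E)%E.
  move: oo; rewrite leye_eq => /eqP ->.
  by rewrite poweRyr ?leey // invr_eq0.
have I2 : itg P (fun w => f w ^+ 2) by apply: itg_ge0 => // w; exact: sqr_ge0.
by rewrite (E_EFin I2) poweR_EFin lee_fin powR12_sqrt ?E_sqr_ge0// L2_L1_le.
Qed.

Theorem theorem1 (R : realType) (nu : R) (nu_gt0 : 0 < nu) :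
  exists C : R, 0 < C /\
  forall (H : completeNormedModType R) (ip : inner_product H)
    (d : measure_display) (T : measurableType d) (P : probability T R)
    (W : H -> {RV P >-> R}) (n : nat)
    (X : {RV P >-> R}) (Y : 'I_n -> {RV P >-> R})
    (LX : {RV P >-> R}) (DLX DX : T -> H) (DY : 'I_n -> T -> H),
  separable H -> isonormal ip W -> (1 <= n)%N ->
  ('E_P[X] = 0)%E -> (forall j, 'E_P[Y j] = 0)%E ->
  sobolev ip W 2 X -> (forall j, sobolev ip W 2 (Y j)) ->
  pinv_OU ip W X LX -> malliavin ip W 2 LX DLX ->
  malliavin ip W 2 X DX -> (forall j, malliavin ip W 2 (Y j) (DY j)) ->
  let lhs :=
    d2 (distribution P (joint X Y))
       (tensor_law (centered_gamma nu) (distribution P (random_vector Y))) in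
  (lhs <=
     C%:E * 'E_P[fun w => (`|2 * (X w + nu) - ip (DLX w) (DX w)|)%R]
     + C%:E * \sum_(j < n) 'E_P[fun w => (`|ip (DLX w) (DY j w)|)%R])%E /\
  (sobolev ip W 4 X -> (forall j, sobolev ip W 4 (Y j)) ->
   (lhs <=
     C%:E * 'E_P[fun w => ((2 * (X w + nu) - ip (DLX w) (DX w)) ^+ 2)%R] `^ 2^-1
     + C%:E * \sum_(j < n) 'E_P[fun w => (ip (DLX w) (DY j w) ^+ 2)%R] `^ 2^-1)%E).
Proof.
(* [stein_const] depends on [nu] only; the absolute value and the added [1] make the constant
   positive. *)
pose C := `|stein_const nu| + 1.
have C0 : 0 < C by rewrite ltr_wpDl.
exists C; split=> // H ip d T P W n X Y LX DLX DX DY sepH isoW _ EX _ _ _ XLX DLXP DXP DYP lhs.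
have X2 : L2 P X by have [] := malliavin_approx sepH DXP.
have Y2 j : L2 P (Y j) by have [] := malliavin_approx sepH (DYP j).
have DLX2 : hL2 P DLX by have [] := malliavin_approx sepH DLXP.
have DX2 : hL2 P DX by have [] := malliavin_approx sepH DXP.
have DY2 j : hL2 P (DY j) by have [] := malliavin_approx sepH (DYP j).
have I0 : itg P (fun w => 2 * (X w + nu) - ip (DLX w) (DX w)).
  apply: itgB; last exact: hL2_inner.
  by apply: itgZl; apply: itgD; [exact: L2_itg|exact: itg_cst].
have I1 j : itg P (fun w => ip (DLX w) (DY j w)) by exact: hL2_inner.
pose A := Rintegral P setT (fun w => `|2 * (X w + nu) - ip (DLX w) (DX w)|).
pose B j := Rintegral P setT (fun w => `|ip (DLX w) (DY j w)|).
have le1 : (lhs <= C%:E * A%:E + C%:E * \sum_(j < n) (B j)%:E)%E.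
  apply: ge_ereal_sup => _ [h h_test <-].
  apply: le_trans (test_dist nu_gt0 h_test X2 Y2 isoW sepH EX XLX DLXP DXP DYP) _.
  rewrite sumEFin -!EFinM -EFinD lee_fin; apply: lerD; apply: ler_wpM2r.
  - exact: E_ge0.
  - by rewrite (le_trans (ler_norm _))// lerDl.
  - by apply: sumr_ge0 => j _; exact: E_ge0.
  - by rewrite (le_trans (ler_norm _))// lerDl.
split=> [|_ _].
  rewrite unlock (E_EFin (itg_norm I0)).
  rewrite (eq_bigr (fun j => (B j)%:E))// => j _.
  exact: E_EFin (itg_norm (I1 j)).
apply: le_trans le1 _; apply: leeD; apply: lee_wpmul2l; rewrite ?lee_fin ?(ltW C0)//.
  by rewrite unlock; exact: L1_le_poweR (itg_meas I0).
by apply: lee_sum => j _; rewrite unlock; exact: L1_le_poweR (itg_meas (I1 j)).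
Qed.
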